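(* Let $(R,\mathfrak m)$ be a non-Gorenstein Cohen-Macaulay local ring of dimension $d\ge 1$ with infinite residue field, and let $I$ be a canonical ideal of $R$. Let $\mathfrak C_R$ be the set of all canonical ideals of $R$ and $\operatorname{Max}(\mathfrak C_R)$ the set of its maximal elements with respect to inclusion. (a) If $I\notin \operatorname{Max}(\mathfrak C_R)$, then for any $T\in\mathfrak C_R$ properly containing $I$ one has $I=xT$ for some regular element $x\in\mathfrak m$, where $xR=(I:_R T)$. In particular, $I\subseteq \mathfrak m^2$. (b) If $K\in\mathfrak C_R$ and $x\in K$ is an $R$-regular element, then there exists $y\in I$ such that $yK=xI$. In this situation, $xR$ is a reduction of $K$ if and only if $yR$ is a reduction of $I$. (c) Suppose $\dim R=1$. If $\operatorname{red}(\mathfrak m)=t$, then $\mathfrak m^{t+1}$ does not contain any element of $\operatorname{Max}(\mathfrak C_R)$. In particular, if $R$ has minimal multiplicity, then the non-maximal canonical ideals of $R$ (those not in $\operatorname{Max}(\mathfrak C_R)$) are exactly the canonical ideals contained in $\mathfrak m^2$.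
   Context: Rings are commutative Noetherian. A canonical module of a $d$-dimensional Cohen-Macaulay local ring $(R,\mathfrak m,k)$ is a maximal Cohen-Macaulay module $\omega$ with $\dim_k\operatorname{Ext}^i_R(k,\omega)=\delta_{id}$. A canonical ideal of $R$ is an ideal of $R$ isomorphic to a canonical module. An ideal $J\subseteq I$ is a reduction of $I$ if $I^{n+1}=JI^n$ for some $n\ge 0$. In dimension one with infinite residue field, $\operatorname{red}(\mathfrak m)$ (the reduction number of $\mathfrak m$) is the least $t\ge 0$ such that $\mathfrak m^{t+1}=x\mathfrak m^t$ for some $x\in\mathfrak m$. A one-dimensional Cohen-Macaulay local ring has minimal multiplicity if $\mu(\mathfrak m)=e^0_{\mathfrak m}(R)$, where $\mu$ is the minimal number of generators and $e^0_{\mathfrak m}(R)$ the multiplicity; when the residue field is infinite this means $\mathfrak m^2=x\mathfrak m$ for some $x\in\mathfrak m$ generating a reduction of $\mathfrak m$. *)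

(* Defs.v *)
From HB Require Import structures.
From mathcomp Require Import all_boot all_order all_algebra.
From mathcomp Require Import boolp classical_sets cardinality.

Set Implicit Arguments.
Unset Strict Implicit.
Unset Printing Implicit Defensive.

Import GRing.Theory.
Local Open Scope classical_set_scope.
Local Open Scope ring_scope.

(** * Ideals *)

Section Ideals.
Variable R : comNzRingType.
Implicit Types (I J P : set R) (x : R).

(* An ideal is a submodule of the regular module [R^o]; the unit ideal [setT]
   is allowed (unlike in [idealr_closed]). *)
Definition is_ideal I : Prop := @GRing.submod_closed R R^o [in I].

Definition is_prime I : Prop := idealr_closed [in I] /\ prime_idealr_closed [in I].

Definition generated_by n (g : 'I_n -> R) : set R :=
  [set a | exists c : 'I_n -> R, a = \sum_(i < n) c i * g i].

Definition noetherian : Prop :=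
  forall I, is_ideal I -> exists n (g : 'I_n -> R), I = generated_by g.

Definition ideal_scale x I : set R := [set x * a | a in I].

Definition principal x : set R := ideal_scale x setT.

Definition ideal_mul I J : set R :=
  [set a | exists n (u v : 'I_n -> R),
     [/\ forall i, I (u i), forall i, J (v i) & a = \sum_(i < n) u i * v i]].

Fixpoint ideal_pow I n : set R :=
  if n is n'.+1 then ideal_mul I (ideal_pow I n') else setT.

(* The colon ideal (I :_R J). *)
Definition colon I J : set R := [set a | forall t, J t -> I (a * t)].

Definition is_reduction J I : Prop :=
  [/\ is_ideal J, J `<=` I &
      exists n, ideal_pow I n.+1 = ideal_mul J (ideal_pow I n)].

(* [n] is the supremum of the lengths of the strict chains
   c 0 < c 1 < ... < c l of sets satisfying [A] *)
Definition sup_chain_length (A : set R -> Prop) n : Prop :=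
  let chain l (c : nat -> set R) :=
    (forall i, (i <= l)%N -> A (c i)) /\
    (forall i, (i < l)%N -> c i `<` c i.+1) in
  (exists c, chain n c) /\ (forall l c, chain l c -> (l <= n)%N).

Definition krull_dim d : Prop := sup_chain_length is_prime d.

(* The length of the R-module R/J: its submodules are the ideals containing J. *)
Definition length_quotient J l : Prop :=
  sup_chain_length (fun I => is_ideal I /\ J `<=` I) l.

(* mu(I) = n *)
Definition min_generators I n : Prop :=
  (exists g : 'I_n -> R, I = generated_by g) /\
  (forall n' (g : 'I_n' -> R), I = generated_by g -> (n <= n')%N).

End Ideals.

(** * Depth and maximal Cohen-Macaulay modules *)

Section Depth.
Variables (R : comNzRingType) (M : lmodType R).

Definition finitely_generated : Prop :=
  exists n (g : 'I_n -> M), forall u : M,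
    exists c : 'I_n -> R, u = \sum_(i < n) c i *: g i.

(* The submodule (s_0, ..., s_{n-1}) M. *)
Definition seq_mul (s : seq R) : set M :=
  [set u | exists v : 'I_(size s) -> M, u = \sum_(i < size s) s`_i *: v i].

Definition regular_seq (s : seq R) : Prop :=
  (forall i, (i < size s)%N -> forall u : M,
     seq_mul (take i s) (s`_i *: u) -> seq_mul (take i s) u) /\
  seq_mul s <> setT.

Definition depth (m : set R) n : Prop :=
  (exists s, [/\ size s = n, forall x, x \in s -> m x & regular_seq s]) /\
  (forall s, (forall x, x \in s -> m x) -> regular_seq s -> (size s <= n)%N).

(* Here [d] stands for dim R; the zero module is excluded, since [regular_seq]
   requires sM <> M. *)
Definition maximal_CM (m : set R) (d : nat) : Prop :=
  finitely_generated /\ depth m d.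

End Depth.

(** * Local rings (R, m, k), presented by the projection pi : R -> k *)

Section Local.
Variables (R : comNzRingType) (m : set R) (k : fieldType).
Variable pi : {rmorphism R -> k}.

Definition noetherian_local : Prop :=
  [/\ noetherian R,
      forall I : set R, is_ideal I -> I <> setT -> I `<=` m,
      forall c, exists a, pi a = c &
      forall a, m a <-> pi a = 0].

Definition CM_local (d : nat) : Prop :=
  [/\ noetherian_local, krull_dim R d & @depth R R^o m d].

End Local.

(** * Gorenstein rings: finite injective dimension over themselves *)

Section Injective.
Variable R : comNzRingType.

Definition injective_module (E : lmodType R) : Prop :=
  forall (A B : lmodType R) (i : {linear A -> B}) (f : {linear A -> E}),
    injective i -> exists g : {linear B -> E}, forall a, g (i a) = f a.

(* An exact sequence 0 -> M -> E 0 -> E 1 -> ... of injective modules,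
   with E i = 0 for i > n. *)
Definition finite_injective_dim (M : lmodType R) : Prop :=
  exists (n : nat) (E : nat -> lmodType R) (e : {linear M -> E 0%N})
         (d : forall i, {linear E i -> E i.+1}),
    [/\ forall i, injective_module (E i),
        injective e,
        forall u, d 0%N u = 0 <-> exists v, u = e v,
        forall i u, d i.+1 u = 0 <-> exists v, u = d i v &
        forall i, (n < i)%N -> forall u : E i, u = 0].

Definition gorenstein_local (m : set R) (k : fieldType)
    (pi : {rmorphism R -> k}) : Prop :=
  noetherian_local m pi /\ finite_injective_dim R^o.

End Injective.

(** * Ext^i_R(k, M) and canonical modules *)

(* A resolution of the R-module k by finite free modules
     ... -> R^(rk 1) -> R^(rk 0) -> k -> 0
   with row vectors as elements.  The R-module structure of k is restriction of
   scalars along pi, so that R-linear maps into k are linear for pi \; *%R. *)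
Record free_resolution (R : comNzRingType) (k : fieldType)
    (pi : {rmorphism R -> k}) := FreeResolution {
  rk : nat -> nat;
  diff : forall i, 'M[R]_(rk i.+1, rk i);
  aug : {linear 'rV[R]_(rk 0) -> k | pi \; *%R};
  aug_surj : forall c, exists v, aug v = c;
  aug_exact : forall v, aug v = 0 <-> exists w, v = w *m diff 0;
  diff_exact : forall i (v : 'rV[R]_(rk i.+1)),
    v *m diff i = 0 <-> exists w, v = w *m diff i.+1
}.

Section Ext.
Variables (R : comNzRingType) (k : fieldType) (pi : {rmorphism R -> k}).
Variables (F : free_resolution pi) (M : lmodType R).

Definition cocycle i (f : 'rV[R]_(rk F i) -> M) : Prop :=
  forall v, f (v *m diff F i) = 0.

Definition coboundary i : ('rV[R]_(rk F i) -> M) -> Prop :=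
  match i with
  | 0%N => fun f => forall v, f v = 0
  | j.+1 => fun f => exists g : {linear 'rV[R]_(rk F j) -> M},
                       forall v, f v = g (v *m diff F j)
  end.

(* dim_k Ext^i_R(k, M) = n, where Ext^i is the i-th cohomology of Hom_R(F, M):
   the classes of the cocycles z_j form a k-basis, the scalar pi a acting on
   classes as a does. *)
Definition dim_Ext i n : Prop :=
  exists z : 'I_n -> {linear 'rV[R]_(rk F i) -> M},
    [/\ forall j, cocycle (z j),
        forall f : {linear 'rV[R]_(rk F i) -> M}, cocycle f ->
          exists a : 'I_n -> R,
            coboundary (fun v => f v - \sum_(j < n) a j *: z j v) &
        forall a : 'I_n -> R,
          coboundary (fun v => \sum_(j < n) a j *: z j v) ->
          forall j, pi (a j) = 0].

End Ext.

Section Canonical.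
Variables (R : comNzRingType) (m : set R) (k : fieldType).
Variables (pi : {rmorphism R -> k}) (d : nat).

(* The dimensions of Ext do not depend on the resolution F. *)
Definition canonical_module (W : lmodType R) : Prop :=
  maximal_CM W m d /\
  exists F : free_resolution pi, forall i, dim_Ext F W i (i == d).

(* An ideal isomorphic to a canonical module W is the image of an injective
   linear map W -> R. *)
Definition canonical_ideal (I : set R) : Prop :=
  is_ideal I /\
  exists (W : lmodType R) (f : {linear W -> R^o}),
    [/\ canonical_module W, injective f & I = range f].

Definition maximal_canonical_ideal (I : set R) : Prop :=
  canonical_ideal I /\
  forall J : set R, canonical_ideal J -> I `<=` J -> J = I.

End Canonical.

(** * Reduction number and multiplicity *)

Section Invariants.
Variables (R : comNzRingType) (m : set R).

Definition reduction_number t : Prop :=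
  let reduces s :=
    exists2 x, m x & ideal_pow m s.+1 = ideal_scale x (ideal_pow m s) in
  reduces t /\ forall s, reduces s -> (t <= s)%N.

(* e^0_m(R) = e for dim R = d: the Hilbert-Samuel polynomial, which gives the
   length of R/m^(n+1) for n >> 0, has degree d and leading coefficient e/d!. *)
Definition multiplicity (d e : nat) : Prop :=
  exists P : {poly rat},
    [/\ size P = d.+1,
        lead_coef P = e%:R / (d`!)%:R &
        exists N, forall n, (N <= n)%N -> exists l,
          length_quotient (ideal_pow m n.+1) l /\ P.[n%:R] = l%:R].

(* For dim R = 1. *)
Definition minimal_multiplicity : Prop :=
  exists e, min_generators m e /\ multiplicity 1 e.

End Invariants.

(* Main.v *)
(* Fix a regular sequence s of length d on the canonical ideals at hand; it exists
   since Ext^i(k, T) = 0 for i < d.  As Ext^i(k, T) = 0 for i > d, devissage gives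
   Ext^i(N, T) = 0 for all finitely generated N and i > d, and for i > 0 when s is
   regular on N.  So maps from N to T/sT lift to T, and T/sT, whose socle is nonzero,
   cogenerates the modules killed by s.  It follows that T is faithful, that
   End(T) = R and that two canonical ideals are isomorphic; hence an inclusion of
   canonical ideals is multiplication by some x in m, and (a), (b) are computations
   with such multipliers.  If R itself is a canonical ideal, Ext^i(R/J, R) = 0 for
   i > d bounds the injective dimension of R, so in the non-Gorenstein case
   canonical ideals lie in m.  For (c), a canonical ideal contained in xm^t is x
   times a strictly larger one.  When mu(m) = e, the theorem of Eakin and Sathaye
   gives x with m^(n+1) = xm^n for some n, and comparing the lengths of m/xm, m^n/xm^n
   and m/m^2 gives m^2 = xm. *)

Require Import Defs.
From HB Require Import structures.
From mathcomp Require Import all_boot all_order all_algebra.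
From mathcomp Require Import ring.
From mathcomp Require Import boolp classical_sets cardinality.

Set Implicit Arguments.
Unset Strict Implicit.
Unset Printing Implicit Defensive.

Import GRing.Theory.
Local Open Scope classical_set_scope.
Local Open Scope ring_scope.

(** * Submodules and regular sequences *)

Section Submodules.
Variables (R : comNzRingType) (V : lmodType R).
Implicit Types (Z B M : set V).

(** The hypotheses concern an abstract module through one free resolution of k, whereas the
    arguments need Ext(N, T/B) for many N and B. Neither quotients nor derived functors are formed
    for this: N is the cokernel of a matrix with a free resolution [cx], a map from a free module to
    T/B is a column over T taken modulo B, and [ext_vanish] states exactness in one degree.
    Enlarging B from 0 to sT replaces T by T/sT; mapping cones and division by a regular element
    replace the long exact sequences in the two variables. That T is an ideal helps twice: columns
    over T are matrices over R, and u * h v = v * h u for an endomorphism h of T, which makes End(T)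
    commutative before it is known to be R. The infinite residue field serves to choose one sequence
    s regular on two canonical ideals at once and, for (c), the generic elements in the theorem of
    Eakin and Sathaye. Genuine quotient modules occur only in the construction of injective
    resolutions. *)

Definition is_submod Z : Prop := GRing.submod_closed [in Z].

Lemma is_submodP Z :
  is_submod Z <-> Z 0 /\ forall a u v, Z u -> Z v -> Z (a *: u + v).
Proof.
split=> [[/set_mem Z0 ZS]|[Z0 ZS]]; split=> //.
- by move=> a u v /mem_set Zu /mem_set Zv; apply/set_mem/ZS.
- exact/mem_set.
- by move=> a u v /set_mem Zu /set_mem Zv; apply/mem_set/ZS.
Qed.

Section Closure.
Variables (Z : set V) (Zsub : is_submod Z).

Lemma submod0 : Z 0. Proof. by case/is_submodP: Zsub. Qed.

Lemma submodP a u v : Z u -> Z v -> Z (a *: u + v).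
Proof. by case/is_submodP: Zsub => _; apply. Qed.

Lemma submodZ a u : Z u -> Z (a *: u).
Proof. by move=> Zu; rewrite -[_ *: _]addr0; apply: submodP => //; apply: submod0. Qed.

Lemma submodD u v : Z u -> Z v -> Z (u + v).
Proof. by move=> Zu Zv; rewrite -[u]scale1r; apply: submodP. Qed.

Lemma submodN u : Z u -> Z (- u).
Proof. by move=> Zu; rewrite -scaleN1r; apply: submodZ. Qed.

Lemma submodB u v : Z u -> Z v -> Z (u - v).
Proof. by move=> Zu /submodN; apply: submodD. Qed.

Lemma submod_sum (I : Type) (r : seq I) (P : pred I) (F : I -> V) :
  (forall i, P i -> Z (F i)) -> Z (\sum_(i <- r | P i) F i).
Proof. by move=> ZF; apply: big_ind => //; [apply: submod0|apply: submodD]. Qed.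

Lemma submodDl u v : Z u -> Z (u + v) -> Z v.
Proof. by move=> Zu Zuv; rewrite -[v](addKr u) addrC; apply: submodB. Qed.

Lemma submodBl u v : Z v -> Z (u - v) -> Z u.
Proof. by move=> Zv Zuv; rewrite -[u](subrK v); apply: submodD. Qed.

End Closure.

Lemma submod_set0 : is_submod [set 0].
Proof. by apply/is_submodP; split=> // a u v /= -> ->; rewrite scaler0 addr0. Qed.

Lemma submod_setT : is_submod setT.
Proof. by apply/is_submodP; split. Qed.

Lemma submodI Z B : is_submod Z -> is_submod B -> is_submod (Z `&` B).
Proof.
move=> Zs Bs; apply/is_submodP; split; first by split; apply: submod0.
by move=> a u v [Zu Bu] [Zv Bv]; split; apply: submodP.
Qed.

(** This is B + xM. For B inside M it is the denominator of (M/B)/x(M/B), so quotients by regular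
    elements are handled by enlarging B. *)
Definition padd B x M : set V :=
  [set u | exists b t, [/\ B b, M t & u = b + x *: t]].

Lemma submod_padd B x M :
  is_submod B -> is_submod M -> is_submod (padd B x M).
Proof.
move=> Bs Ms; apply/is_submodP; split.
  by exists 0, 0; split; [apply: submod0|apply: submod0|rewrite scaler0 addr0].
move=> a _ _ [b [t [Bb Mt ->]]] [c [u [Bc Mu ->]]].
exists (a *: b + c), (a *: t + u); split; [exact: submodP|exact: submodP|].
by rewrite !scalerDr !scalerA [x * a]mulrC addrACA.
Qed.

Lemma sub_padd B x M : is_submod M -> B `<=` padd B x M.
Proof.
by move=> Ms b Bb; exists b, 0; split; [|apply: submod0|rewrite scaler0 addr0].
Qed.

Lemma padd_mul B x M t : is_submod B -> M t -> padd B x M (x *: t).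
Proof. by move=> Bs Mt; exists 0, t; split; [apply: submod0| |rewrite add0r]. Qed.

Lemma padd_subset B x M : is_submod M -> B `<=` M -> padd B x M `<=` M.
Proof.
move=> Ms BM _ [b [t [/BM Mb Mt ->]]].
by apply: submodD => //; apply: submodZ.
Qed.

(* [addmul B M s] is B + sM, and [wreg B M s] says that s is a regular sequence
   on M/B, without the condition M <> B + sM. *)
Fixpoint addmul B M (s : seq R) : set V :=
  if s is x :: s' then addmul (padd B x M) M s' else B.

Fixpoint wreg B M (s : seq R) : Prop :=
  if s is x :: s' then
    (forall t, M t -> B (x *: t) -> B t) /\ wreg (padd B x M) M s'
  else True.

Lemma submod_addmul s B M :
  is_submod B -> is_submod M -> is_submod (addmul B M s).
Proof.
by elim: s B => //= x s IH B Bs Ms; apply: IH => //; apply: submod_padd.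
Qed.

Lemma sub_addmul s B M : is_submod M -> B `<=` addmul B M s.
Proof.
elim: s B => [|x s IH] B Ms b Bb //=; apply: IH => //.
exact: (sub_padd x Ms Bb).
Qed.

Lemma addmul_subset s B M : is_submod M -> B `<=` M -> addmul B M s `<=` M.
Proof.
by elim: s B => [|x s IH] B Ms BM //=; apply: IH => //; apply: padd_subset.
Qed.

Lemma addmul_mul s B M x t : is_submod B -> is_submod M ->
  x \in s -> M t -> addmul B M s (x *: t).
Proof.
move=> + Ms; elim: s B => //= y s IH B Bs.
rewrite inE => /orP[/eqP<- Mt|xs]; last by apply: IH => //; apply: submod_padd.
exact/sub_addmul/padd_mul.
Qed.

Lemma addmul_min s B M L : is_submod L -> B `<=` L ->
  (forall x t, x \in s -> M t -> L (x *: t)) -> addmul B M s `<=` L.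
Proof.
move=> Ls; elim: s B => [|x s IH] B BL sL //=; apply: IH.
  move=> _ [b [t [/BL Lb Mt ->]]]; apply: submodD => //.
  by apply: sL => //; rewrite mem_head.
by move=> y t ys; apply: sL; rewrite inE ys orbT.
Qed.

(** Regular sequences are consumed from the front, but [common_regular_seq] extends them at the
    end. *)
Lemma wreg_rcons s B M x :
  wreg B M (rcons s x) <->
  wreg B M s /\ (forall t, M t -> addmul B M s (x *: t) -> addmul B M s t).
Proof.
elim: s B => [|y s IH] B /=; first by split=> [[]|[]].
rewrite IH; split=> [[h [h1 h2]]|[[h h1] h2]]; do !split=> //.
Qed.

End Submodules.

(** * Ideals and matrices with entries in an ideal *)

Section Ideals.
Variable R : comNzRingType.
Implicit Types (T I J : set R).

Lemma is_idealE T : is_ideal T = is_submod (T : set R^o).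
Proof. by []. Qed.

Lemma idealM T a t : is_ideal T -> T t -> T (a * t).
Proof. by move=> Ti; apply: (@submodZ R R^o). Qed.

Lemma ideal_set0 : is_ideal [set (0 : R)].
Proof. exact: (@submod_set0 R R^o). Qed.

Lemma ideal_setT : is_ideal [set: R].
Proof. exact: (@submod_setT R R^o). Qed.

Lemma ideal_one T : is_ideal T -> T 1 -> T = setT.
Proof.
by move=> Ti T1; apply/seteqP; split=> // a _; rewrite -[a]mulr1; apply: idealM.
Qed.

Lemma generated_mem n (g : 'I_n -> R) i : generated_by g (g i).
Proof.
exists (fun j => (j == i)%:R).
by rewrite (bigD1 i) //= eqxx mul1r big1 ?addr0 // => j /negPf->; rewrite mul0r.
Qed.

(** A column with entries in T is a linear map from row vectors to T; this is how Hom(R^n, T) is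
    represented. *)
Definition mxin T p q (A : 'M[R]_(p, q)) : Prop := forall i j, T (A i j).

Section Closure.
Variables (T : set R) (Ti : is_ideal T).

Lemma mxin0 p q : mxin T (0 : 'M_(p, q)).
Proof. by move=> i j; rewrite mxE; apply: (@submod0 R R^o). Qed.

Lemma mxinD p q (A B : 'M_(p, q)) : mxin T A -> mxin T B -> mxin T (A + B).
Proof. by move=> TA TB i j; rewrite mxE; apply: (@submodD R R^o). Qed.

Lemma mxinN p q (A : 'M_(p, q)) : mxin T A -> mxin T (- A).
Proof. by move=> TA i j; rewrite mxE; apply: (@submodN R R^o). Qed.

Lemma mxinB p q (A B : 'M_(p, q)) : mxin T A -> mxin T B -> mxin T (A - B).
Proof. by move=> TA TB; apply: mxinD => //; apply: mxinN. Qed.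

Lemma mxinZ p q a (A : 'M_(p, q)) : mxin T A -> mxin T (a *: A).
Proof. by move=> TA i j; rewrite mxE; apply: idealM. Qed.

Lemma mxinM p q r (A : 'M_(p, q)) (B : 'M_(q, r)) :
  mxin T B -> mxin T (A *m B).
Proof.
move=> TB i j; rewrite mxE; apply: (@submod_sum R R^o) => // l _.
exact: idealM.
Qed.

Lemma mxinBl p q (A B : 'M_(p, q)) : mxin T B -> mxin T (A - B) -> mxin T A.
Proof. by move=> TB TAB; rewrite -[A](subrK B); apply: mxinD. Qed.

End Closure.

Lemma mxin_sub T T' p q (A : 'M_(p, q)) : T `<=` T' -> mxin T A -> mxin T' A.
Proof. by move=> TT' TA i j; apply: TT'. Qed.

Lemma mxin_padd T B x p q (A : 'M_(p, q)) :
  mxin (padd (B : set R^o) x T) A ->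
  exists b t, [/\ mxin B b, mxin T t & A = b + x *: t].
Proof.
move=> h.
have /choice[f hf] (ij : 'I_p * 'I_q) : exists bt : R * R,
    [/\ B bt.1, T bt.2 & A ij.1 ij.2 = bt.1 + x * bt.2].
  by have [b [t [Bb Tt e]]] := h ij.1 ij.2; exists (b, t).
exists (\matrix_(i, j) (f (i, j)).1), (\matrix_(i, j) (f (i, j)).2).
split=> [i j|i j|]; [by rewrite mxE; case: (hf (i, j))..|].
by apply/matrixP=> i j; rewrite !mxE; case: (hf (i, j)).
Qed.

Lemma mxin_padd_mul T B x p q (t : 'M[R]_(p, q)) : is_ideal B -> mxin T t ->
  mxin (padd (B : set R^o) x T) (x *: t).
Proof.
move=> Bi Tt i j; rewrite mxE; exact: (@padd_mul R R^o B x T).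
Qed.

Lemma mxin_set0 p q (A : 'M[R]_(p, q)) : mxin [set 0] A <-> A = 0.
Proof.
split=> [h|-> i j]; last by rewrite mxE.
by apply/matrixP=> i j; rewrite mxE; apply: h.
Qed.

Definition rowspan p n (G : 'M[R]_(p, n)) : set 'rV[R]_n :=
  [set v | exists w, v = w *m G].

Lemma submod_rowspan p n (G : 'M[R]_(p, n)) : is_submod (rowspan G).
Proof.
apply/is_submodP; split; first by exists 0; rewrite mul0mx.
move=> a _ _ [u ->] [v ->]; exists (a *: u + v).
by rewrite mulmxDl scalemxAl.
Qed.

Lemma row_rowspan p n (G : 'M[R]_(p, n)) i : rowspan G (row i G).
Proof. by exists (delta_mx 0 i); rewrite rowE. Qed.

Lemma rowspanP p n (G : 'M[R]_(p, n)) (Z : set 'rV[R]_n) : is_submod Z ->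
  (rowspan G `<=` Z) <-> (forall i, Z (row i G)).
Proof.
move=> Zs; split=> [h i|h _ [w ->]]; first exact/h/row_rowspan.
rewrite mulmx_sum_row; apply: submod_sum => // i _; exact: submodZ.
Qed.

Lemma rows_factor p n q (A : 'M[R]_(p, n)) (G : 'M[R]_(q, n)) :
  (forall i, rowspan G (row i A)) -> exists H, A = H *m G.
Proof.
move=> /choice[f hf]; exists (\matrix_i f i).
by apply/row_matrixP=> i; rewrite row_mul rowK hf.
Qed.

End Ideals.

(** * Submodules of free modules over a Noetherian ring *)

Section Noetherian.
Variables (R : comNzRingType) (Rnoeth : noetherian R).

(** Induction along 0 -> R^n -> R^(1+n) -> R -> 0: lifted generators of the image I of Z under the
    first coordinate are completed by generators of the kernel part Z'. *)
Lemma noetherian_rowspan n (Z : set 'rV[R]_n) :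
  is_submod Z -> exists p (G : 'M[R]_(p, n)), Z = rowspan G.
Proof.
elim: n Z => [|n IH] Z Zs.
  exists 0%N, 0; apply/seteqP; split=> v _; first by exists 0; rewrite [v]thinmx0 thinmx0.
  by rewrite [v]thinmx0; apply: submod0.
move: Z Zs; rewrite -[n.+1]add1n => Z Zs.
pose I : set R := [set a | exists2 v : 'rV[R]_(1 + n), Z v & v 0 0 = a].
have Ii : is_ideal I.
  rewrite is_idealE; apply/is_submodP; split.
    by exists 0; [exact: submod0|rewrite mxE].
  move=> a b c [u Zu eu] [w Zw ew]; exists (a *: u + w); first exact: submodP.
  by rewrite !mxE eu ew.
have [p [g Ig]] := Rnoeth Ii.
have /choice[f hf] (i : 'I_p) : exists v : 'rV[R]_(1 + n), Z v /\ v 0 0 = g i.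
  have : I (g i).
    by rewrite Ig; apply: generated_mem.
  by case=> v; exists v.
pose Z' : set 'rV[R]_n := [set v | Z (row_mx 0 v : 'rV[R]_(1 + n))].
have Z's : is_submod Z'.
  apply/is_submodP; split; first by rewrite /Z' /= row_mx0; apply: submod0.
  move=> a u w Zu Zw; rewrite /Z' /=.
  have -> : row_mx 0 (a *: u + w) = a *: row_mx 0 u + row_mx 0 w :> 'rV[R]_(1 + n).
    by rewrite scale_row_mx add_row_mx scaler0 addr0.
  exact: submodP.
have [q [G' ZG']] := IH _ Z's.
exists (p + q)%N, (col_mx (\matrix_i f i) (row_mx 0 G')).
apply/seteqP; split=> [v Zv|_ [w ->]]; last first.
  rewrite -[w]hsubmxK mul_row_col; apply: submodD => //.
    rewrite mulmx_sum_row; apply: submod_sum => // i _; apply: submodZ => //.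
    by rewrite rowK; case: (hf i).
  rewrite mul_mx_row mulmx0.
  have : Z' (rsubmx w *m G') by rewrite ZG'; exists (rsubmx w).
  by [].
have [c ec] : generated_by g (v 0 0) by rewrite -Ig; exists v.
pose w := \row_i c i; pose v1 := v - w *m \matrix_i f i.
have Zv1 : Z v1.
  apply: submodB => //; rewrite mulmx_sum_row; apply: submod_sum => // i _.
  by apply: submodZ => //; rewrite rowK; case: (hf i).
have v10 : lsubmx v1 = 0.
  apply/matrixP=> i j; rewrite !ord1 mxE.
  have -> : lshift n 0 = 0 :> 'I_(1 + n) by apply: val_inj.
  rewrite /v1 !mxE ec; apply/eqP; rewrite subr_eq0; apply/eqP/eq_bigr => l _.
  by rewrite !mxE; case: (hf l) => _ ->.
have [w' ew'] : rowspan G' (rsubmx v1).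
  rewrite -ZG' /Z' /=; rewrite -[v1 in Z v1](@hsubmxK _ 1 1 n) v10 in Zv1.
  exact: Zv1.
exists (row_mx w w'); rewrite mul_row_col mul_mx_row mulmx0 -ew' -v10 hsubmxK.
by rewrite /v1 addrC subrK.
Qed.

Lemma noetherian_acc n (Z : nat -> set 'rV[R]_n) :
  (forall i, is_submod (Z i)) -> (forall i, Z i `<=` Z i.+1) ->
  exists i, Z i.+1 `<=` Z i.
Proof.
move=> Zs Zinc.
have Zle i j : (i <= j)%N -> Z i `<=` Z j.
  move/subnK<-; elim: (j - i)%N => [|l IH] //.
  by move=> v /IH; rewrite addSn; apply: Zinc.
pose U : set 'rV[R]_n := [set v | exists i, Z i v].
have Us : is_submod U.
  apply/is_submodP; split; first by exists 0%N; apply: submod0.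
  move=> a u v [i Zu] [j Zv]; exists (maxn i j); apply: submodP => //.
    exact: (Zle _ _ (leq_maxl i j)).
  exact: (Zle _ _ (leq_maxr i j)).
have [p [G UG]] := noetherian_rowspan Us.
have /choice[f hf] (i : 'I_p) : U (row i G) by rewrite UG; apply: row_rowspan.
exists (\max_i f i)%N => v Zv.
have : U v by exists (\max_i f i).+1%N.
rewrite UG; apply: (iffRL (rowspanP G (Zs _))) => i.
exact: (Zle _ _ (leq_bigmax i)).
Qed.

(** Dependent choice among counterexamples would give a chain contradicting [noetherian_acc]. *)
Lemma noetherian_ind n (P : set 'rV[R]_n -> Prop) :
  (forall Z, is_submod Z ->
    (forall Z', is_submod Z' -> Z `<=` Z' -> ~ Z' `<=` Z -> P Z') -> P Z) ->
  forall Z, is_submod Z -> P Z.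
Proof.
move=> IH Z0 Z0s; apply: contrapT => nP.
pose bad := {Z : set 'rV[R]_n | is_submod Z /\ ~ P Z}.
have /choice[nxt hnxt] (Z : bad) :
    exists Z' : bad, sval Z `<=` sval Z' /\ ~ sval Z' `<=` sval Z.
  case: Z => Z [Zs nPZ] /=; apply: contrapT => h; apply/nPZ/IH => // Z' Z's ZZ' nZ'Z.
  apply: contrapT => nPZ'; apply: h.
  by exists (exist _ Z' (conj Z's nPZ')).
pose ch i := iter i nxt (exist _ Z0 (conj Z0s nP) : bad).
have [||i] := @noetherian_acc n (fun i => sval (ch i)).
- by move=> i; case: (svalP (ch i)).
- by move=> i; case: (hnxt (ch i)).
- by case: (hnxt (ch i)).
Qed.

End Noetherian.

(** * Complexes of free modules *)

Section Complexes.
Variable R : comNzRingType.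
Implicit Types (T B : set R).

(** The ranks with [n] put in front: the module resolved is a quotient of R^n, and Ext^j is read off
    at the term [rk_ n r j], for [j = 0] too. *)
Definition rk_ (n : nat) (r : nat -> nat) j := if j is j'.+1 then r j' else n.

(* A complex ... -> R^(rks 1) -> R^(rks 0) -> R^n of row vectors, augmented to
   the cokernel of [df 0]. *)
Record cx n := Cx {
  rks : nat -> nat;
  df : forall j, 'M[R]_(rks j, rk_ n rks j)
}.

Local Notation dg n C j := (rk_ n (rks C) j).

Definition is_cx n (C : cx n) := forall j,
  (df C j.+1 : 'M_(rks C j.+1, rks C j)) *m df C j = 0.

Definition acyclic n (C : cx n) := is_cx C /\
  forall j (v : 'rV_(rks C j)), v *m df C j = 0 -> rowspan (df C j.+1) v.

(** Free modules being projective, a cochain with values in T/B is represented by a column over T,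
    and conditions on it are imposed modulo B. *)
Definition cocycle_mod n (C : cx n) T B j (w : 'cV[R]_(dg n C j)) : Prop :=
  mxin T w /\ mxin B (df C j *m w).

Definition cobound_mod n (C : cx n) T B j : 'cV[R]_(dg n C j) -> Prop :=
  match j with
  | 0%N => fun w => mxin B w
  | j'.+1 => fun w => exists u : 'cV[R]_(dg n C j'),
      mxin T u /\ mxin B (w - df C j' *m u)
  end.

(* Vanishing of Ext^j(M, T/B), where M is the cokernel of [df C 0]. *)
Definition ext_vanish n (C : cx n) T B j : Prop :=
  forall w, @cocycle_mod n C T B j w -> cobound_mod T B w.

Definition chain_map n p (P : cx p) (Q : cx n)
    (f : forall j, 'M[R]_(dg p P j, dg n Q j)) : Prop :=
  forall j, df P j *m f j = (f j.+1 : 'M_(rks P j, rks Q j)) *m df Q j.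

Definition null_htpy n p (P : cx p) (Q : cx n)
    (f : forall j, 'M[R]_(dg p P j, dg n Q j))
    (H : forall j, 'M[R]_(dg p P j, rks Q j)) : Prop :=
  f 0%N = H 0%N *m df Q 0%N /\
  forall j, f j.+1 = H j.+1 *m df Q j.+1 + df P j *m H j.

Lemma resolution_exists (Rnoeth : noetherian R) n (Z : set 'rV[R]_n) :
  is_submod Z -> exists C : cx n, acyclic C /\ rowspan (df C 0%N) = Z.
Proof.
move=> Zs; have [p0 [G0 ZG0]] := noetherian_rowspan Rnoeth Zs.
(* A state is a matrix with its size; the next one is a matrix whose rows generate the kernel. *)
pose st := {pq : nat * nat & 'M[R]_(pq.1, pq.2)}.
have ex (s : st) : exists s' : {p : nat & 'M[R]_(p, (tag s).1)},
    rowspan (tagged s') = [set v | v *m tagged s = 0].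
  have Ks : is_submod [set v : 'rV[R]_(tag s).1 | v *m tagged s = 0].
    apply/is_submodP; split; first by rewrite /= mul0mx.
    by move=> a u v /= eu ev; rewrite mulmxDl -scalemxAl eu ev scaler0 addr0.
  have [p [G KG]] := noetherian_rowspan Rnoeth Ks.
  by exists (existT _ p G).
pose nxt s := sval (cid (ex s)).
have hnxt s : rowspan (tagged (nxt s)) = [set v | v *m tagged s = 0].
  exact: svalP (cid (ex s)).
pose s0 : st := existT _ (p0, n) G0.
pose nx (s : st) : st :=
  existT (fun pq : nat * nat => 'M[R]_(pq.1, pq.2)) (tag (nxt s), (tag s).1)
    (tagged (nxt s)).
pose r j := (tag (iter j nx s0)).1.
pose D j : 'M[R]_(r j, rk_ n r j) := match j with
  | 0%N => G0
  | j'.+1 => tagged (nxt (iter j' nx s0))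
  end.
have ker j (v : 'rV[R]_(r j)) : rowspan (D j.+1) v <-> v *m D j = 0.
  by case: j v => [|j] v; [have := hnxt s0|have := hnxt (iter j.+1 nx s0)];
    move/seteqP => [h1 h2]; split=> [/h1|h]; [|exact: h2|  |exact: h2].
exists (Cx D); split=> //; split=> [j|j v]; last by move/ker.
by apply/row_matrixP=> i; rewrite row_mul row0; apply/ker/row_rowspan.
Qed.

Section Lift.
Variables (n p : nat) (P : cx p) (Q : cx n).
Hypotheses (Pcx : is_cx P) (Qex : acyclic Q).

Lemma chain_map_lift (f0 : 'M[R]_(p, n)) :
  (forall v, rowspan (df P 0%N) v -> rowspan (df Q 0%N) (v *m f0)) ->
  exists f : forall j, 'M[R]_(dg p P j, dg n Q j), f 0%N = f0 /\ chain_map f.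
Proof.
move=> f0P.
(* Carried along the recursion: [f] maps the image of [df P j] into that of [df Q j], which is what
   lifting the next component requires. *)
pose good j (f : 'M[R]_(dg p P j, dg n Q j)) :=
  forall v, rowspan (df P j) v -> rowspan (df Q j) (v *m f).
have step j (f : {f | good j f}) :
    {f' : {f' | good j.+1 f'} |
      df P j *m sval f = (sval f' : 'M_(rks P j, rks Q j)) *m df Q j}.
  apply: cid; case: f => f fg /=.
  have [|f' ef'] := @rows_factor _ _ _ _ (df P j *m f) (df Q j).
    by move=> i; rewrite row_mul; apply/fg/row_rowspan.
  have f'g : @good j.+1 f'.
    move=> _ [w ->]; apply: (proj2 Qex).
    rewrite /= -mulmxA -mulmxA -ef' (mulmxA (df P j.+1)).
    by rewrite Pcx mul0mx mulmx0.
  by exists (exist _ f' f'g).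
pose F := fix F j : {f | good j f} :=
  match j with 0%N => exist (@good 0%N) f0 f0P | j'.+1 => sval (step j' (F j')) end.
exists (fun j => sval (F j)); split=> // j.
by rewrite (svalP (step j (F j))).
Qed.

Lemma chain_map_null (f : forall j, 'M[R]_(dg p P j, dg n Q j)) : chain_map f ->
  (forall i, rowspan (df Q 0%N) (row i (f 0%N))) -> exists H, null_htpy f H.
Proof.
move=> fch f0Q.
(* This makes [f j.+1 - df P j *m H] land in the cycles of Q, so that it factors through
   [df Q j.+1]. *)
pose good j (H : 'M[R]_(dg p P j, rks Q j)) :=
  df P j *m f j = df P j *m H *m df Q j.
have [H0 eH0] := rows_factor f0Q.
have H0g : @good 0%N H0 by rewrite /good -mulmxA eH0.
have step j (H : {H | good j H}) : {H' : {H' | good j.+1 H'} |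
      f j.+1 = sval H' *m df Q j.+1 + df P j *m sval H}.
  apply: cid; case: H => H Hg /=.
  have [|H' eH'] := @rows_factor _ _ _ _ (f j.+1 - df P j *m H) (df Q j.+1).
    move=> i; apply: (proj2 Qex); rewrite -row_mul mulmxBl -(fch j) Hg subrr.
    exact: row0.
  have H'g : @good j.+1 H'.
    rewrite /good -mulmxA -eH' mulmxBr (mulmxA (df P j.+1)) (Pcx j) mul0mx.
    by rewrite subr0.
  by exists (exist _ H' H'g) => /=; rewrite -eH' subrK.
pose F := fix F j : {H | good j H} :=
  match j with 0%N => exist (@good 0%N) H0 H0g | j'.+1 => sval (step j' (F j')) end.
exists (fun j => sval (F j)); split=> // j.
by rewrite (svalP (step j (F j))).
Qed.

End Lift.

Lemma scalar_chain_map n (C : cx n) (x : R) :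
  chain_map (fun j => x%:M : 'M[R]_(dg n C j, dg n C j)).
Proof. by move=> j; rewrite mul_mx_scalar mul_scalar_mx. Qed.

(** Up to coboundaries a cocycle [w] over P is [f (g w)], the homotopy giving the correction, and
    [g w] is a coboundary over Q. *)
Lemma ext_vanish_htpy n p (P : cx p) (Q : cx n) T B j
    (f : forall j, 'M[R]_(dg p P j, dg n Q j))
    (g : forall j, 'M[R]_(dg n Q j, dg p P j)) H :
  is_ideal T -> is_ideal B -> chain_map f -> chain_map g ->
  null_htpy (fun j => f j *m g j - 1%:M) H ->
  ext_vanish Q T B j -> ext_vanish P T B j.
Proof.
move=> Ti Bi fch gch [H0 HS] van w [Tw Bw].
have gw : cocycle_mod T B (g j *m w).
  split; first exact: mxinM.
  by rewrite mulmxA (gch j) -mulmxA; apply: mxinM.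
have := van _ gw; case: j => [|j] /= in w Tw Bw {van} gw *.
  move=> Bgw; have : mxin B ((f 0%N *m g 0%N - 1%:M) *m w).
    by rewrite H0 -mulmxA; apply: mxinM.
  rewrite mulmxBl mul1mx -mulmxA => h.
  rewrite -[w](subKr (f 0%N *m (g 0%N *m w))); apply: mxinB => //.
  exact: mxinM.
move=> [u [Tu Bu]].
exists (f j *m u - H j *m w); split; first by apply: mxinB => //; apply: mxinM.
have e : (f j.+1 *m g j.+1 - 1%:M) *m w =
   (H j.+1 *m df P j.+1 + df P j *m H j) *m w by rewrite HS.
rewrite mulmxBl mul1mx mulmxDl in e.
have -> : w - df P j *m (f j *m u - H j *m w) =
  f j.+1 *m (g j.+1 *m w - df Q j *m u) - H j.+1 *m (df P j.+1 *m w).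
  rewrite /= !mulmxBr !mulmxA fch.
  move/(canRL (addrNK _)): e => e.
  rewrite e -[_ + _ + w]addrA [X in X - _ - _]addrC [RHS]addrAC addrK opprB addrA.
  by rewrite [w + _]addrC.
by apply: mxinB => //; apply: mxinM.
Qed.

End Complexes.

(** * Mapping cones and long exact sequences in the first variable *)

Section Cone.
Variable R : comNzRingType.
Implicit Types (T B : set R).
Local Notation dg n C j := (rk_ n (rks C) j).
Variables (n p : nat) (P : cx R p) (Q : cx R n).
Variable f : forall j, 'M[R]_(dg p P j, dg n Q j).

(** The mapping cone, with the term R^p of P placed beside [rks Q 0]: it presents the cokernel of
    the map M_P -> M_Q between the modules presented by P and Q. *)
Definition cone : cx R n :=
  let r j := (rks Q j + rk_ p (rks P) j)%N in
  @Cx R n r (fun j => match j return 'M[R]_(r j, rk_ n r j) with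
    | 0%N => col_mx (df Q 0%N) (f 0%N)
    | j'.+1 => block_mx (df Q j'.+1) 0 (f j'.+1) (- df P j')
    end).

Hypothesis fch : chain_map f.

(** The last hypothesis is the injectivity of M_P -> M_Q; it enters for exactness at the lowest
    syzygy. *)
Lemma cone_acyclic : acyclic P -> acyclic Q ->
  (forall u, rowspan (df Q 0%N) (u *m f 0%N) -> rowspan (df P 0%N) u) ->
  acyclic cone.
Proof.
move=> [Pcx Pex] [Qcx Qex] finj; split=> [[|j]|[|j] v].
- rewrite /= mul_block_col (Qcx 0%N) mul0mx addr0 mulNmx (fch 0%N) addrN.
  by rewrite col_mx0.
- rewrite /= mulmx_block !mul0mx !mulmx0 (Qcx j.+1) !addr0 add0r.
  rewrite mulNmx (fch j.+1) addrN mulNmx mulmxN opprK (Pcx j).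
  by rewrite block_mx_const.
- rewrite /= -[v]hsubmxK mul_row_col => e.
  have [w ew] : rowspan (df P 0%N) (rsubmx v).
    apply: finj; exists (- lsubmx v); rewrite mulNmx.
    by apply/eqP; rewrite -addr_eq0 addrC e.
  have : (lsubmx v + w *m f 1%N) *m df Q 0%N = 0.
    by rewrite mulmxDl -mulmxA -(fch 0%N) mulmxA -ew.
  move=> /Qex[u eu]; exists (row_mx u (- w)).
  rewrite /= mul_row_block mulmx0 add0r !mulNmx mulmxN opprK -ew -eu.
  by rewrite addrK.
- rewrite /= -[v]hsubmxK mul_row_block mulmx0 add0r -[0 in RHS]row_mx0.
  move=> /eq_row_mx[e]; rewrite mulmxN => /eqP; rewrite oppr_eq0 => /eqP/Pex[w ew].
  have : (lsubmx v + w *m f j.+2) *m df Q j.+1 = 0.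
    by rewrite mulmxDl -mulmxA -(fch j.+1) mulmxA -ew.
  move=> /Qex[u eu]; exists (row_mx u (- w)).
  rewrite /= mul_row_block mulmx0 add0r !mulNmx mulmxN opprK -ew -eu.
  by rewrite addrK.
Qed.

Lemma rowspan_cone v : rowspan (df cone 0%N) v <->
  exists u, rowspan (df Q 0%N) (v - u *m f 0%N).
Proof.
split=> [[w ->]|[u [w e]]].
  exists (rsubmx w), (lsubmx w).
  by rewrite -[w in w *m _]hsubmxK /= mul_row_col addrK.
by exists (row_mx w u); rewrite /= mul_row_col -e subrK.
Qed.

Variables (T B : set R).
Hypotheses (Ti : is_ideal T) (Bi : is_ideal B).

(** Surjectivity of Ext^j(M_Q, T/B) -> Ext^j(M_P, T/B). *)
Definition ext_lift j := forall y, cocycle_mod (C := P) T B (j := j) y ->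
  exists q, cocycle_mod (C := Q) T B (j := j) q /\
            cobound_mod (C := P) T B (y - f j *m q).

(** Exactness of Ext^j(M_Q) -> Ext^j(M_P) -> Ext^(j+1)(cone): the connecting map takes [y] to the
    column with blocks 0 and [y], and the upper block of a column bounding it is [q]. *)
Lemma cone_ext_lift j : ext_vanish cone T B j.+1 -> ext_lift j.
Proof.
move=> van y [Ty By].
have := van (col_mx 0 y : 'cV_(rks Q j + rk_ p (rks P) j)).
case.
  split=> [i l|].
    by rewrite mxE; case: (split i) => a; rewrite ?mxE //; apply: (@submod0 R R^o).
  rewrite /= mul_block_col !mulmx0 !mul0mx !add0r mulNmx => i l.
  rewrite mxE; case: (split i) => a; first exact: mxin0.
  exact: mxinN.
case: j y Ty By {van} => [|j] y Ty By u [Tu].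
  rewrite /= mul_col_mx opp_col_mx add_col_mx => Bu.
  exists u; split; first split=> //.
    move=> i l; have := Bu (lshift _ i) l; rewrite col_mxEu add0r mxE.
    by move=> /(@submodN R R^o _ Bi); rewrite opprK.
  by move=> i l; have := Bu (rshift _ i) l; rewrite col_mxEd.
rewrite /= -[u]vsubmxK mul_block_col opp_col_mx add_col_mx => Bu.
exists (usubmx u); split; first split.
- by move=> i l; rewrite mxE; apply: Tu.
- move=> i l; have := Bu (lshift _ i) l; rewrite col_mxEu mul0mx addr0 add0r mxE.
  by move=> /(@submodN R R^o _ Bi); rewrite opprK.
exists (- dsubmx u); split; first by apply: mxinN => // i l; rewrite mxE; apply: Tu.
move=> i l; have := Bu (rshift _ i) l; rewrite col_mxEd.
by rewrite mulNmx mulmxN opprD addrA.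
Qed.

(** Exactness of Ext(cone) -> Ext(M_Q) -> Ext(M_P): a column [u] bounding the image of [w] under [f]
    completes [w] to a cocycle of the cone. *)
Lemma cone_ext_vanish j : ext_vanish P T B j.+1 ->
  ext_vanish cone T B j.+1 -> ext_vanish Q T B j.+1.
Proof.
move=> vanP vanC w [Tw Bw].
have [|u [Tu Bu]] := vanP (f j.+1 *m w).
  split; first exact: mxinM.
  by rewrite mulmxA (fch j.+1) -mulmxA; apply: mxinM.
have := vanC (col_mx w u : 'cV_(rks Q j + rk_ p (rks P) j)).
case.
  split=> [i l|].
    by rewrite mxE; case: (split i) => a.
  rewrite /= mul_block_col mul0mx addr0 mulNmx => i l.
  by rewrite mxE; case: (split i) => a.
case: j w Tw Bw u Tu Bu {vanP vanC} => [|j] w Tw Bw u Tu Bu v [Tv].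
  rewrite /= mul_col_mx opp_col_mx add_col_mx => Bv.
  exists v; split=> // i l.
  by have := Bv (lshift _ i) l; rewrite col_mxEu.
rewrite /= -[v]vsubmxK mul_block_col opp_col_mx add_col_mx => Bv.
exists (usubmx v); split; first by move=> i l; rewrite mxE; apply: Tv.
by move=> i l; have := Bv (lshift _ i) l; rewrite col_mxEu mul0mx addr0.
Qed.

End Cone.

(** * Passing from T/B to T/(B + xT) for an x regular on T/B *)

Section ModRegular.
Variable R : comNzRingType.
Implicit Types (T B : set R).
Local Notation dg n C j := (rk_ n (rks C) j).
Variables (T B : set R) (x : R).
Hypotheses (Ti : is_ideal T) (Bi : is_ideal B) (BT : B `<=` T).
Hypothesis xreg : forall t, T t -> B (x * t) -> B t.
Let B' : set R := padd (B : set R^o) x T.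

Let B'i : is_ideal B'.
Proof. exact: (@submod_padd R R^o). Qed.

Let BB' : B `<=` B'.
Proof. exact: (@sub_padd R R^o). Qed.

Lemma mxin_regular p q (A : 'M[R]_(p, q)) :
  mxin T A -> mxin B (x *: A) -> mxin B A.
Proof. by move=> TA BA i j; apply: xreg => //; have := BA i j; rewrite mxE. Qed.

(** Connecting map of 0 -> T/B -> T/B -> T/B' -> 0, where the first map is multiplication by x: the
    coboundary of [w] is divisible by x modulo B, and [y] is the quotient. *)
Lemma cocycle_connect n (C : cx R n) j (w : 'cV[R]_(dg n C j)) : is_cx C ->
  cocycle_mod T B' w -> exists2 y : 'cV[R]_(rks C j),
    mxin B (df C j *m w - x *: y) & cocycle_mod (C := C) (j := j.+1) T B y.
Proof.
move=> Ccx [Tw] /mxin_padd[b [y [Bb Ty e]]].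
exists y; first by rewrite e addrK.
split=> //; apply: mxin_regular; first exact: mxinM.
have -> : x *: (df C j.+1 *m y) = - (df C j.+1 *m b).
  apply/eqP; rewrite -addr_eq0 scalemxAr -mulmxDr addrC -e mulmxA Ccx.
  by rewrite mul0mx.
by apply: mxinN => //; apply: mxinM.
Qed.

Lemma cobound_padd n (C : cx R n) j (z u : 'cV[R]_(dg n C j)) :
  cobound_mod T B z -> mxin T u -> cobound_mod T B' (z + x *: u).
Proof.
case: j z u => [|j] z u /=.
  move=> Bz Tu; apply: mxinD => //; first exact: mxin_sub Bz.
  exact: mxin_padd_mul.
move=> [v [Tv Bv]] Tu; exists v; split=> //; rewrite addrAC.
by apply: mxinD => //; [exact: mxin_sub Bv|exact: mxin_padd_mul].
Qed.

(** Exactness of Ext^j(M, T/B) -> Ext^j(M, T/B') -> Ext^(j+1)(M, T/B): if [u] bounds the connecting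
    class, then [w - x *: u] is a cocycle modulo B. *)
Lemma ext_vanish_padd n (C : cx R n) j : is_cx C ->
  ext_vanish C T B j -> ext_vanish C T B j.+1 -> ext_vanish C T B' j.
Proof.
move=> Ccx van vanS w [Tw Bw].
have [y By [Ty cy]] := cocycle_connect Ccx (conj Tw Bw).
have [u [Tu Bu]] := vanS _ (conj Ty cy).
rewrite -[w](subrK (x *: u)); apply: cobound_padd => //; apply: van.
split; first by apply: mxinB => //; apply: mxinZ.
rewrite mulmxBr -scalemxAr -[df C j *m w](subrK (x *: y)) -addrA -scalerBr.
by apply: mxinD => //; apply: mxinZ.
Qed.

Section Homotopy.
Variables (n : nat) (C : cx R n).
Hypothesis Ccx : is_cx C.
Variable H : forall j, 'M[R]_(dg n C j, rks C j).
Hypothesis xH : null_htpy (fun j => x%:M : 'M_(dg n C j)) H.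

Lemma ext_vanish0_htpy : ext_vanish C T B 0.
Proof.
move=> w [Tw Bw] /=; apply: mxin_regular => //.
by rewrite -mul_scalar_mx (proj1 xH) -mulmxA; apply: mxinM.
Qed.

(** When x is null-homotopic, as it is on a resolution of a module killed by x, the connecting map
    Ext^j(M, T/B') -> Ext^(j+1)(M, T/B) is onto: [H j *m w] is an explicit preimage of the class of
    [w]. *)
Lemma htpy_cocycle j (w : 'cV[R]_(rks C j)) : cocycle_mod (C := C) (j := j.+1) T B w ->
  cocycle_mod T B' (H j *m w) /\ mxin B (x *: w - df C j *m (H j *m w)).
Proof.
move=> [Tw Bw]; have e : x *: w - df C j *m (H j *m w) = H j.+1 *m (df C j.+1 *m w).
  rewrite -mul_scalar_mx; have /= -> := proj2 xH j.
  by rewrite mulmxDl !mulmxA addrK.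
split; last by rewrite e; apply: mxinM.
split; first exact: mxinM.
have -> : df C j *m (H j *m w) = - (H j.+1 *m (df C j.+1 *m w)) + x *: w.
  by rewrite -e opprB subrK.
apply: mxinD => //; last exact: mxin_padd_mul.
by apply: mxinN => //; apply: mxinM => //; apply: mxin_sub Bw.
Qed.

Lemma ext_vanish_htpy_padd j :
  ext_vanish C T B' j -> ext_vanish C T B j.+1.
Proof.
move=> van w cw; have [cy Bxw] := htpy_cocycle cw; have [Tw Bw] := cw.
suff [c Tc Bc] : exists2 c, mxin T c & mxin B (df C j *m (H j *m w - x *: c)).
  exists c; split=> //; apply: mxin_regular.
    by apply: mxinB => //; apply: mxinM.
  have -> : x *: (w - df C j *m c) = (x *: w - df C j *m (H j *m w)) +
      df C j *m (H j *m w - x *: c).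
    by rewrite mulmxBr addrA subrK scalerBr scalemxAr.
  exact: mxinD.
move: (H j *m w) (van _ cy) => y; case: j y {van w cw cy Bxw Tw Bw} => [|j] y /=.
  move=> /mxin_padd[b [c [Bb Tc ->]]]; exists c => //.
  by rewrite addrK; apply: mxinM.
move=> [u [Tu /mxin_padd[b [c [Bb Tc e]]]]]; exists c => //.
have -> : y - x *: c = b + df C j *m u.
  by apply/eqP; rewrite subr_eq -addrA [_ + x *: c]addrC addrA -e subrK.
by rewrite mulmxDr mulmxA Ccx mul0mx addr0; apply: mxinM.
Qed.

(** Surjectivity moves down one degree: the class of [y] is sent to degree j+1 by the connecting
    map, lifted there to C, and pulled back by [htpy_cocycle]. Vanishing of Ext^j(M_P, T/B) makes
    the connecting map injective on the side of P. *)
Lemma ext_lift_padd p (P : cx R p) (f : forall j, 'M[R]_(dg p P j, dg n C j)) j :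
  is_cx P -> chain_map f -> ext_vanish P T B j ->
  ext_lift f T B j.+1 -> ext_lift f T B' j.
Proof.
move=> Pcx fch van lift y [Ty By].
have [y' By' [Ty' cy']] := cocycle_connect Pcx (conj Ty By).
have [q [cq [u [Tu Bu]]]] := lift _ (conj Ty' cy').
have [cHq BHq] := htpy_cocycle cq.
exists (H j *m q); split=> //.
rewrite -[y - _](subrK (x *: u)); apply: cobound_padd => //; apply: van.
split.
  apply: mxinB => //; last exact: mxinZ.
  by apply: mxinB => //; apply: mxinM; case: cHq.
have -> : df P j *m (y - f j *m (H j *m q) - x *: u) =
   (df P j *m y - x *: y') + x *: (y' - f j.+1 *m q - df P j *m u) +
   f j.+1 *m (x *: q - df C j *m (H j *m q)).
  rewrite !mulmxBr (mulmxA (df P j)) fch -!scalemxAr !scalerBr -mulmxA.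
  move: (df P j *m y) (x *: y') (x *: (f j.+1 *m q)) (x *: (df P j *m u)).
  move: (f j.+1 *m _) => e a b c d.
  rewrite -(addrA b) (addrA (a - b) b) subrK [- c - d]addrC (addrA _ c) (addrA a).
  by rewrite subrK addrAC.
apply: mxinD => //; last exact: mxinM.
by apply: mxinD => //; apply: mxinZ.
Qed.

End Homotopy.

End ModRegular.

(** Ext^1(M, T/B) = 0 lifts maps M -> T/(B + xT) to T/B, and the vanishing of all positive Ext
    passes to T/(B + xT), so induction on s applies. *)
Lemma hom_lift (R : comNzRingType) (T B : set R) s n (C : cx R n) :
  is_ideal T -> is_ideal B -> B `<=` T -> is_cx C ->
  @wreg R R^o B T s -> (forall j, ext_vanish C T B j.+1) ->
  forall w : 'cV[R]_n, mxin T w -> mxin (@addmul R R^o B T s) (df C 0%N *m w) ->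
  exists w', [/\ mxin T w', mxin B (df C 0%N *m w') &
                 mxin (@addmul R R^o B T s) (w - w')].
Proof.
move=> Ti + + Ccx; elim: s B => [|x s IH] B Bi BT.
  move=> _ _ w Tw Bw; exists w; split=> //; rewrite subrr; exact: mxin0.
move=> /= [xreg sreg] van w Tw Bw.
have B'i : is_ideal (@padd R R^o B x T) by apply: (@submod_padd R R^o).
have B'T : @padd R R^o B x T `<=` T by apply: (@padd_subset R R^o).
have [|w1 [Tw1 Bw1 ww1]] := IH _ B'i B'T sreg _ w Tw Bw.
  by move=> j; apply: ext_vanish_padd.
have [y By [Ty cy]] := cocycle_connect Ti Bi xreg (j := 0%N) Ccx (conj Tw1 Bw1).
have [u [Tu Bu]] := van 0%N _ (conj Ty cy).
exists (w1 - x *: u); split.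
- by apply: mxinB => //; apply: mxinZ.
- rewrite mulmxBr -scalemxAr -[df C 0%N *m w1](subrK (x *: y)) -addrA -scalerBr.
  by apply: mxinD => //; apply: mxinZ.
have Ai : is_ideal (@addmul R R^o (@padd R R^o B x T) T s).
  exact: (@submod_addmul R R^o).
rewrite opprB addrCA addrC; apply: mxinD => //.
apply: (@mxin_sub R (@padd R R^o B x T)); first exact: (@sub_addmul R R^o).
exact: mxin_padd_mul.
Qed.

(** * Noetherian local rings *)

Lemma infinite_injection (k : Type) :
  infinite_set [set: k] -> exists c : nat -> k, injective c.
Proof.
elim/Ppointed: k => k; first by rewrite emptyE.
by move=> /infiniteP/pcard_injP[f fI]; exists f => i j; apply: fI; rewrite inE.
Qed.

Section LocalRing.
Variables (R : comNzRingType) (m : set R) (k : fieldType).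
Variable pi : {rmorphism R -> k}.
Hypothesis loc : noetherian_local m pi.

Let Rnoeth : noetherian R. Proof. by case: loc. Qed.

Lemma local_maxE a : m a <-> pi a = 0. Proof. by case: loc. Qed.

Lemma local_lift c : exists a, pi a = c. Proof. by case: loc. Qed.

Lemma proper_ideal_sub I : is_ideal I -> ~ I 1 -> I `<=` m.
Proof.
case: loc => _ h _ _ Ii nI1; apply: h => // e; apply: nI1; by rewrite e.
Qed.

Lemma local_max_ideal : is_ideal m.
Proof.
rewrite is_idealE; apply/is_submodP; split; first by apply/local_maxE; rewrite raddf0.
move=> a u v /local_maxE eu /local_maxE ev; apply/local_maxE.
by rewrite -[LHS]/(pi (a * u + v)) rmorphD rmorphM eu ev mulr0 addr0.
Qed.

Lemma local_max_proper : ~ m 1.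
Proof. by move/local_maxE; rewrite rmorph1 => /eqP; rewrite oner_eq0. Qed.

Lemma local_unit a : ~ m a -> exists b, b * a = 1.
Proof.
move=> nma; apply: contrapT => nb.
have Ii : is_ideal (rowspan (a%:M : 'M[R]_1) \o (fun b => b%:M)).
  rewrite is_idealE; apply/is_submodP; split.
    by exists 0; rewrite mul0mx raddf0.
  move=> c u v [w ew] [w' ew']; exists (c *: w + w').
  by rewrite mulmxDl -scalemxAl -ew -ew' raddfD /= scale_scalar_mx.
apply/nma/(proper_ideal_sub Ii) => [[w /matrixP/(_ 0 0)]|].
  rewrite !mxE big_ord1 !mxE eqxx !mulr1n => e.
  by apply: nb; exists (w 0 0).
by exists 1%:M; rewrite mul1mx.
Qed.

(** The determinant of 1 - A is congruent to 1 modulo m, hence a unit; the adjugate does the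
    rest. *)
Lemma local_matrix_inv p (A : 'M[R]_p) : mxin m A ->
  exists N, N *m (1%:M - A) = 1%:M.
Proof.
move=> mA; have [|b eb] := @local_unit (\det (1%:M - A)).
  move/local_maxE; rewrite -det_map_mx map_mxB map_mx1.
  have -> : map_mx pi A = 0.
    by apply/matrixP=> i j; rewrite !mxE; apply/local_maxE.
  by rewrite subr0 det1 => /eqP; rewrite oner_eq0.
exists (b *: \adj (1%:M - A)).
by rewrite -scalemxAl mul_adj_mx scale_scalar_mx eb.
Qed.

(** Nakayama's lemma without quotients: modulo L the generators are killed by the invertible matrix
    1 - c. *)
Lemma nakayama (V : lmodType R) (L : set V) p (g : 'I_p -> V) : is_submod L ->
  (forall i, exists2 c : 'I_p -> R, forall j, m (c j) &
     L (g i - \sum_j c j *: g j)) ->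
  forall i, L (g i).
Proof.
move=> Ls h.
have /choice[c hc] i : exists c : 'I_p -> R,
    (forall j, m (c j)) /\ L (g i - \sum_j c j *: g j).
  by have [c mc Lc] := h i; exists c.
have [|N eN] := @local_matrix_inv p (\matrix_(i, j) c i j).
  by move=> i j; rewrite mxE; case: (hc i).
move=> i; have -> : g i = \sum_l N i l *: (g l - \sum_j c l j *: g j).
  transitivity (\sum_j (\sum_l N i l * ((1%:M : 'M[R]_p) l j - c l j)) *: g j).
    have E j : \sum_l N i l * ((1%:M : 'M[R]_p) l j - c l j) = (i == j)%:R.
      have /matrixP/(_ i j) := eN; rewrite !mxE => <-.
      by apply: eq_bigr => l _; rewrite !mxE.
    rewrite (bigD1 i) //= E eqxx scale1r big1 ?addr0 // => j ji.
    by rewrite E eq_sym (negPf ji) scale0r.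
  under eq_bigr do rewrite scaler_suml.
  rewrite exchange_big /=; apply: eq_bigr => l _.
  under eq_bigr do rewrite -scalerA scalerBl.
  rewrite -scaler_sumr sumrB; congr (_ *: (_ - _)).
  rewrite (bigD1 l) //= big1 ?addr0 => [|j jl]; rewrite mxE.
    by rewrite eqxx scale1r.
  by rewrite eq_sym (negPf jl) scale0r.
apply: submod_sum => // l _; apply: submodZ => //; by case: (hc l).
Qed.

Lemma nakayama_rV n (K L : set 'rV[R]_n) x : is_submod K -> is_submod L -> m x ->
  (forall v, K v -> exists2 u, K u & L (v - x *: u)) -> K `<=` L.
Proof.
move=> Ks Ls mx h; have [p [G KG]] := noetherian_rowspan Rnoeth Ks.
rewrite KG; apply/rowspanP => //; apply: nakayama => // i.
have [|u + Lu] := h (row i G); first by rewrite KG; apply: row_rowspan.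
rewrite KG => -[c eu]; exists (fun j => x * c 0 j).
  by move=> j; rewrite mulrC; apply: idealM => //; apply: local_max_ideal.
move: Lu; rewrite eu mulmx_sum_row scaler_sumr.
by under eq_bigr do rewrite scalerA.
Qed.

Lemma nakayama_ideal (K L : set R) x : is_ideal K -> is_ideal L -> m x ->
  (forall v, K v -> exists2 u, K u & L (v - x * u)) -> K `<=` L.
Proof.
move=> Ki Li mx h; have [p [g Kg]] := Rnoeth Ki.
have gK i : K (g i).
  by rewrite Kg; apply: generated_mem.
suff gL i : L (g i).
  by rewrite Kg => _ [c ->]; apply: (@submod_sum R R^o) => // i _; apply: idealM.
move: i; apply: (@nakayama R^o) => // i.
have [u + Lu] := h _ (gK i); rewrite Kg => -[c eu].
exists (fun j => x * c j).
  by move=> j; rewrite mulrC; apply: idealM => //; apply: local_max_ideal.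
move: Lu; rewrite eu mulr_sumr.
by under eq_bigr do rewrite mulrA.
Qed.

(** * Elements regular on several modules, over an infinite residue field *)

Section Regular.
Hypothesis k_infinite : infinite_set [set: k].

(* Otherwise every y + c z kills some v_c outside B, and the submodules of M on
   which (y + c_0 z) ... (y + c_(i-1) z) takes values in B increase strictly:
   modulo B that product acts on v_(c_i) as a unit times z^i. *)
Lemma regular_pencil n (M B : set 'rV[R]_n) y z :
  is_submod M -> is_submod B -> B `<=` M ->
  (forall v, M v -> B (y *: v) -> B (z *: v) -> B v) ->
  exists c, forall v, M v -> B ((y + c * z) *: v) -> B v.
Proof.
move=> Ms Bs BM yz; have [d dinj] := infinite_injection k_infinite.
have /choice[c hc] i : exists a, pi a = d i by apply: local_lift.
pose P i := \prod_(l < i) (y + c l * z).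
pose S i : set 'rV[R]_n := [set v | M v /\ B (P i *: v)].
have PS i : P i.+1 = (y + c i * z) * P i by rewrite /P big_ord_recr /= [RHS]mulrC.
have [i|i v [Mv Bv]|i hi] := @noetherian_acc _ Rnoeth n S.
- apply/is_submodP; split; first by split; rewrite ?scaler0; apply: submod0.
  move=> a u v [Mu Bu] [Mv Bv]; split; first exact: submodP.
  by rewrite scalerDr scalerA mulrC -scalerA; apply: submodP.
- by split=> //; rewrite PS -scalerA; apply: submodZ.
exists (c i) => v Mv Bv.
have [_ BPv] : S i v.
  by apply: hi; split=> //; rewrite PS mulrC -scalerA; apply: submodZ.
pose u l := \prod_(l' < l) (c l' - c i).
have uP l : B (P l *: v - (u l * z ^+ l) *: v).
  elim: l => [|l IH]; first by rewrite /P /u !big_ord0 mul1r subrr; apply: submod0.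
  have -> : P l.+1 *: v - (u l.+1 * z ^+ l.+1) *: v =
     P l *: ((y + c i * z) *: v) +
     ((c l - c i) * z) *: (P l *: v - (u l * z ^+ l) *: v).
    rewrite scalerBr addrA !scalerA -scalerDl; congr (_ *: _ - _ *: _).
      by rewrite PS; ring.
    by rewrite /u big_ord_recr /= exprS; ring.
  by apply: submodD => //; apply: submodZ.
have [|b bu] := @local_unit (u i).
  move/local_maxE; rewrite rmorph_prod => /eqP/prodf_eq0[l _].
  rewrite rmorphB !hc subr_eq0 => /eqP/dinj e.
  by have := ltn_ord l; rewrite e ltnn.
have Bz : B (z ^+ i *: v).
  have -> : z ^+ i *: v = b *: (P i *: v) - b *: (P i *: v - (u i * z ^+ i) *: v).
    by rewrite -scalerBr opprB addrC subrK scalerA mulrA bu mul1r.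
  by apply: submodB => //; apply: submodZ.
(* When [z ^+ j.+1 *: v] and [(y + c i * z) *: v] are in B, both y and z send [z ^+ j *: v] into B,
   so [yz] lowers the exponent. *)
suff desc j : B (z ^+ j *: v) -> B v by exact: desc Bz.
elim: j => [|j IH] Bzj; first by rewrite scale1r in Bzj.
apply: IH; apply: yz; first exact: submodZ.
  have -> : y *: (z ^+ j *: v) =
      z ^+ j *: ((y + c i * z) *: v) - c i *: (z ^+ j.+1 *: v).
    by rewrite !scalerA -scalerBl; congr (_ *: _); rewrite exprS; ring.
  by apply: submodB => //; apply: submodZ.
by rewrite scalerA -exprS.
Qed.

(** A replacement for prime avoidance: the hypothesis says that M/B has no socle, and the generators
    of m are absorbed one at a time. On the part M' of M sent into B by [g i], the remaining
    generators provide y; some y + c g_i then works on all of M. *)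
Lemma regular_exists n (M B : set 'rV[R]_n) :
  is_submod M -> is_submod B -> B `<=` M ->
  (forall v, M v -> (forall a, m a -> B (a *: v)) -> B v) ->
  exists2 x, m x & forall v, M v -> B (x *: v) -> B v.
Proof.
move=> Ms Bs BM; have [p [g mg]] := Rnoeth local_max_ideal.
have gm i : m (g i).
  by rewrite mg; apply: generated_mem.
move=> h; have {h} : forall v, M v -> (forall i, i \in enum 'I_p -> B (g i *: v)) -> B v.
  move=> v Mv Bv; apply: h => // a; rewrite mg => -[c ->].
  rewrite scaler_suml; apply: submod_sum => // i _.
  by rewrite -scalerA; apply: submodZ => //; apply: Bv; rewrite mem_enum.
elim: (enum 'I_p) M Ms BM => [|i s IH] M Ms BM h.
  by exists 0 => [|v Mv _]; [exact: (@submod0 R R^o _ local_max_ideal)|exact: h].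
pose M' : set 'rV[R]_n := [set v | M v /\ B (g i *: v)].
have M's : is_submod M'.
  apply/is_submodP; split; first by split; [|rewrite scaler0]; apply: submod0.
  move=> a u v [Mu Bu] [Mv Bv]; split; first exact: submodP.
  by rewrite scalerDr scalerA mulrC -scalerA; apply: submodP.
have [||y my yreg] := IH M' M's.
- by move=> v Bv; split; [exact: BM|exact: submodZ].
- move=> v [Mv Bv] h'; apply: h => // j; rewrite inE => /orP[/eqP->//|]; exact: h'.
have [|c creg] := regular_pencil (y := y) (z := g i) Ms Bs BM.
  by move=> v Mv By Bg; apply: yreg.
exists (y + c * g i) => //; apply: (@submodD R R^o _ local_max_ideal) => //.
by apply: idealM => //; apply: local_max_ideal.
Qed.

(** The product of the T i is a submodule of R^n, so [regular_exists] gives one x for all quotients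
    at once. *)
Lemma common_regular n (T B : 'I_n -> set R) :
  (forall i, is_ideal (T i)) -> (forall i, is_ideal (B i)) ->
  (forall i, B i `<=` T i) ->
  (forall i t, T i t -> (forall a, m a -> B i (a * t)) -> B i t) ->
  exists2 x, m x & forall i t, T i t -> B i (x * t) -> B i t.
Proof.
move=> Ti Bi BT soc.
have sub (S : 'I_n -> set R) : (forall i, is_ideal (S i)) ->
    is_submod [set v : 'rV[R]_n | forall i, S i (v 0 i)].
  move=> Si; apply/is_submodP; split=> [i|a u v Su Sv i]; rewrite !mxE.
    exact: (@submod0 R R^o _ (Si i)).
  exact: (@submodP R R^o _ (Si i)).
have [v Bv i|v Tv h i|x mx xreg] := regular_exists (sub T Ti) (sub B Bi).
- exact: BT.
- by apply: soc => // a ma; have := h a ma i; rewrite mxE.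
exists x => // i t Tt Bt.
have := xreg (\row_j (if j == i then t else 0)).
have h (S : 'I_n -> set R) u : (forall i, is_ideal (S i)) -> S i u ->
    forall j, S j (if j == i then u else 0).
  by move=> Si Su j; case: eqP => [->//|_]; apply: (@submod0 R R^o _ (Si j)).
have -> : (x *: \row_j (if j == i then t else 0)) =
    \row_j (if j == i then x * t else 0) :> 'rV[R]_n.
  by apply/rowP=> j; rewrite !mxE; case: ifP => //; rewrite mulr0.
move=> /(_ _ _ i); rewrite mxE eqxx; apply=> j; rewrite mxE; exact: h.
Qed.

End Regular.

End LocalRing.

(** * Vanishing of Ext *)

Section Devissage.
Variables (R : comNzRingType) (m : set R) (k : fieldType).
Variable pi : {rmorphism R -> k}.
Hypothesis loc : noetherian_local m pi.
Local Notation dg n C j := (rk_ n (rks C) j).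

Let Rnoeth : noetherian R. Proof. by case: loc. Qed.

Lemma submod_colon n (Z : set 'rV[R]_n) (v : 'rV_n) :
  is_submod Z -> is_submod [set a : 'rV[R]_1 | Z (a *m v)].
Proof.
move=> Zs; apply/is_submodP; split=> [|a u w Zu Zw] /=.
  by rewrite mul0mx; apply: submod0.
by rewrite mulmxDl -scalemxAl; apply: submodP.
Qed.

(** The chain map x lifts multiplication by x on M, which is zero. *)
Lemma null_htpy_annihilator n (C : cx R n) x : acyclic C ->
  (forall v, rowspan (df C 0%N) (x *: v)) ->
  exists H, null_htpy (fun j => x%:M : 'M_(dg n C j)) H.
Proof.
move=> Cac h; apply: chain_map_null; [exact: (proj1 Cac)|exact: Cac| |].
  exact: scalar_chain_map.
by move=> i; rewrite -scalemx1 linearZ; apply: h.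
Qed.

Section Vanishing.
Variable T : set R.
Hypothesis Ti : is_ideal T.

Lemma ext_vanish_full n (C : cx R n) B j : is_ideal B -> acyclic C ->
  (forall v, rowspan (df C 0%N) v) -> ext_vanish C T B j.+1.
Proof.
move=> Bi Cac h; have [|H [_ HS]] := null_htpy_annihilator (x := 1) Cac.
  by move=> v; apply: h.
move=> w [Tw Bw]; exists (H j *m w); split; first exact: mxinM.
rewrite -[X in X - _]mul1mx (HS j) mulmxDl !mulmxA addrK -mulmxA.
exact: mxinM.
Qed.

(** The cone of x stands for M/xM, and its vanishing makes x surjective on Ext^(j+1)(M, T). This Ext
    is K/L, the cocycles modulo the coboundaries, written with row vectors so that [nakayama_rV]
    applies. *)
Lemma ext_vanish_scalar_cone n (C : cx R n) x j : m x ->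
  ext_vanish (cone (P := C) (Q := C) (fun j => x%:M)) T [set 0] j.+2 ->
  ext_vanish C T [set 0] j.+1.
Proof.
move=> mx van w [Tw Bw].
pose K : set 'rV[R]_(rks C j) := [set v | cocycle_mod (C := C) (j := j.+1) T [set 0] v^T].
pose L : set 'rV[R]_(rks C j) := [set v | cobound_mod (C := C) (j := j.+1) T [set 0] v^T].
suff KL : K `<=` L by have := KL w^T; rewrite /K /L /= trmxK; apply.
have Ks : is_submod K.
  apply/is_submodP; split=> [|a u v [Tu u0] [Tv v0]].
    by split; rewrite linear0 ?mulmx0; apply: mxin0 => //; apply: ideal_set0.
  split; rewrite linearP; first by apply: mxinD => //; apply: mxinZ.
  rewrite mulmxDr -scalemxAr.
  by apply: mxinD => //; [exact: ideal_set0| apply: mxinZ => //; exact: ideal_set0].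
have Ls : is_submod L.
  apply/is_submodP; split=> [|a u v [u' [Tu' u0]] [v' [Tv' v0]]].
    exists 0; split; first exact: mxin0.
    by rewrite linear0 mulmx0 subr0; apply: mxin0 => //; apply: ideal_set0.
  exists (a *: u' + v'); split; first by apply: mxinD => //; apply: mxinZ.
  rewrite linearP mulmxDr -scalemxAr opprD addrACA -scalerBr.
  by apply: mxinD => //; [exact: ideal_set0| apply: mxinZ => //; exact: ideal_set0].
apply: (nakayama_rV loc Ks Ls mx) => v Kv.
have [q [cq [u [Tu Bu]]]] := cone_ext_lift Ti (@ideal_set0 R) van Kv.
exists q^T; first by rewrite /K /= trmxK.
exists u; split=> //; rewrite linearB linearZ /= trmxK.
by rewrite -mul_scalar_mx.
Qed.

(** The long exact sequence of 0 -> Rv -> M -> M/Rv -> 0: P resolves Rv, whose relations form the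
    annihilator of v in M, and M/Rv is resolved by the cone, an instance of C'. *)
Lemma ext_vanish_extension n (C : cx R n) (v : 'rV_n) (P : cx R 1) j :
  acyclic C -> acyclic P ->
  rowspan (df P 0%N) = [set a : 'rV[R]_1 | rowspan (df C 0%N) (a *m v)] ->
  ext_vanish P T [set 0] j.+1 ->
  (forall C' : cx R n, acyclic C' -> rowspan (df C 0%N) `<=` rowspan (df C' 0%N) ->
     rowspan (df C' 0%N) v -> ext_vanish C' T [set 0] j.+1) ->
  ext_vanish C T [set 0] j.+1.
Proof.
move=> Cac Pac ePC vanP vanC.
have [|f [f0 fch]] := chain_map_lift (proj1 Pac) Cac (f0 := v).
  by move=> a; rewrite ePC.
have van : ext_vanish (cone f) T [set 0] j.+1.
  apply: vanC.
  - by apply: cone_acyclic => // u; rewrite f0 ePC.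
  - by move=> u Cu; apply/rowspan_cone; exists 0; rewrite mul0mx subr0.
  - apply/rowspan_cone; exists 1%:M; rewrite mul1mx f0 subrr.
    by apply: submod0; apply: submod_rowspan.
exact: (cone_ext_vanish fch Ti (@ideal_set0 R) vanP van).
Qed.

Variable e : nat.
Hypothesis van_k : forall C : cx R 1, acyclic C ->
  rowspan (df C 0%N) = [set v | m (v 0 0)] ->
  forall j, (e <= j)%N -> ext_vanish C T [set 0] j.+1.

(* A maximal ideal J for which R/J violates the claim is prime, by the sequences
   0 -> R/(J : a) -> R/J -> R/(J + a) -> 0; if x lies in m but not in J, then x is
   regular on R/J and Nakayama's lemma applies to Ext(R/J, T). *)
Lemma ext_vanish_cyclic (C : cx R 1) : acyclic C ->
  forall j, (e <= j)%N -> ext_vanish C T [set 0] j.+1.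
Proof.
suff main (Z : set 'rV[R]_1) : is_submod Z -> forall C : cx R 1, acyclic C ->
    rowspan (df C 0%N) = Z -> forall j, (e <= j)%N -> ext_vanish C T [set 0] j.+1.
  by move=> Cac; apply: main (submod_rowspan _) C Cac erefl.
move: Z => {C}; apply: noetherian_ind => // Z Zs IH C Cac eZ j ej.
have [Z1|nZ1] := pselect (Z 1%:M).
  apply: ext_vanish_full => // [|v]; first exact: ideal_set0.
  by rewrite eZ [v]mx11_scalar -scalemx1; apply: submodZ.
have [[a [b [nZa nZb Zba]]]|dom] :=
    pselect (exists a b, [/\ ~ Z a, ~ Z b & Z (b *m a)]).
  have [P [Pac eP]] := resolution_exists Rnoeth (submod_colon a Zs).
  apply: (ext_vanish_extension (v := a) Cac Pac); rewrite ?eZ //.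
    apply: (IH _ (submod_colon a Zs)) => // [c Zc|/(_ b Zba)//].
    by rewrite /= [a]mx11_scalar mul_mx_scalar; apply: submodZ.
  move=> C' C'ac sub C'a.
  apply: (IH _ (submod_rowspan _) sub _ C' C'ac erefl j ej) => sub'.
  exact/nZa/sub'.
have [[x [mx nZx]]|mZ] := pselect (exists x, m x /\ ~ Z x%:M).
  apply: (ext_vanish_scalar_cone mx).
  apply: (IH _ (submod_rowspan _) _ _ _ _ erefl j.+1 (leqW ej)).
  - by move=> u Zu; apply/rowspan_cone; exists 0; rewrite mul0mx subr0 eZ.
  - move=> /(_ x%:M) h; apply/nZx/h/rowspan_cone; exists 1%:M.
    by rewrite mul1mx subrr; apply: submod0; apply: submod_rowspan.
  - apply: cone_acyclic => //; first exact: scalar_chain_map.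
    by move=> u; rewrite eZ => Zu; apply: contrapT => nZu; apply: dom; exists x%:M, u.
(* The proper submodule Z now contains m, so it is m and [van_k] applies. *)
apply: van_k ej => //; rewrite eZ; apply/seteqP; split=> v.
  have Ii : is_ideal [set a | Z a%:M].
    rewrite is_idealE; apply/is_submodP; split=> [|a u w Zu Zw] /=.
      by rewrite raddf0; apply: submod0.
    by rewrite raddfD /= -scale_scalar_mx; apply: submodP.
  rewrite [v]mx11_scalar => Zv; apply: (proper_ideal_sub loc Ii) => //=.
  by rewrite mxE eqxx mulr1n.
by move=> mv; apply: contrapT => nZv; apply: mZ; exists (v 0 0); rewrite -mx11_scalar.
Qed.

(** One cyclic submodule Rv is peeled off at a time: the quotient is presented by a larger Z, to
    which Noetherian induction applies. *)
Lemma ext_vanish_above n (C : cx R n) : acyclic C ->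
  forall j, (e <= j)%N -> ext_vanish C T [set 0] j.+1.
Proof.
suff main (Z : set 'rV[R]_n) : is_submod Z -> forall C : cx R n, acyclic C ->
    rowspan (df C 0%N) = Z -> forall j, (e <= j)%N -> ext_vanish C T [set 0] j.+1.
  by move=> Cac; apply: main (submod_rowspan _) C Cac erefl.
move: Z => {C}; apply: noetherian_ind => // Z Zs IH C Cac eZ j ej.
have [ZT|] := pselect (forall v, Z v).
  by apply: ext_vanish_full => // [|v]; [exact: ideal_set0|rewrite eZ].
move=> /existsNP[v nZv].
have [P [Pac eP]] := resolution_exists Rnoeth (submod_colon v Zs).
apply: (ext_vanish_extension (v := v) Cac Pac); rewrite ?eZ //.
  exact: ext_vanish_cyclic.
move=> C' C'ac sub C'v.
apply: (IH _ (submod_rowspan _) sub _ C' C'ac erefl j ej) => sub'.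
exact/nZv/sub'.
Qed.

(* One regular element x at a time: Ext^(j+1)(M/xM, T) = 0 makes x surjective on
   Ext^j(M, T), which is then 0 by Nakayama's lemma. *)
Lemma ext_vanish_climb s n (C : cx R n) j : acyclic C ->
  (forall x, x \in s -> m x) -> wreg (rowspan (df C 0%N)) setT s ->
  (e <= j + size s)%N -> ext_vanish C T [set 0] j.+1.
Proof.
elim: s n C j => [|x s IH] n C j Cac sm /=.
  by move=> _; rewrite addn0; apply: ext_vanish_above.
move=> [xreg sreg] ej.
have eC : rowspan (df (cone (P := C) (Q := C) (fun j => x%:M)) 0%N) =
    padd (rowspan (df C 0%N)) x setT.
  apply/seteqP; split=> v.
    move/rowspan_cone => [u]; rewrite mul_mx_scalar => Cu.
    by exists (v - x *: u), u; rewrite subrK.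
  move=> [b [t [Cb _ ->]]]; apply/rowspan_cone; exists t.
  by rewrite mul_mx_scalar addrK.
apply: (@ext_vanish_scalar_cone _ _ x); first by apply: sm; rewrite mem_head.
apply: IH; last by rewrite addSnnS.
- apply: cone_acyclic => //; first exact: scalar_chain_map.
  by move=> u; rewrite mul_mx_scalar; apply: xreg.
- by move=> y ys; apply: sm; rewrite inE ys orbT.
- by rewrite eC.
Qed.

End Vanishing.
End Devissage.

(** * Shifting the degree of Ext along a regular sequence *)

Section RegularSequences.
Variable R : comNzRingType.
Implicit Types (T B : set R).
Local Notation dg n C j := (rk_ n (rks C) j).

Definition annihilates n (C : cx R n) (s : seq R) :=
  forall x, x \in s -> forall v, rowspan (df C 0%N) (x *: v).

Lemma annihilates_cons n (C : cx R n) x s :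
  annihilates C (x :: s) -> (forall v, rowspan (df C 0%N) (x *: v)) /\ annihilates C s.
Proof.
move=> h; split; first by apply: h; rewrite mem_head.
by move=> y ys; apply: h; rewrite inE ys orbT.
Qed.

Lemma ideal_padd T B x : is_ideal T -> is_ideal B -> is_ideal (@padd R R^o B x T).
Proof. by move=> Ti Bi; apply: (@submod_padd R R^o). Qed.

Lemma ideal_padd_sub T B x : is_ideal T -> B `<=` T -> @padd R R^o B x T `<=` T.
Proof. by move=> Ti BT; apply: (@padd_subset R R^o). Qed.

Lemma ideal_addmul T B s : is_ideal T -> is_ideal B -> is_ideal (@addmul R R^o B T s).
Proof. by move=> Ti Bi; apply: (@submod_addmul R R^o). Qed.

Variable T : set R.
Hypothesis Ti : is_ideal T.

(** Rees's argument: each element of s lowers the degree by one, until a Hom from a module killed by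
    x into one on which x is regular is left. *)
Lemma ext_vanish_below s B n (C : cx R n) j : is_ideal B -> B `<=` T ->
  acyclic C -> @wreg R R^o B T s -> annihilates C s -> (j < size s)%N ->
  ext_vanish C T B j.
Proof.
move=> + + Cac; elim: s B j => // x s IH B j Bi BT /= [xreg sreg].
move=> /annihilates_cons[xC sC] js.
have [H xH] := null_htpy_annihilator Cac xC.
case: j js => [|j] js; first exact: (ext_vanish0_htpy Bi xreg xH).
apply: (ext_vanish_htpy_padd Ti Bi xreg (proj1 Cac) xH).
by apply: IH => //; [exact: ideal_padd|exact: ideal_padd_sub].
Qed.

(** Surjectivity on Ext in degree [size s] becomes surjectivity on Hom into T/(B + sT);
    [ext_vanish_below] supplies the injectivity of the connecting maps. *)
Lemma ext_lift_addmul s B n p (P : cx R p) (Q : cx R n)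
    (f : forall j, 'M[R]_(dg p P j, dg n Q j)) : is_ideal B -> B `<=` T ->
  acyclic P -> acyclic Q -> chain_map f -> annihilates P s -> annihilates Q s ->
  @wreg R R^o B T s -> ext_lift f T B (size s) ->
  ext_lift f T (@addmul R R^o B T s) 0.
Proof.
move=> + + Pac Qac fch; elim: s B => // x s IH B Bi BT /=.
move=> Pxs /annihilates_cons[xQ sQ] [xreg sreg] lift.
have [H xH] := null_htpy_annihilator Qac xQ.
have [_ sP] := annihilates_cons Pxs.
apply: IH => //; [exact: ideal_padd|exact: ideal_padd_sub|].
apply: (ext_lift_padd Ti Bi xreg xH (proj1 Pac) fch _ lift).
exact: (@ext_vanish_below (x :: s)).
Qed.

Lemma ext_vanish_addmul s B n (C : cx R n) e : is_ideal B -> B `<=` T ->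
  is_cx C -> @wreg R R^o B T s ->
  (forall j, (j < e + size s)%N -> ext_vanish C T B j) ->
  forall j, (j < e)%N -> ext_vanish C T (@addmul R R^o B T s) j.
Proof.
move=> + + Ccx; elim: s B => [|x s IH] B Bi BT /=.
  by move=> _ van j je; apply: van; rewrite addn0.
move=> [xreg sreg] van; apply: IH => //; [exact: ideal_padd|exact: ideal_padd_sub|].
move=> j je; apply: ext_vanish_padd => //; apply: van; rewrite addnS //.
by apply: leqW.
Qed.

Lemma ext_vanish_addmul_inv s B n (C : cx R n) j : is_ideal B -> B `<=` T ->
  acyclic C -> @wreg R R^o B T s -> annihilates C s ->
  ext_vanish C T (@addmul R R^o B T s) j -> ext_vanish C T B (j + size s).
Proof.
move=> + + Cac; elim: s B j => [|x s IH] B j Bi BT /=; first by rewrite addn0.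
move=> [xreg sreg] /annihilates_cons[xC sC] van.
have [H xH] := null_htpy_annihilator Cac xC.
rewrite addnS; apply: (ext_vanish_htpy_padd Ti Bi xreg (proj1 Cac) xH).
by apply: IH => //; [exact: ideal_padd|exact: ideal_padd_sub].
Qed.

End RegularSequences.

(** Multiplication by G identifies R^p modulo the preimage of B with [rowspan G] modulo B. *)
Lemma wreg_preimage (R : comNzRingType) p q (G : 'M[R]_(p, q)) s (B : set 'rV_q) :
  is_submod B -> B `<=` rowspan G -> wreg B (rowspan G) s ->
  wreg [set a | B (a *m G)] setT s.
Proof.
elim: s B => // x s IH B Bs BG /= [xreg sreg]; split.
  move=> t _; rewrite -scalemxAl; apply: xreg; by exists t.
have -> : padd [set a | B (a *m G)] x setT = [set a | padd B x (rowspan G) (a *m G)].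
  apply/seteqP; split=> a.
    move=> [b [t [Bb _ ->]]]; exists (b *m G), (t *m G); split=> //.
      by exists t.
    by rewrite mulmxDl scalemxAl.
  move=> [b [t [Bb [c ->] e]]]; exists (a - x *: c), c; split=> //.
    by rewrite /= mulmxBl -scalemxAl e addrK.
  by rewrite subrK.
apply: IH => //; first by apply: submod_padd => //; apply: submod_rowspan.
by apply: padd_subset => //; apply: submod_rowspan.
Qed.

(** * Separating elements by maps into T/sT and into T *)

Section Separation.
Variables (R : comNzRingType) (m : set R) (k : fieldType).
Variable pi : {rmorphism R -> k}.
Hypothesis loc : noetherian_local m pi.
Variables (T : set R) (s : seq R).
Hypotheses (Ti : is_ideal T) (sm : forall x, x \in s -> m x).
Hypothesis sT : @wreg R R^o [set 0] T s.
Hypothesis van : forall n (C : cx R n), acyclic C ->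
  forall j, (size s <= j)%N -> ext_vanish C T [set 0] j.+1.
Let sTT : set R := @addmul R R^o [set 0] T s.
Variable t0 : R.
Hypotheses (Tt0 : T t0) (nt0 : ~ sTT t0) (mt0 : forall a, m a -> sTT (a * t0)).

Let Rnoeth : noetherian R. Proof. by case: loc. Qed.

Let T0 : [set 0] `<=` T.
Proof. by move=> _ ->; apply: (@submod0 R R^o). Qed.

Let sTTi : is_ideal sTT. Proof. by apply: ideal_addmul => //; apply: ideal_set0. Qed.

(* T/sT cogenerates the modules killed by s: the residue field embeds in it, and
   maps into it extend since Ext^(d+1)(-, T) = 0. *)
Lemma separate_quotient n (Z : set 'rV[R]_n) v : is_submod Z ->
  (forall x u, x \in s -> Z (x *: u)) -> ~ Z v ->
  exists w : 'cV[R]_n, [/\ mxin T w, forall z, Z z -> mxin sTT (z *m w) &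
    ~ mxin sTT (v *m w)].
Proof.
move=> Zs sZ nZv.
have [Q [Qac eQ]] := resolution_exists Rnoeth Zs.
have [P [Pac eP]] := resolution_exists Rnoeth (submod_colon v Zs).
have [|f [f0 fch]] := chain_map_lift (proj1 Pac) Qac (f0 := v).
  by move=> a; rewrite eP eQ.
have lift : ext_lift f T [set 0] (size s).
  apply: cone_ext_lift => //; first exact: ideal_set0.
  by apply: van => //; apply: cone_acyclic => // u; rewrite f0 eP eQ.
(* The annihilator of v modulo Z lies in m, which kills [t0] modulo sT; so v -> t0 defines a map
   from Rv to T/sT, and this map is extended to R^n/Z. *)
have Zm (a : 'rV[R]_1) : Z (a *m v) -> m (a 0 0).
  rewrite [a]mx11_scalar mul_scalar_mx mxE eqxx mulr1n => Zav.
  apply: contrapT => /(local_unit loc)[b ba]; apply: nZv.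
  by rewrite -[v]scale1r -ba -scalerA; apply: submodZ.
have [|||w [[Tw Bw] /= Bt]] := ext_lift_addmul Ti (@ideal_set0 R) T0 Pac Qac fch
    _ _ sT lift (y := t0%:M).
- by move=> x xs u; rewrite eP /= -scalemxAl; exact: sZ.
- by move=> x xs u; rewrite eQ; apply: sZ.
- split=> [i j|i j]; first by rewrite !ord1 mxE.
  rewrite ord1 mul_mx_scalar mxE mulrC; apply: mt0.
  have : rowspan (df P 0%N) (row i (df P 0%N)) by apply: row_rowspan.
  by rewrite eP => /Zm; rewrite mxE.
exists w; split=> //.
  by move=> z; rewrite -eQ => -[c ->]; rewrite -mulmxA; apply: mxinM.
move=> Bvw; apply: nt0; rewrite f0 in Bt.
have := mxinBl sTTi Bvw Bt => /(_ 0 0).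
by rewrite mxE eqxx.
Qed.

(** Present M as R^p modulo relations and separate v from L there by a map to T/sT. As s is regular
    on M, Ext^i(M, T) = 0 for all i > 0, so [hom_lift] yields a map to T that agrees with it modulo
    sT. *)
Lemma separate_submodule q (M L : set 'rV[R]_q) v : is_submod M -> is_submod L ->
  wreg [set 0] M s -> (forall x u, x \in s -> M u -> L (x *: u)) ->
  M v -> ~ L v ->
  exists F : 'rV[R]_q -> R,
    [/\ forall a u w, M u -> M w -> F (a *: u + w) = a * F u + F w,
        forall u, M u -> T (F u), forall u, M u -> L u -> sTT (F u) & ~ sTT (F v)].
Proof.
move=> Ms Ls sM sML Mv nLv; have [p [G MG]] := noetherian_rowspan Rnoeth Ms.
have G0 : is_submod [set a : 'rV[R]_p | a *m G = 0].
  apply/is_submodP; split; first by rewrite /= mul0mx.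
  by move=> a u w /= eu ew; rewrite mulmxDl -scalemxAl eu ew scaler0 addr0.
have [D [Dac eD]] := resolution_exists Rnoeth G0.
have vanD j : ext_vanish D T [set 0] j.+1.
  apply: (ext_vanish_climb loc Ti (e := size s) _ Dac sm); last exact: leq_addl.
    by move=> C Cac _ i si; apply: van.
  rewrite eD; apply: (wreg_preimage (B := [set 0])); rewrite -?MG //.
    exact: submod_set0.
  by move=> _ ->; apply: submod0.
have [a0 ea0] : rowspan G v by rewrite -MG.
have [|||w [Tw Zw nw]] := @separate_quotient p [set a | L (a *m G)] a0.
- apply/is_submodP; split=> [|a u w Lu Lw] /=; first by rewrite mul0mx; apply: submod0.
  by rewrite mulmxDl -scalemxAl; apply: submodP.
- by move=> x u xs; rewrite /= -scalemxAl; apply: sML => //; rewrite MG; exists u.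
- by rewrite /= -ea0.
have [|w' [Tw' Dw' ww']] := hom_lift Ti (@ideal_set0 R) T0 (proj1 Dac) sT vanD Tw.
  move=> i j; have -> : (df D 0%N *m w) i j = (row i (df D 0%N) *m w) 0 j.
    by rewrite -row_mul [RHS]mxE.
  apply: Zw; have : rowspan (df D 0%N) (row i (df D 0%N)) by apply: row_rowspan.
  by rewrite eD /= => ->; apply: submod0.
move/mxin_set0: Dw' => Dw'.
(* As [w'] kills the relations, its value does not depend on the coordinates [c u] chosen for u
   below. *)
have wd (a b : 'rV[R]_p) : a *m G = b *m G -> a *m w' = b *m w'.
  move=> e; have : rowspan (df D 0%N) (a - b).
    by rewrite eD /= mulmxBl e subrr.
  move=> [c ec]; apply/eqP; rewrite -subr_eq0 -mulmxBl ec -mulmxA Dw' mulmx0.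
  exact: eqxx.
have /choice[c hc] (u : 'rV[R]_q) : exists c : 'rV_p, M u -> u = c *m G.
  have [|nMu] := pselect (M u); last by exists 0.
  by rewrite MG => -[c ec]; exists c.
exists (fun u => (c u *m w') 0 0); split.
- move=> a u z Mu Mz; have -> : c (a *: u + z) *m w' = (a *: c u + c z) *m w'.
    by apply: wd; rewrite -hc ?mulmxDl -?scalemxAl -?hc //; apply: submodP.
  by rewrite mulmxDl -scalemxAl !mxE.
- by move=> u Mu; apply: mxinM.
- move=> u Mu Lu; apply: (mxinBl sTTi (B := c u *m (w' - w))).
    by apply: mxinM => //; rewrite -opprB; apply: mxinN.
  rewrite mulmxBr subKr; apply: Zw; by rewrite /= -hc.
move=> Bv; apply: nw => i j; rewrite !ord1.
have -> : a0 *m w = c v *m w' + a0 *m (w - w').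
  have -> : c v *m w' = a0 *m w' by apply: wd; rewrite -hc.
  by rewrite -mulmxDr addrC subrK.
rewrite mxE; apply: (@submodD R R^o _ sTTi) => //; exact: mxinM.
Qed.

End Separation.

Definition lincomb (R : comNzRingType) (V : lmodType R) n (u : 'I_n -> V)
  (v : 'rV[R]_n) : V := \sum_i v 0 i *: u i.

Lemma lincomb_is_linear (R : comNzRingType) (V : lmodType R) n (u : 'I_n -> V) :
  linear (lincomb u).
Proof.
move=> a v w; rewrite /lincomb scaler_sumr -big_split; apply: eq_bigr => i _ /=.
by rewrite !mxE scalerDl scalerA.
Qed.

HB.instance Definition _ (R : comNzRingType) (V : lmodType R) n (u : 'I_n -> V) :=
  GRing.isLinear.Build R 'rV[R]_n V _ (lincomb u) (lincomb_is_linear u).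

Lemma linear_lincomb (R : comNzRingType) (V W : lmodType R) n (u : 'I_n -> V)
  (f : {linear V -> W}) v : f (lincomb u v) = lincomb (f \o u) v.
Proof. by rewrite linear_sum; apply: eq_bigr => i _ /=; rewrite linearZ. Qed.

Lemma lincombE (R : comNzRingType) (V : lmodType R) n (f : {linear 'rV[R]_n -> V}) v :
  f v = lincomb (fun i => f (delta_mx 0 i)) v.
Proof.
rewrite {1}[v]row_sum_delta linear_sum; apply: eq_bigr => i _.
by rewrite linearZ.
Qed.

Lemma lincomb_col (R : comNzRingType) n (w : 'cV[R]_n) v :
  lincomb (V := R^o) (fun i => w i 0) v = (v *m w) 0 0.
Proof. by rewrite mxE. Qed.

(** * Resolutions of the residue field *)

Section ResidueResolution.
Variables (R : comNzRingType) (m : set R) (k : fieldType).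
Variable pi : {rmorphism R -> k}.
Hypothesis loc : noetherian_local m pi.
Variable F : free_resolution pi.

(** The [match] makes the types agree, since [rk_] reduces only on a constructor. *)
Definition res_cx : cx R (rk F 0) :=
  @Cx R (rk F 0) (fun j => rk F j.+1)
    (fun j => match j with 0%N => diff F 0 | j'.+1 => diff F j'.+1 end).

Lemma res_cx_acyclic : acyclic res_cx.
Proof.
split=> [|[|j] v].
- by case=> [|j]; apply/row_matrixP=> i; rewrite row_mul row0; apply/diff_exact;
    exists (delta_mx 0 i); rewrite rowE.
- by move/diff_exact.
- by move/diff_exact.
Qed.

Lemma aug_entry : exists A : 'cV[R]_(rk F 0), forall v, aug F v = pi ((v *m A) 0 0).
Proof.
have /choice[a ha] i : exists a, pi a = aug F (delta_mx 0 i) by apply: (local_lift loc).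
exists (\col_i a i) => v; rewrite {1}[v]row_sum_delta linear_sum mxE rmorph_sum.
by apply: eq_bigr => i _; rewrite linearZ /= mxE rmorphM ha.
Qed.

Lemma res_cx_annihilates s : (forall x, x \in s -> m x) -> annihilates res_cx s.
Proof.
move=> sm x xs v; apply/aug_exact; rewrite linearZ /=.
by have /(local_maxE loc) -> := sm x xs; rewrite mul0r.
Qed.

(** The given F may have several generators in degree 0, while the devissage uses resolutions of R/m
    starting with R. A preimage [e] of 1 and a lift [A] of the augmentation induce chain maps in the
    two directions, whose composite on C is homotopic to the identity. *)
Lemma ext_vanish_residue T B (C : cx R 1) j : is_ideal T -> is_ideal B ->
  acyclic C -> rowspan (df C 0%N) = [set v | m (v 0 0)] ->
  ext_vanish res_cx T B j -> ext_vanish C T B j.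
Proof.
move=> Ti Bi Cac eC; have Fac := res_cx_acyclic.
have [e ee] := aug_surj F 1; have [A hA] := aug_entry.
have [v|f [f0 fch]] := chain_map_lift (proj1 Cac) Fac (f0 := e).
  rewrite eC /= => mv; apply/aug_exact.
  by rewrite [v]mx11_scalar mul_scalar_mx linearZ /= (iffLR (local_maxE loc _)) ?mul0r.
have [v|g [g0 gch]] := chain_map_lift (proj1 Fac) Cac (f0 := A).
  rewrite eC => /aug_exact; rewrite hA => h /=; exact/(local_maxE loc).
have [||H hH] := @chain_map_null _ _ _ C C (proj1 Cac) Cac (fun j => f j *m g j - 1%:M).
- move=> i; rewrite mulmxBr mulmxBl mulmx1 mul1mx mulmxA fch -mulmxA gch mulmxA.
  by [].
- move=> i; rewrite eC f0 g0 /= !mxE; apply/(local_maxE loc).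
  have := hA e; rewrite ee => h.
  rewrite rmorphB ord1 eqxx rmorph1 h mxE; apply/eqP; rewrite subr_eq0; apply/eqP.
  by congr (pi _); apply: eq_bigr => l _; rewrite ?mxE.
exact: ext_vanish_htpy hH.
Qed.

(** An element t killed by m modulo B gives a map k -> T/B with column [t *: A], where A lifts the
    augmentation. It vanishes, and evaluation at [e], where A takes a unit value, puts t in B. *)
Lemma ext_vanish0_socle T B : is_ideal T -> is_ideal B ->
  ext_vanish res_cx T B 0 ->
  forall t, T t -> (forall a, m a -> B (a * t)) -> B t.
Proof.
move=> Ti Bi van t Tt mt; have [e ee] := aug_surj F 1; have [A hA] := aug_entry.
have tAB p (G : 'M[R]_(p, rk F 0)) : (forall i, m ((G *m A) i 0)) -> mxin B (G *m (t *: A)).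
  by move=> mG i j; rewrite -scalemxAr mxE ord1 mulrC; apply: mt.
have [|b be] := @local_unit _ _ _ _ loc ((e *m A) 0 0).
- by move/(local_maxE loc); rewrite -hA ee => /eqP; rewrite oner_eq0.
have : mxin B (e *m (t *: A)).
  apply: mxinM => //; apply: van; split=> [i j|].
    by rewrite mxE mulrC; apply: idealM.
  apply: tAB => i; apply/(local_maxE loc).
  have -> : (df res_cx 0%N *m A) i 0 = (row i (diff F 0) *m A) 0 0.
    by rewrite -row_mul [RHS]mxE.
  by rewrite -hA; apply/aug_exact; exists (delta_mx 0 i); rewrite rowE.
move/(_ 0 0); rewrite -scalemxAr mxE => Bt.
by rewrite -[t]mul1r -be -mulrA [_ * t]mulrC; apply: idealM.
Qed.

(** Any entry outside B of a degree 0 cocycle will do: m times a basis vector consists of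
    boundaries, because m kills k. *)
Lemma socle_exists T B : is_ideal T -> is_ideal B -> ~ ext_vanish res_cx T B 0 ->
  exists t, [/\ T t, ~ B t & forall a, m a -> B (a * t)].
Proof.
move=> Ti Bi /existsNP[w /not_implyP[[Tw Bw] /= nBw]].
have /existsNP[i /existsNP[j nB]] := nBw.
exists (w i j); split=> // a ma.
have [c ec] : exists c, a *: (delta_mx 0 i : 'rV_(rk F 0)) = c *m diff F 0.
  by apply/aug_exact; rewrite linearZ /= (iffLR (local_maxE loc _)) ?mul0r.
have -> : a * w i j = (c *m (df res_cx 0%N *m w)) 0 j.
  by rewrite mulmxA -[c *m _]/(c *m diff F 0) -ec -scalemxAl -rowE !mxE.
exact: (@mxinM R B Bi _ _ _ c _ Bw 0 j).
Qed.

End ResidueResolution.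

(** * Canonical ideals *)

Section Canonical.
Variables (R : comNzRingType) (m : set R) (k : fieldType).
Variable pi : {rmorphism R -> k}.
Hypothesis loc : noetherian_local m pi.
Implicit Types (T W B : set R).

(** The form in which canonical modules are used: their Ext is transported from W to the ideal T
    itself, where cochains are columns. *)
Definition ext_concentrated T d := exists F : free_resolution pi,
  (forall j, j <> d -> ext_vanish (res_cx F) T [set 0] j) /\
  ~ ext_vanish (res_cx F) T [set 0] d.

Section Transport.
Variables (W : lmodType R) (f : {linear W -> R^o}) (F : free_resolution pi).
Hypothesis finj : injective f.

Let lift_col n (w : 'cV[R]_n) : mxin (range f) w ->
  exists u : 'I_n -> W, forall v, f (lincomb u v) = (v *m w) 0 0.
Proof.
move=> fw; have /choice[u hu] i : exists u, f u = w i 0.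
  by have [u _ e] := fw i 0; exists u.
exists u => v; rewrite linear_lincomb -lincomb_col; apply: eq_bigr => i _ /=.
by rewrite hu.
Qed.

Let to_col n (phi : {linear 'rV[R]_n -> W}) :
  exists2 w : 'cV[R]_n, mxin (range f) w & forall v, f (phi v) = (v *m w) 0 0.
Proof.
exists (\col_i f (phi (delta_mx 0 i))).
  by move=> i j; rewrite mxE; exists (phi (delta_mx 0 i)).
move=> v; rewrite lincombE linear_lincomb -lincomb_col; apply: eq_bigr => i _ /=.
by rewrite mxE.
Qed.

Let col_eq n p (A : 'M[R]_(p, n)) (w : 'cV[R]_n) :
  (forall v : 'rV_p, (v *m A *m w) 0 0 = 0) -> A *m w = 0.
Proof.
move=> h; apply/matrixP=> i j; rewrite ord1 [RHS]mxE -(h (delta_mx 0 i)).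
by rewrite -mulmxA -rowE [RHS]mxE.
Qed.

Lemma ext_vanish_dim j : dim_Ext F W j 0 ->
  ext_vanish (res_cx F) (range f) [set 0] j.
Proof.
case=> z [_ h _] w [Tw /mxin_set0 Bw].
have hcob (phi : {linear 'rV[R]_(rk F j) -> W}) :
    cocycle phi -> coboundary (phi : 'rV[R]_(rk F j) -> W).
  move=> /h[a]; congr coboundary; apply/funext => v.
  by rewrite big_ord0 subr0.
have cu (u : 'I_(rk F j) -> W) (w' : 'cV[R]_(rk F j)) :
    (forall v, f (lincomb u v) = (v *m w') 0 0) -> diff F j *m w' = 0 ->
    cocycle (lincomb u).
  by move=> hu w0 v; apply: finj; rewrite hu raddf0 -mulmxA w0 mulmx0 mxE.
case: j w Tw Bw {z h} hcob cu => [|j] w Tw Bw hcob cu.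
  have [u hu] := lift_col Tw; have /= u0 := hcob (lincomb u) (cu _ _ hu Bw).
  apply/mxin_set0; rewrite -[w]mul1mx; apply: col_eq => v.
  by rewrite mulmx1 -hu u0 raddf0.
(* This second case split only lets the types of [res_cx] reduce. *)
case: j w Tw Bw hcob cu => [|j] w Tw Bw hcob cu; have [u hu] := lift_col Tw;
  have [g hg] := hcob (lincomb u) (cu _ _ hu Bw); have [c Tc hc] := to_col g;
  exists c; (split; first by []); apply/mxin_set0; rewrite -[w - _]mul1mx;
  apply: col_eq => v;
  by rewrite mulmx1 mulmxBr mulmxA mxE -hu hg hc [X in _ + X]mxE subrr.
Qed.

Lemma ext_nonvanish_dim j : dim_Ext F W j 1 ->
  ~ ext_vanish (res_cx F) (range f) [set 0] j.
Proof.
case=> z [zc _ zfree] van.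
have zcob : ~ coboundary (z ord0 : 'rV[R]_(rk F j) -> W).
  move=> cob; have := zfree (fun _ => 1).
  have -> : (fun v => \sum_(j0 < 1) 1 *: z j0 v) = z ord0.
    by apply/funext => v; rewrite big_ord1 scale1r.
  by move=> /(_ cob ord0); rewrite rmorph1 => /eqP; rewrite oner_eq0.
apply: zcob; move: (z ord0) (zc ord0) => {z zc zfree} phi cphi.
have [w Tw hw] := to_col phi.
have Bw : diff F j *m w = 0.
  by apply: col_eq => v; rewrite -hw cphi raddf0.
case: j phi cphi w Tw hw Bw van => [|j] phi cphi w Tw hw Bw van.
  have /mxin_set0 w0 := van w (conj Tw (iffRL (mxin_set0 _) Bw)).
  by move=> v; apply: finj; rewrite hw w0 mulmx0 mxE raddf0.
have [c [Tc /mxin_set0/eqP]] := van w (conj Tw (iffRL (mxin_set0 _) Bw)).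
rewrite subr_eq0 => /eqP ec.
case: j phi cphi w Tw hw Bw {van} c Tc ec => [|j] phi cphi w Tw hw Bw c Tc ec;
  have [u hu] := lift_col Tc; exists (lincomb u) => v;
  by apply: finj; rewrite hw hu ec mulmxA.
Qed.

End Transport.

Lemma canonical_ext d I : canonical_ideal m pi d I ->
  is_ideal I /\ ext_concentrated I d.
Proof.
case=> Ii [W [f [[_ [F hF]] finj eI]]]; split=> //; rewrite eI.
exists F; split=> [j jd|]; last by apply: ext_nonvanish_dim => //; have := hF d; rewrite eqxx.
by apply: ext_vanish_dim => //; have := hF j; rewrite (negPf (introN eqP jd)).
Qed.

Lemma ext_concentrated_above T d n (C : cx R n) : is_ideal T ->
  ext_concentrated T d -> acyclic C ->
  forall j, (d <= j)%N -> ext_vanish C T [set 0] j.+1.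
Proof.
move=> Ti [F [van _]] Cac; apply: (ext_vanish_above loc Ti _ Cac).
move=> D Dac eD j dj; apply: (ext_vanish_residue loc (F := F)) => //.
  exact: ideal_set0.
by apply: van => e; rewrite -e ltnn in dj.
Qed.

Section CommonSequence.
Hypothesis k_infinite : infinite_set [set: k].

(** While fewer than d elements are chosen, no T i / s(T i) has a socle: Hom(k, T/sT) vanishes once
    Ext^j(k, T) does for j up to [size s]. *)
Lemma common_regular_seq n (T : 'I_n -> set R) d :
  (forall i, is_ideal (T i)) -> (forall i, ext_concentrated (T i) d) ->
  exists s, [/\ size s = d, forall x, x \in s -> m x &
                forall i, @wreg R R^o [set 0] (T i) s].
Proof.
move=> Ti Te; suff h e : (e <= d)%N ->
  exists s, [/\ size s = e, forall x, x \in s -> m x &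
                forall i, @wreg R R^o [set 0] (T i) s] by exact: h.
have T0 i : [set 0] `<=` T i by move=> _ ->; apply: (@submod0 R R^o _ (Ti i)).
elim: e => [|e IH] ed; first by exists [::].
have [s [se sm sreg]] := IH (ltnW ed).
have [i|i|i|i|x mx xreg] := common_regular loc k_infinite (T := T)
    (B := fun i => @addmul R R^o [set 0] (T i) s).
- exact: Ti.
- by apply: ideal_addmul => //; apply: ideal_set0.
- by apply: (@addmul_subset R R^o) => //; exact: Ti.
- have [F [van _]] := Te i.
  apply: (ext_vanish0_socle loc (F := F)) => //.
    by apply: ideal_addmul => //; apply: ideal_set0.
  apply: (@ext_vanish_addmul _ _ (Ti i) s _ _ _ 1) => //.
  + exact: ideal_set0.
  + exact: (proj1 (res_cx_acyclic F)).
  + move=> j; rewrite se add1n => je; apply: van => ej.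
    by move: je; rewrite ej ltnS leqNgt ed.
exists (rcons s x); split; first by rewrite size_rcons se.
  by move=> y; rewrite mem_rcons inE => /orP[/eqP->|/sm].
by move=> i; apply/(@wreg_rcons R R^o); split=> // t; apply: xreg.
Qed.

End CommonSequence.

(** Were Hom(k, T/sT) zero, d shifts along s would give Ext^d(k, T) = 0. *)
Lemma socle_element T d s : is_ideal T -> ext_concentrated T d ->
  size s = d -> (forall x, x \in s -> m x) -> @wreg R R^o [set 0] T s ->
  exists t, [/\ T t, ~ @addmul R R^o [set 0] T s t &
                forall a, m a -> @addmul R R^o [set 0] T s (a * t)].
Proof.
move=> Ti [F [_ nvan]] sd sm sreg.
have T0 : [set 0] `<=` T by move=> _ ->; apply: (@submod0 R R^o _ Ti).
apply: (socle_exists loc (F := F)) => //.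
  by apply: ideal_addmul => //; apply: ideal_set0.
move=> van; apply: nvan; rewrite -sd -[size s]add0n.
apply: (ext_vanish_addmul_inv Ti _ T0 _ sreg) => //; first exact: ideal_set0.
  exact: res_cx_acyclic.
exact: (res_cx_annihilates loc).
Qed.

End Canonical.

(** * Linear maps on an ideal and their reduction modulo s *)

Section Endomorphisms.
Variables (R : comNzRingType) (m : set R) (k : fieldType).
Variable pi : {rmorphism R -> k}.
Hypothesis loc : noetherian_local m pi.
Implicit Types (T W B : set R).

(** Maps out of an ideal are functions on all of R; their values outside T are arbitrary. *)
Definition linear_on T (f : R -> R) :=
  forall a u v, T u -> T v -> f (a * u + v) = a * f u + f v.

Section LinearOn.
Variables (T : set R) (f : R -> R).
Hypotheses (Ti : is_ideal T) (flin : linear_on T f).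

Let T0 : T 0. Proof. exact: (@submod0 R R^o). Qed.

Lemma linear_on0 : f 0 = 0.
Proof.
have := flin (-1) T0 T0; rewrite mulr0 addr0 mulN1r addNr; exact.
Qed.

Lemma linear_onM a t : T t -> f (a * t) = a * f t.
Proof. by move=> Tt; rewrite -[a * t]addr0 flin // linear_on0 addr0. Qed.

Lemma linear_on_sum n (c g : 'I_n -> R) : (forall i, T (g i)) ->
  f (\sum_i c i * g i) = \sum_i c i * f (g i).
Proof.
move=> Tg; suff [_ ->] : T (\sum_i c i * g i) /\
  f (\sum_i c i * g i) = \sum_i c i * f (g i) by [].
elim/big_rec2: _ => [|i u v _ [Tv ev]]; first by rewrite linear_on0.
by split; [apply: (@submodP R R^o)|rewrite flin // ev].
Qed.

Lemma linear_on_addmul s : (forall t, T t -> T (f t)) ->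
  forall t, @addmul R R^o [set 0] T s t -> @addmul R R^o [set 0] T s (f t).
Proof.
move=> fT; pose L : set R := [set t | T t /\ @addmul R R^o [set 0] T s (f t)].
have Ai : is_ideal (@addmul R R^o [set 0] T s).
  by apply: ideal_addmul => //; apply: ideal_set0.
have Li : is_ideal L.
  rewrite is_idealE; apply/is_submodP; split=> [|a u v [Tu Au] [Tv Av]].
    by split=> //; rewrite linear_on0; apply: (@submod0 R R^o _ Ai).
  split; first exact: (@submodP R R^o _ Ti).
  by rewrite -[a *: u]/(a * u) flin //; apply: (@submodP R R^o _ Ai).
suff sub : @addmul R R^o [set 0] T s `<=` L by move=> t /sub[].
apply: (@addmul_min R R^o) => // [_ ->|x t xs Tt].
  by split=> //; rewrite linear_on0; apply: (@submod0 R R^o _ Ai).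
split; first exact: idealM.
rewrite -[x *: t]/(x * t) linear_onM //.
by apply: (@addmul_mul R R^o) => //; [exact: submod_set0|exact: fT].
Qed.

End LinearOn.

(* The annihilators descend from T/(B + sT) to T/B one element of s at a time, by
   Nakayama's lemma. *)
Lemma annihilator_addmul s A B T : is_ideal A -> is_ideal B -> is_ideal T ->
  B `<=` T -> (forall x, x \in s -> m x) -> @wreg R R^o B T s ->
  (forall r t, A r -> T t -> B (r * t)) ->
  (forall r, (forall t, T t -> @addmul R R^o B T s (r * t)) ->
     @addmul R R^o A setT s r) ->
  forall r, (forall t, T t -> B (r * t)) -> A r.
Proof.
move=> + + Ti; elim: s A B => [|x s IH] A B Ai Bi BT sm /=.
  by move=> _ AB ann r /ann.
move=> [xreg sreg] AB ann.
have ann' r : (forall t, T t -> padd (B : set R^o) x T (r * t)) ->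
    padd (A : set R^o) x setT r.
  apply: (IH _ _ _ _ _ _ sreg _ ann).
  - by apply: ideal_padd => //; apply: ideal_setT.
  - exact: ideal_padd.
  - exact: ideal_padd_sub.
  - by move=> y ys; apply: sm; rewrite inE ys orbT.
  move=> _ t [a [b [Aa _ ->]]] Tt; exists (a * t), (b * t); split.
  - exact: AB.
  - exact: idealM.
  - by rewrite mulrDl -[x *: b]/(x * b) -mulrA.
pose K : set R := [set r | forall t, T t -> B (r * t)].
have Ki : is_ideal K.
  rewrite is_idealE; apply/is_submodP; split=> [t _|a u v Ku Kv t Tt].
    by rewrite mul0r; apply: (@submod0 R R^o _ Bi).
  rewrite mulrDl -[a *: u]/(a * u) -mulrA.
  by apply: (@submodP R R^o _ Bi); [exact: Ku|exact: Kv].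
apply: (nakayama_ideal loc Ki Ai (x := x)); first by apply: sm; rewrite mem_head.
move=> r Kr; have [|a [b [Aa _ er]]] := ann' r.
  by move=> t Tt; apply: (@sub_padd R R^o) => //; apply: Kr.
exists b; last by rewrite er -[x *: b]/(x * b) addrK.
move=> t Tt; apply: xreg; first exact: idealM.
have e : x * (b * t) = r * t - a * t.
  by rewrite er -[x *: b]/(x * b); ring.
by rewrite -[x *: _]/(x * (b * t)) e; apply: (@submodB R R^o _ Bi); [exact: Kr|exact: AB].
Qed.

(* Hom(M, sT) = s Hom(M, T), where the maps M -> T are the columns w over T with
   D w = 0. *)
Lemma hom_into_addmul s B T n (C : cx R n) : is_ideal T -> is_ideal B ->
  B `<=` T -> is_cx C -> @wreg R R^o B T s ->
  (forall j, ext_vanish C T B j.+1) ->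
  forall w : 'cV[R]_n, cocycle_mod (C := C) T B (j := 0%N) w ->
  mxin (@addmul R R^o B T s) w ->
  exists2 u, addmul [set 0] (cocycle_mod (C := C) T B (j := 0%N)) s u &
             mxin B (w - u).
Proof.
move=> Ti + + Ccx; elim: s B => [|x s IH] B Bi BT /=.
  by move=> _ _ w _ Bw; exists 0 => //; rewrite subr0.
move=> [xreg sreg] van w cw Aw.
have B'i := ideal_padd x Ti Bi; have B'T := ideal_padd_sub (x := x) Ti BT.
have KB B1 : is_ideal B1 -> is_submod (cocycle_mod (C := C) T B1 (j := 0%N)).
  move=> B1i; apply/is_submodP; split=> [|a u v [Tu Bu] [Tv Bv]].
    by split; rewrite ?mulmx0; apply: mxin0.
  split; first by apply: mxinD => //; apply: mxinZ.
  by rewrite mulmxDr -scalemxAr; apply: mxinD => //; apply: mxinZ.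
have [||u' su' wu'] := IH _ B'i B'T sreg _ w _ Aw.
- by move=> j; apply: ext_vanish_padd.
- by case: cw => Tw Bw; split=> //; apply: mxin_sub Bw; apply: (@sub_padd R R^o).
set K := cocycle_mod (C := C) T B (j := 0%N); have Ks : is_submod K := KB B Bi.
have As l : is_submod (addmul [set 0] K l).
  by apply: submod_addmul => //; apply: submod_set0.
(* The induction hypothesis speaks of maps into T/(B + xT); as Ext^1(M, T/B) = 0, each of them lifts
   to an element of K up to [padd B x T]. *)
have [u su uu'] : exists2 u, addmul [set 0] K s u & mxin (@padd R R^o B x T) (u' - u).
  pose L : set 'cV[R]_n := [set v | exists2 u, addmul [set 0] K s u &
    mxin (@padd R R^o B x T) (v - u)].
  suff : addmul [set 0] (cocycle_mod (C := C) T (@padd R R^o B x T) (j := 0%N)) s `<=` L.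
    by move/(_ _ su').
  apply: addmul_min => [|_ ->|y t ys ct].
  - apply/is_submodP; split=> [|a v1 v2 [u1 s1 p1] [u2 s2 p2]].
      by exists 0; [exact: (submod0 (As s))|rewrite subr0; apply: mxin0].
    exists (a *: u1 + u2); first exact: submodP.
    rewrite opprD addrACA -scalerBr; apply: mxinD => //; exact: mxinZ.
  - by exists 0; [exact: (submod0 (As s))|rewrite subr0; apply: mxin0].
  have [y' By' cy'] := cocycle_connect Ti Bi xreg Ccx ct.
  have [v [Tv Bv]] := van 0%N _ cy'; case: ct => Tt _.
  exists (y *: (t - x *: v)).
    apply: addmul_mul => //; first exact: submod_set0.
    split; first by apply: mxinB => //; apply: mxinZ.
    rewrite mulmxBr -scalemxAr -[df C 0%N *m t](subrK (x *: y')) -addrA -scalerBr.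
    by apply: mxinD => //; apply: mxinZ.
  by rewrite -scalerBr subKr; apply: mxinZ => //; apply: mxin_padd_mul.
have su1 : addmul [set 0] K (x :: s) u.
  move: u su {uu'}; apply: (addmul_min (As (x :: s))).
    by move=> _ ->; apply: (submod0 (As (x :: s))).
  move=> y t ys Kt; apply: (@addmul_mul _ _ (x :: s)) => //; first exact: submod_set0.
  by rewrite inE ys orbT.
have Ku : K u by apply: (addmul_subset (s := x :: s) Ks _ su1) => _ ->; apply: (submod0 Ks).
have /mxin_padd[b [t [Bb Tt e]]] : mxin (@padd R R^o B x T) (w - u).
  by rewrite -[w](subrK u') -addrA; apply: mxinD.
exists (u + x *: t); last by rewrite opprD addrA e addrK.
apply: (submodD (As (x :: s)) su1).
apply: addmul_mul => //; [exact: submod_set0|exact: mem_head|].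
split=> //; apply: (mxin_regular xreg); first exact: mxinM.
have -> : x *: (df C 0%N *m t) = df C 0%N *m (w - u) - df C 0%N *m b.
  by rewrite e mulmxDr addrC addKr scalemxAr.
apply: mxinB => //; last exact: mxinM.
by case: (submodB Ks cw Ku).
Qed.

Lemma wreg_rV s B T n : is_ideal T -> @wreg R R^o B T s ->
  wreg [set v : 'rV[R]_n | mxin B v] [set v | mxin T v] s.
Proof.
move=> Ti; elim: s B => // x s IH B /= [xreg sreg]; split.
  by move=> t Tt Bt; exact: (mxin_regular xreg Tt Bt).
have -> : padd [set v : 'rV[R]_n | mxin B v] x [set v | mxin T v] =
    [set v | mxin (@padd R R^o B x T) v].
  apply/seteqP; split=> [_ [b [t [Bb Tt ->]]] i j|v /mxin_padd[b [t [Bb Tt ->]]]].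
    by exists (b i j), (t i j); split=> //; rewrite !mxE.
  by exists b, t.
exact: IH.
Qed.

Lemma submod_mxin T p q : is_ideal T -> is_submod [set v : 'M[R]_(p, q) | mxin T v].
Proof.
move=> Ti; apply/is_submodP; split=> [|a u v Tu Tv]; first exact: mxin0.
by apply: mxinD => //; apply: mxinZ.
Qed.

End Endomorphisms.

(** * Duality with respect to T: faithfulness and endomorphisms *)

Section Duality.
Variables (R : comNzRingType) (m : set R) (k : fieldType).
Variable pi : {rmorphism R -> k}.
Hypothesis loc : noetherian_local m pi.
Implicit Types (T W B : set R).

Let Rnoeth : noetherian R. Proof. by case: loc. Qed.

(** What duality uses of a canonical ideal, relative to a sequence s that several ideals may
    share. *)
Record dualizing_seq T (s : seq R) : Prop := DualizingSeq {
  dual_ideal : is_ideal T;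
  dual_max : forall x, x \in s -> m x;
  dual_reg : @wreg R R^o [set 0] T s;
  dual_van : forall n (C : cx R n), acyclic C ->
    forall j, (size s <= j)%N -> ext_vanish C T [set 0] j.+1;
  dual_socle : exists t, [/\ T t, ~ @addmul R R^o [set 0] T s t &
                forall a, m a -> @addmul R R^o [set 0] T s (a * t)]
}.

Lemma dualizing_seq_exists n (T : 'I_n -> set R) d :
  infinite_set [set: k] ->
  (forall i, is_ideal (T i)) -> (forall i, ext_concentrated pi (T i) d) ->
  exists s, forall i, dualizing_seq (T i) s.
Proof.
move=> kinf Ti Te; have [s [se sm sreg]] := common_regular_seq loc kinf Ti Te.
exists s => i; split=> //; last exact: (socle_element loc (d := d)).
by move=> p C Cac j; rewrite se; apply: (ext_concentrated_above loc).
Qed.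

Lemma wreg_rV0 T s n : is_ideal T -> @wreg R R^o [set 0] T s ->
  wreg [set 0] [set v : 'rV[R]_n | mxin T v] s.
Proof.
move=> Ti /(wreg_rV n Ti); congr wreg.
by apply/seteqP; split=> v /=; [move/mxin_set0|move=> ->; apply: mxin0; apply: ideal_set0].
Qed.

Section OneModule.
Variables (T : set R) (s : seq R).
Hypothesis Ts : dualizing_seq T s.
Let sT : set R := @addmul R R^o [set 0] T s.
Let Ti : is_ideal T := dual_ideal Ts.

Let T0 : [set 0] `<=` T.
Proof. by move=> _ ->; apply: (@submod0 R R^o). Qed.

Let sTi : is_ideal sT.
Proof. by apply: ideal_addmul => //; apply: ideal_set0. Qed.

(** If r is not in sR, separating r from 0 in R/sR gives t in T with r t outside sT; so T/sT is
    faithful over R/sR, and [annihilator_addmul] descends to T. *)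
Lemma dualizing_faithful r : (forall t, T t -> r * t = 0) -> r = 0.
Proof.
apply: (annihilator_addmul loc (@ideal_set0 R) (@ideal_set0 R) Ti T0 (dual_max Ts)
  (dual_reg Ts)) => [_ t -> _|{}r rT] ; first by rewrite mul0r.
have [t0 [Tt0 nt0 mt0]] := dual_socle Ts.
apply: contrapT => nr.
have RTs : is_submod (@addmul R R^o [set 0] setT s).
  by apply: submod_addmul; [exact: submod_set0|exact: submod_setT].
have [|||w [Tw _]] := separate_quotient loc Ti (dual_reg Ts) (dual_van Ts) Tt0 nt0 mt0
    (Z := [set z : 'rV[R]_1 | @addmul R R^o [set 0] setT s (z 0 0)]) (v := r%:M).
- apply/is_submodP; split=> [|a u v Au Av]; rewrite /= !mxE; first exact: (submod0 RTs).
  exact: (submodP RTs).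
- move=> x u xs; rewrite /= mxE; apply: (@addmul_mul R R^o) => //.
    exact: submod_set0.
  exact: submod_setT.
- by rewrite /= mxE eqxx mulr1n.
by apply=> i j; rewrite mul_scalar_mx mxE; apply: rT.
Qed.

Lemma separate_ideal W v : is_ideal W -> @wreg R R^o [set 0] W s ->
  W v -> ~ @addmul R R^o [set 0] W s v ->
  exists F, [/\ linear_on W F, forall u, W u -> T (F u) & ~ sT (F v)].
Proof.
move=> Wi sW Wv nv; have [t0 [Tt0 nt0 mt0]] := dual_socle Ts.
have Ai : is_ideal (@addmul R R^o [set 0] W s).
  by apply: ideal_addmul => //; apply: ideal_set0.
have mx1 (S : set R) a : S a -> mxin S (a%:M : 'M_1).
  by move=> Sa i j; rewrite !ord1 mxE.
have [||||||F [Flin FT _ nF]] := separate_submodule loc Ti (dual_max Ts) (dual_reg Ts)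
   (dual_van Ts) Tt0 nt0 mt0 (M := [set u : 'rV[R]_1 | mxin W u])
   (L := [set u : 'rV[R]_1 | mxin (@addmul R R^o [set 0] W s) u]) (v := v%:M).
- exact: submod_mxin.
- exact: submod_mxin.
- exact: (wreg_rV0 1 Wi sW).
- move=> x u xs Wu i j; rewrite mxE; apply: (@addmul_mul R R^o) => //.
  exact: submod_set0.
- exact: mx1.
- by move/(_ 0 0); rewrite mxE eqxx.
exists (fun u => F u%:M); split=> // [a u w Wu Ww|u Wu].
  by rewrite raddfD /= -scale_scalar_mx Flin //; apply: mx1.
by apply: FT; apply: mx1.
Qed.

(** For an endomorphism h of the ideal T, [u * h v = h (u * v) = v * h u] on T. Multiplication by
    two elements a and b of T makes the composites agree, and T is faithful. *)
Lemma linear_on_comm f g t : linear_on T f -> linear_on T g ->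
  (forall u, T u -> T (f u)) -> (forall u, T u -> T (g u)) -> T t ->
  f (g t) = g (f t).
Proof.
move=> flin glin fT gT Tt; apply/eqP; rewrite -subr_eq0; apply/eqP.
apply: dualizing_faithful => b Tb.
apply: dualizing_faithful => a Ta.
have sw h : linear_on T h -> forall u v, T u -> T v -> u * h v = v * h u.
  by move=> hlin u v Tu Tv; rewrite -!(linear_onM Ti hlin) // mulrC.
have e h1 h2 : linear_on T h1 -> linear_on T h2 -> (forall u, T u -> T (h2 u)) ->
    a * h1 (h2 t) = h2 a * h1 t.
  move=> l1 l2 h2T; transitivity (h1 (h2 (t * a))).
    by rewrite [t * a]mulrC (linear_onM Ti l2 a Tt) (linear_onM Ti l1 a (h2T _ Tt)).
  by rewrite (linear_onM Ti l2 t Ta) mulrC (linear_onM Ti l1 (h2 a) Tt).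
have e1 := e f g flin glin gT; have e2 := e g f glin flin fT.
have -> : (f (g t) - g (f t)) * b * a = b * (a * f (g t)) - b * (a * g (f t)) by ring.
rewrite e1 e2; have -> : b * (g a * f t) = (a * f t) * g b.
  by rewrite mulrA (sw g glin b a Tb Ta); ring.
have -> : b * (f a * g t) = f a * (b * g t) by ring.
by rewrite (sw f flin a t Ta Tt) (sw g glin b t Tb Tt); ring.
Qed.

(* Otherwise some F : T^n -> T maps the line R (g_i) into sT, but not (f (g_i)).
   Since End(T) is commutative, F (f (g_i)) = f (F (g_i)), which is in sT. *)
Lemma endomorphism_mod f : linear_on T f -> (forall t, T t -> T (f t)) ->
  forall n (g : 'I_n -> R), T = generated_by g ->
  exists r, forall i, sT (f (g i) - r * g i).
Proof.
move=> flin fT n g Tg.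
have gT i : T (g i).
  by rewrite Tg; apply: generated_mem.
pose M := [set v : 'rV[R]_n | mxin T v].
pose L := [set v : 'rV[R]_n | exists r, mxin sT (v - r *: \row_i g i)].
have Ms : is_submod M by apply: submod_mxin.
have Ls : is_submod L.
  apply/is_submodP; split=> [|a u v [r Au] [q Av]].
    by exists 0; rewrite scale0r subr0; apply: mxin0.
  exists (a * r + q); rewrite scalerDl -scalerA opprD addrACA -scalerBr.
  by apply: mxinD => //; apply: mxinZ.
have [[r hr]|nL] := pselect (L (\row_i f (g i))).
  by exists r => i; have := hr 0 i; rewrite !mxE.
have [t0 [Tt0 nt0 mt0]] := dual_socle Ts.
have [|||F [Flin FT FL nF]] := separate_submodule loc Ti (dual_max Ts) (dual_reg Ts)
   (dual_van Ts) Tt0 nt0 mt0 Ms Ls _ _ _ nL.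
- exact: (wreg_rV0 n Ti (dual_reg Ts)).
- move=> x u xs Mu; exists 0; rewrite scale0r subr0 => i j; rewrite mxE.
  by apply: (@addmul_mul R R^o) => //; exact: submod_set0.
- by move=> i j; rewrite mxE; apply: fT.
case: nF.
have Md i t : T t -> M (t *: delta_mx 0 i).
  by move=> Tt a b; rewrite mxE mulrC; apply: idealM.
(* The components of F : T^n -> T are endomorphisms of T, hence commute with f. *)
pose Fi i t := F (t *: delta_mx 0 i).
have Fi_lin i : linear_on T (Fi i).
  by move=> a u v Tu Tv; rewrite /Fi scalerDl -scalerA Flin //; apply: Md.
have FiT i t : T t -> T (Fi i t) by move=> Tt; apply/FT/Md.
have F0 : F 0 = 0.
  by have := Flin (-1) 0 0 (submod0 Ms) (submod0 Ms); rewrite scaler0 addr0 mulN1r addNr.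
have Fsum (c : 'I_n -> R) : (forall i, T (c i)) -> F (\row_i c i) = \sum_i Fi i (c i).
  move=> Tc; have -> : \row_i c i = \sum_i c i *: delta_mx 0 i.
    by rewrite [LHS]row_sum_delta; apply: eq_bigr => i _; rewrite mxE.
  suff [_ ->] : M (\sum_i c i *: delta_mx 0 i) /\
    F (\sum_i c i *: delta_mx 0 i) = \sum_i Fi i (c i) by [].
  elim/big_rec2: _ => [|i u v _ [Mv ev]].
    by split; [exact: (submod0 Ms)|].
  have Mi := Md i _ (Tc i); split; first exact: (submodD Ms Mi Mv).
  by have := Flin 1 _ _ Mi Mv; rewrite scale1r mul1r => ->; rewrite ev.
have Mg : M (\row_i g i) by move=> i j; rewrite mxE.
rewrite Fsum => [|i]; last exact: fT.
have -> : \sum_i Fi i (f (g i)) = f (F (\row_i g i)).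
  rewrite (Fsum g gT); transitivity (\sum_i 1 * f (Fi i (g i))).
    by apply: eq_bigr => i _; rewrite mul1r; apply: linear_on_comm => //; apply: FiT.
  rewrite -(linear_on_sum Ti flin) => [|i]; last exact: FiT.
  by congr f; apply: eq_bigr => i _; rewrite mul1r.
apply: (linear_on_addmul Ti flin) => //; apply: FL => //.
by exists 1; rewrite scale1r subrr; apply: mxin0.
Qed.

(** Nakayama's lemma for K contained in L + sK, with transposes to reuse the results on rows. *)
Lemma nakayama_addmul n (K L : set 'cV[R]_n) : is_submod K -> is_submod L ->
  (forall v, K v -> exists2 u, addmul [set 0] K s u & L (v - u)) -> K `<=` L.
Proof.
move=> Ks Ls h.
have [p [G KG]] : exists p (G : 'M[R]_(p, n)), [set v | K v^T] = rowspan G.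
  apply: noetherian_rowspan => //; apply/is_submodP; split=> [|a u v Ku Kv] /=.
    by rewrite linear0; apply: submod0.
  by rewrite linearP; apply: submodP.
have KP v : K v <-> exists c, v = (c *m G)^T.
  split=> [Kv|[c ->]].
    have : [set v | K v^T] v^T by rewrite /= trmxK.
    by rewrite KG => -[c ec]; exists c; rewrite -ec trmxK.
  have : rowspan G (c *m G) by exists c.
  by rewrite -KG.
have sumE (c : 'rV_p) : (c *m G)^T = \sum_j c 0 j *: (row j G)^T.
  by rewrite mulmx_sum_row linear_sum; apply: eq_bigr => j _; rewrite linearZ.
have gL i : L (row i G)^T.
  apply: (nakayama loc (g := fun i => (row i G)^T)) => // {}i.
  have [|u su Lu] := h (row i G)^T.
    by apply/KP; exists (delta_mx 0 i); rewrite rowE.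
  have [c mc eu] : exists2 c : 'rV_p, mxin m c & u = (c *m G)^T.
    move: u su {Lu}; apply: addmul_min.
    - have mi := local_max_ideal loc.
      apply/is_submodP; split=> [|a _ _ [c mc ->] [e me ->]].
        by exists 0; [exact: (mxin0 mi)|rewrite mul0mx linear0].
      exists (a *: c + e); first by apply: mxinD => //; apply: mxinZ.
      by rewrite -linearP mulmxDl -scalemxAl.
    - move=> _ ->; exists 0; last by rewrite mul0mx linear0.
      exact: (mxin0 (local_max_ideal loc)).
    move=> x t xs /KP[c ->]; exists (x *: c); last by rewrite -linearZ scalemxAl.
    move=> a b; rewrite mxE mulrC; apply: idealM; last exact: (dual_max Ts).
    exact: local_max_ideal loc.
  by exists (fun j => c 0 j); rewrite -?sumE -?eu.
move=> v /KP[c ->]; rewrite sumE; apply: submod_sum => // i _; exact: submodZ.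
Qed.

(* By [endomorphism_mod], End(T) = R + s End(T). *)
Theorem endomorphism_scalar f : linear_on T f -> (forall t, T t -> T (f t)) ->
  exists r, forall t, T t -> f t = r * t.
Proof.
move=> flin fT; have [n [g Tg]] := Rnoeth Ti.
have gT i : T (g i).
  by rewrite Tg; apply: generated_mem.
pose G : 'cV[R]_n := \col_i g i.
have GE (c : 'rV_n) : (c *m G) 0 0 = \sum_i c 0 i * g i.
  by rewrite mxE; apply: eq_bigr => i _; rewrite mxE.
have Gs : is_submod [set a : 'rV[R]_n | a *m G = 0].
  apply/is_submodP; split; first by rewrite /= mul0mx.
  by move=> a u v /= eu ev; rewrite mulmxDl -scalemxAl eu ev scaler0 addr0.
have [D [Dac eD]] := resolution_exists Rnoeth Gs.
have vanD e : ext_vanish D T [set 0] e.+1.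
  apply: (ext_vanish_climb loc Ti (e := size s) _ Dac (dual_max Ts)); last exact: leq_addl.
    by move=> C Cac _ i si; apply: (dual_van Ts).
  rewrite eD; have TG : [set v : 'rV[R]_1 | mxin T v] = rowspan G.
    apply/seteqP; split=> [v Tv|_ [c ->] i j]; last first.
      by rewrite !ord1 GE Tg; exists (c 0).
    have : T (v 0 0) by apply: Tv.
    rewrite Tg => -[c ec]; exists (\row_i c i).
    apply/matrixP=> i j; rewrite !ord1 GE ec.
    by apply: eq_bigr => l _; rewrite mxE.
  apply: (wreg_preimage (B := [set 0])); first exact: submod_set0.
    by move=> _ ->; apply: (submod0 (submod_rowspan G)).
  by rewrite -TG; apply: (wreg_rV0 1 Ti (dual_reg Ts)).
have zero_mod (w : 'cV[R]_n) : mxin T w -> (forall a : 'rV_n, a *m G = 0 -> a *m w = 0) ->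
    cocycle_mod (C := D) T [set 0] (j := 0%N) w.
  move=> Tw w0; split=> //; apply/mxin_set0/row_matrixP => i.
  rewrite row_mul row0; apply: w0.
  have : rowspan (df D 0%N) (row i (df D 0%N)) by apply: row_rowspan.
  by rewrite eD.
(* K is End(T): a column lists the images of the generators g and respects their relations D. In it
   G is the identity and L consists of the scalars. *)
pose K := cocycle_mod (C := D) T [set 0] (j := 0%N).
have Ks : is_submod K.
  have O := @ideal_set0 R; apply/is_submodP; split=> [|a u v [Tu Bu] [Tv Bv]].
    by split; rewrite ?mulmx0; apply: mxin0.
  split; first by apply: mxinD => //; apply: mxinZ.
  by rewrite mulmxDr -scalemxAr; apply: mxinD => //; apply: mxinZ.
have KG : K G by apply: zero_mod => // i j; rewrite mxE.
pose L := [set w : 'cV[R]_n | exists r, w = r *: G].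
have Ls : is_submod L.
  apply/is_submodP; split=> [|a _ _ [r ->] [q ->]]; first by exists 0; rewrite scale0r.
  by exists (a * r + q); rewrite scalerDl scalerA.
have /choice[c hc] t : exists c : 'rV[R]_n, T t -> t = (c *m G) 0 0.
  have [|nTt] := pselect (T t); last by exists 0.
  rewrite Tg => -[c ->]; exists (\row_i c i); rewrite GE.
  by move=> _; apply: eq_bigr => i _; rewrite mxE.
have KL : K `<=` L.
  apply: nakayama_addmul => // w Kw; have [Tw /mxin_set0 Dw] := Kw.
  have wd (a b : 'rV[R]_n) : (a *m G) 0 0 = (b *m G) 0 0 -> a *m w = b *m w.
    move=> e; have : rowspan (df D 0%N) (a - b).
      rewrite eD /= mulmxBl; apply/eqP; rewrite subr_eq0; apply/eqP/matrixP=> i j.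
      by rewrite !ord1.
    move=> [u eu]; apply/eqP; rewrite -subr_eq0 -mulmxBl eu -mulmxA Dw mulmx0.
    exact: eqxx.
  have mx1D (a : R) (x y : 'M[R]_1) : (a *: x + y) 0 0 = a * x 0 0 + y 0 0.
    by rewrite !mxE.
  (* Modulo s the map w is a scalar r, so [w - r *: G] maps T into sT; by [hom_into_addmul] it lies
     in s End(T), as [nakayama_addmul] demands. *)
  have [||r hr] := @endomorphism_mod (fun t => (c t *m w) 0 0) _ _ n g Tg.
  - move=> a u v Tu Tv; have -> : c (a * u + v) *m w = (a *: c u + c v) *m w.
      apply: wd; rewrite -hc; last exact: (@submodP R R^o).
      by rewrite mulmxDl -scalemxAl mx1D -!hc.
    by rewrite mulmxDl -scalemxAl mx1D.
  - by move=> t Tt; apply: mxinM.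
  have [||u su] := @hom_into_addmul _ s [set 0] T n D Ti (@ideal_set0 R) T0 (proj1 Dac)
      (dual_reg Ts) vanD (w - r *: G).
  - by apply: (submodB Ks Kw); apply: (submodZ Ks).
  - move=> i j; rewrite ord1 !mxE; have <- : (c (g i) *m w) 0 0 = w i 0.
      have -> : c (g i) *m w = delta_mx 0 i *m w.
        by apply: wd; rewrite -hc // -rowE !mxE.
      by rewrite -rowE mxE.
    exact: hr.
  move=> /mxin_set0/eqP; rewrite subr_eq0 => /eqP eu.
  by exists u => //; exists r; rewrite -eu subKr.
have /KL[r er] : K (\col_i f (g i)).
  apply: zero_mod => [i j|a a0]; first by rewrite mxE; apply: fT.
  apply/matrixP=> i j; rewrite !ord1 !mxE.
  transitivity (f ((a *m G) 0 0)); last by rewrite a0 mxE (linear_on0 Ti flin).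
  rewrite GE (linear_on_sum Ti flin) //.
  by apply: eq_bigr => l _; rewrite mxE.
exists r => t Tt; rewrite {1}[t]hc // {2}[t]hc // GE (linear_on_sum Ti flin) // mulr_sumr.
apply: eq_bigr => i _; have /matrixP/(_ i 0) := er; rewrite !mxE => ->.
by rewrite mulrCA.
Qed.

End OneModule.
End Duality.

(** * Products, powers and multiples of ideals *)

Section IdealArithmetic.
Variable R : comNzRingType.
Implicit Types (I J K : set R) (x y : R).

Lemma scale_scale x y I : ideal_scale x (ideal_scale y I) = ideal_scale (x * y) I.
Proof.
apply/seteqP; split=> [_ [_ [a Ia <-] <-]|_ [a Ia <-]]; first by exists a; rewrite ?mulrA.
by exists (y * a); [exists a|rewrite mulrA].
Qed.

Lemma scale_inj x I J : GRing.lreg x ->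
  ideal_scale x I = ideal_scale x J -> I = J.
Proof.
move=> xreg e; apply/seteqP; split=> a Ia.
  by have : ideal_scale x J (x * a) by [rewrite -e; exists a]; case=> b Jb /xreg <-.
by have : ideal_scale x I (x * a) by [rewrite e; exists a]; case=> b Jb /xreg <-.
Qed.

Lemma is_ideal_scale x I : is_ideal I -> is_ideal (ideal_scale x I).
Proof.
move=> Ii; rewrite is_idealE; apply/is_submodP; split.
  by exists 0; rewrite ?mulr0 //; apply: (@submod0 R R^o).
move=> a _ _ [u Iu <-] [v Iv <-]; exists (a * u + v); first exact: (@submodP R R^o).
by rewrite mulrDr -[a *: _]/(a * _) mulrCA.
Qed.

Lemma is_ideal_mul I J : is_ideal I -> is_ideal (ideal_mul I J).
Proof.
move=> Ii; rewrite is_idealE; apply/is_submodP; split.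
  by exists 0%N, (fun=> 0), (fun=> 0); split=> [[]//|[]//|]; rewrite big_ord0.
move=> a _ _ [n [u [v [Iu Jv ->]]]] [p [w [z [Iw Jz ->]]]].
pose cat (f : 'I_n -> R) (g : 'I_p -> R) (i : 'I_(n + p)) :=
  match split i with inl j => f j | inr j => g j end.
exists (n + p)%N, (cat (fun i => a * u i) w), (cat v z); split.
- by rewrite /cat => i; case: split => j //; apply: idealM.
- by rewrite /cat => i; case: split => j.
rewrite big_split_ord /= -[a *: _]/(a * _) mulr_sumr; congr (_ + _).
  apply: eq_bigr => i _; rewrite /cat.
  by have := unsplitK (inl i : 'I_n + 'I_p)%type; rewrite /= => ->; rewrite mulrA.
apply: eq_bigr => i _; rewrite /cat.
by have := unsplitK (inr i : 'I_n + 'I_p)%type; rewrite /= => ->.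
Qed.

Lemma is_ideal_pow I n : is_ideal I -> is_ideal (ideal_pow I n).
Proof. by case: n => [|n] Ii; [exact: ideal_setT|exact: is_ideal_mul]. Qed.

Lemma ideal_mul_mem I J a b : I a -> J b -> ideal_mul I J (a * b).
Proof.
by move=> Ia Jb; exists 1%N, (fun=> a), (fun=> b); split=> //; rewrite big_ord1.
Qed.

Lemma ideal_mul_min I J K : is_ideal K ->
  (forall a b, I a -> J b -> K (a * b)) -> ideal_mul I J `<=` K.
Proof.
move=> Ki h _ [n [u [v [Iu Jv ->]]]].
by apply: (@submod_sum R R^o _ Ki) => i _; apply: h.
Qed.

Lemma scale_mul x y I J :
  ideal_scale (x * y) (ideal_mul I J) = ideal_mul (ideal_scale x I) (ideal_scale y J).
Proof.
apply/seteqP; split=> [_ [_ [n [u [v [Iu Jv ->]]]] <-]|_ [n [u [v [Iu Jv ->]]]]].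
  exists n, (fun i => x * u i), (fun i => y * v i); split=> [i|i|].
  - by exists (u i).
  - by exists (v i).
  by rewrite mulr_sumr; apply: eq_bigr => i _; rewrite mulrACA.
have /choice[u' hu] i : exists a, I a /\ x * a = u i by case: (Iu i) => a; exists a.
have /choice[v' hv] i : exists a, J a /\ y * a = v i by case: (Jv i) => a; exists a.
exists (\sum_(i < n) u' i * v' i).
  exists n, u', v'; split=> // i; first by case: (hu i).
  by case: (hv i).
rewrite mulr_sumr; apply: eq_bigr => i _.
by rewrite mulrACA; case: (hu i) => _ ->; case: (hv i) => _ ->.
Qed.

Lemma principal_mul x J : is_ideal J -> ideal_mul (principal x) J = ideal_scale x J.
Proof.
move=> Ji; apply/seteqP; split.
  apply: ideal_mul_min; first exact: is_ideal_scale.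
  by move=> _ b [a _ <-] Jb; exists (a * b); [exact: idealM|rewrite mulrA].
by move=> _ [a Ja <-]; apply: ideal_mul_mem => //; exists 1; rewrite ?mulr1.
Qed.

Lemma scale_pow x y I K n : ideal_scale y K = ideal_scale x I ->
  ideal_scale (y ^+ n) (ideal_pow K n) = ideal_scale (x ^+ n) (ideal_pow I n).
Proof. by move=> e; elim: n => //= n IH; rewrite !exprS !scale_mul e IH. Qed.

Lemma lreg_exp x n : GRing.lreg x -> GRing.lreg (x ^+ n).
Proof.
move=> xreg; elim: n => [|n IH] a b; first by rewrite expr0 !mul1r.
by rewrite exprS -!mulrA => /xreg/IH.
Qed.

Lemma lregP x : (forall a, x * a = 0 -> a = 0) -> GRing.lreg x.
Proof.
move=> h a b e; apply/eqP; rewrite -subr_eq0; apply/eqP/h.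
by rewrite mulrBr e subrr.
Qed.

(** From yK = xI follows y^n K^n = x^n I^n, so x^(n+1) I^(n+1) = y^(n+1) K^(n+1) = y^(n+1) x K^n =
    x^(n+1) y I^n, where x^(n+1) cancels. *)
Lemma reduction_transfer x y I K n : GRing.lreg x ->
  ideal_scale y K = ideal_scale x I ->
  ideal_pow K n.+1 = ideal_scale x (ideal_pow K n) ->
  ideal_pow I n.+1 = ideal_scale y (ideal_pow I n).
Proof.
move=> xreg e eK; apply: (scale_inj (lreg_exp (n := n.+1) xreg)).
rewrite -(scale_pow n.+1 e) eK !scale_scale exprS -mulrA [_ ^+ n * x]mulrC mulrA.
by rewrite -scale_scale (scale_pow n e) scale_scale exprS; congr ideal_scale; ring.
Qed.

End IdealArithmetic.

(** * Comparison of canonical ideals *)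

Section CanonicalIdeals.
Variables (R : comNzRingType) (m : set R) (k : fieldType).
Variable pi : {rmorphism R -> k}.
Variable d : nat.
Hypothesis loc : noetherian_local m pi.
Hypothesis k_infinite : infinite_set [set: k].
Implicit Types (I J K T W : set R).

(* For v in the socle of W/sW, choose f : W -> T with f v nonzero modulo sT, then
   g : T -> W with g (f v) nonzero modulo sW.  As g \o f is a scalar not killing
   the socle element v, it is a unit. *)
Lemma dualizing_iso T W s : dualizing_seq m T s -> dualizing_seq m W s ->
  exists f, [/\ linear_on W f, forall u, W u -> T (f u),
    forall u, W u -> f u = 0 -> u = 0 & forall t, T t -> exists2 u, W u & f u = t].
Proof.
move=> Ts Ws; have Ti := dual_ideal Ts; have Wi := dual_ideal Ws.
have [v [Wv nv mv]] := dual_socle Ws.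
have [f [flin fT nf]] := separate_ideal loc Ts Wi (dual_reg Ws) Wv nv.
have [g [glin gW ng]] := separate_ideal loc Ws Ti (dual_reg Ts) (fT _ Wv) nf.
have [||r hr] := endomorphism_scalar loc Ws (f := g \o f).
- move=> a u w Wu Ww /=; rewrite flin // glin //; exact: fT.
- by move=> u Wu; apply/gW/fT.
have [||r' hr'] := endomorphism_scalar loc Ts (f := f \o g).
- move=> a u w Tu Tw /=; rewrite glin // flin //; exact: gW.
- by move=> u Tu; apply/fT/gW.
have [|b br] := @local_unit _ _ _ _ loc r.
  by move=> mr; apply: ng; have := hr _ Wv => /= ->; apply: mv.
(* As [f (g (f v))] is both [r * f v] and [r' * f v], one has [f v = b * r' * f v]; for r' in m this
   would force [f v = 0]. *)
have [|b' br'] := @local_unit _ _ _ _ loc r'.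
  move=> mr'; apply: nf.
  have e : f v - b * r' * f v = 0.
    have := hr' _ (fT _ Wv); have /= -> := hr _ Wv.
    rewrite (linear_onM Wi flin) // => er; apply/eqP; rewrite subr_eq0 -mulrA -er.
    by rewrite mulrA br mul1r.
  have [|c hc] := @local_unit _ _ _ _ loc (1 - b * r').
    move=> m1; apply: (local_max_proper loc); rewrite -(subrK (b * r') 1).
    apply: (@submodD R R^o _ (local_max_ideal loc)) => //.
    by apply: idealM => //; apply: local_max_ideal loc.
  have -> : f v = c * (f v - b * r' * f v).
    by rewrite -{2}[f v]mul1r -mulrBl mulrA hc mul1r.
  rewrite e mulr0; apply: (@submod0 R R^o).
  by apply: ideal_addmul => //; apply: ideal_set0.
exists f; split=> //.
  move=> u Wu fu; have := hr _ Wu => /=; rewrite fu (linear_on0 Ti glin) => e.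
  by rewrite -[u]mul1r -br -mulrA -e mulr0.
move=> t Tt; exists (g (b' * t)); first by apply: gW; apply: idealM.
have /= -> := hr' (b' * t) (idealM _ Ti Tt).
by rewrite mulrA [r' * b']mulrC br' mul1r.
Qed.

Lemma canonical_pair T W : canonical_ideal m pi d T -> canonical_ideal m pi d W ->
  exists s, dualizing_seq m T s /\ dualizing_seq m W s.
Proof.
move=> /(canonical_ext (d := d))[Ti Te] /(canonical_ext (d := d))[Wi We].
have [||s hs] := dualizing_seq_exists loc (d := d)
    (T := fun i : 'I_2 => if i == 0 then T else W) k_infinite.
- by move=> i; case: eqP.
- by move=> i; case: eqP.
by exists s; split; [have := hs 0|have := hs 1].
Qed.

Lemma canonical_is_ideal T : canonical_ideal m pi d T -> is_ideal T.
Proof. by case. Qed.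

Lemma canonical_faithful T : canonical_ideal m pi d T ->
  forall r, (forall t, T t -> r * t = 0) -> r = 0.
Proof.
move=> Tc; have [s [Ts _]] := canonical_pair Tc Tc.
exact: (dualizing_faithful loc Ts).
Qed.

Lemma canonical_iso T W : canonical_ideal m pi d T -> canonical_ideal m pi d W ->
  exists f, [/\ linear_on W f, forall u, W u -> T (f u),
    forall u, W u -> f u = 0 -> u = 0 & forall t, T t -> exists2 u, W u & f u = t].
Proof.
by move=> Tc Wc; have [s [Ts Ws]] := canonical_pair Tc Wc; apply: dualizing_iso Ts Ws.
Qed.

Lemma canonical_endo T f : canonical_ideal m pi d T -> linear_on T f ->
  (forall t, T t -> T (f t)) -> exists r, forall t, T t -> f t = r * t.
Proof.
move=> Tc; have [s [Ts _]] := canonical_pair Tc Tc.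
exact: (endomorphism_scalar loc Ts).
Qed.

(** The isomorphism T -> I followed by the inclusion is an endomorphism of T, hence some x.
    Likewise, if aT lies in I = xT, then dividing by x makes a/x an endomorphism of T, hence a
    scalar, and a is in xR. *)
Lemma canonical_contained I T : canonical_ideal m pi d I ->
  canonical_ideal m pi d T -> I `<` T ->
  exists x, [/\ GRing.lreg x, m x, I = ideal_scale x T & principal x = colon I T].
Proof.
move=> Ic Tc [IT nTI].
have Ii := canonical_is_ideal Ic; have Ti := canonical_is_ideal Tc.
have [f [flin fI finj fsurj]] := canonical_iso Ic Tc.
have [|x hx] := canonical_endo Tc flin; first by move=> t /fI/IT.
have xT t : T t -> x * t = 0 -> t = 0 by move=> Tt; rewrite -hx //; apply: finj.
have eI : I = ideal_scale x T.
  apply/seteqP; split=> [t /fsurj[u Tu <-]|_ [t Tt <-]].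
    by exists u; rewrite ?hx.
  by rewrite -hx //; apply: fI.
have xreg : GRing.lreg x.
  apply: lregP => a xa; apply: (canonical_faithful Tc) => t Tt.
  by apply: xT; [exact: idealM|rewrite mulrA xa mul0r].
exists x; split=> //.
  apply: contrapT => /(local_unit loc)[b bx]; apply: nTI => t Tt.
  by rewrite -[t]mul1r -bx -mulrA; apply: idealM => //; rewrite -hx //; apply: fI.
apply/seteqP; split=> [_ [a _ <-] t Tt|a aT].
  by rewrite eI -mulrA; exists (a * t) => //; apply: idealM.
have /choice[g hg] t : exists u, T t -> T u /\ x * u = a * t.
  have [Tt|nTt] := pselect (T t); last by exists 0.
  by have := aT _ Tt; rewrite eI => -[u Tu e]; exists u.
have [|t /hg[]//|r hr] := canonical_endo (f := g) Tc.
  move=> b u v Tu Tv; apply: xreg; case: (hg _ Tu) => _ eu; case: (hg _ Tv) => _ ev.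
  have [|_ ->] := hg (b * u + v); first exact: (@submodP R R^o).
  by rewrite [RHS]mulrDr mulrCA eu ev; ring.
exists r => //; apply/eqP; rewrite -subr_eq0; apply/eqP.
apply: (canonical_faithful Tc) => t Tt.
by case: (hg _ Tt) => _; rewrite hr // mulrBl -mulrA => ->; rewrite subrr.
Qed.

(** J is x times J' = (J : x), which is isomorphic to J and so canonical. Equality J' = J would mean
    J = xJ, hence J = 0 by Nakayama's lemma, but J is faithful. *)
Lemma not_maximal_of_divisible J x : m x -> canonical_ideal m pi d J ->
  J `<=` principal x -> ~ maximal_canonical_ideal m pi d J.
Proof.
move=> mx Jc Jx [_ Jmax]; have Ji := canonical_is_ideal Jc.
have xreg : GRing.lreg x.
  apply: lregP => a xa; apply: (canonical_faithful Jc) => t /Jx[b _ <-].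
  by rewrite mulrA [a * x]mulrC xa mul0r.
pose J' : set R := [set a | J (x * a)].
have J'i : is_ideal J'.
  rewrite is_idealE; apply/is_submodP; split.
    by rewrite /J' /= mulr0; apply: (@submod0 R R^o).
  move=> a u v Ju Jv; rewrite /J' /= mulrDr -[a *: u]/(a * u) mulrCA.
  exact: (@submodP R R^o).
have J'c : canonical_ideal m pi d J'.
  split=> //; case: Jc => _ [W [f [Wc finj eJ]]].
  have /choice[g hg] w : exists a, f w = x * a.
    by have /Jx[a _ <-] : J (f w) by [rewrite eJ; exists w]; exists a.
  have glin : linear (g : W -> R^o).
    move=> a u v; apply: xreg; rewrite -hg linearP !hg.
    by rewrite mulrDr -![a *: _]/(a * _) mulrCA.
  pose g' : {linear W -> R^o} := HB.pack g (GRing.isLinear.Build R W R^o _ g glin).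
  exists W, g'; split=> //.
    by move=> u v e; apply: finj; rewrite !hg; congr (x * _).
  apply/seteqP; split=> [a|_ [w _ <-]]; rewrite /J' /=.
    rewrite eJ => -[w _]; rewrite hg => /xreg e; by exists w.
  by rewrite -hg eJ; exists w.
have eJ : J' = J.
  by apply: Jmax => // t Jt; apply: idealM.
have J0 : J `<=` [set 0].
  apply: (nakayama_ideal loc Ji (@ideal_set0 R) mx) => v Jv.
  have [a _ ea] := Jx _ Jv; exists a; last by rewrite /= -ea subrr.
  by rewrite -eJ /J' /= ea.
have e1 : (1 : R) = 0.
  by apply: (canonical_faithful Jc) => t /J0 ->; rewrite mulr0.
by have := oner_neq0 R; rewrite e1 eqxx.
Qed.

(** For an isomorphism f : K -> I take y = f x, since [f x * t = f (x * t) = x * f t]. *)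
Lemma canonical_transfer I K x : canonical_ideal m pi d I ->
  canonical_ideal m pi d K -> K x ->
  exists y, I y /\ ideal_scale y K = ideal_scale x I.
Proof.
move=> Ic Kc Kx; have Ki := canonical_is_ideal Kc.
have [f [flin fI finj fsurj]] := canonical_iso Ic Kc.
exists (f x); split; first exact: fI.
have e t : K t -> f x * t = x * f t.
  move=> Kt; rewrite -(linear_onM Ki flin) // mulrC.
  by rewrite -(linear_onM Ki flin) // mulrC.
apply/seteqP; split=> [_ [t Kt <-]|_ [i /fsurj[t Kt <-] <-]].
  by exists (f t); [exact: fI|rewrite e].
by exists t; rewrite ?e.
Qed.

Lemma canonical_reduction I K x y : canonical_ideal m pi d I ->
  canonical_ideal m pi d K -> K x -> I y -> GRing.lreg x ->
  ideal_scale y K = ideal_scale x I ->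
  is_reduction (principal x) K <-> is_reduction (principal y) I.
Proof.
move=> Ic Kc Kx Iy xreg e.
have Ii := canonical_is_ideal Ic; have Ki := canonical_is_ideal Kc.
(* If a y = 0, then a kills yK = xI, hence I, which is faithful. *)
have yreg : GRing.lreg y.
  apply: lregP => a ya; apply: (canonical_faithful Ic) => t It.
  apply: xreg; rewrite mulr0 mulrCA.
  have : ideal_scale x I (x * t) by exists t.
  by rewrite -e => -[u _ <-]; rewrite mulrA [a * y]mulrC ya mul0r.
have red J z n : is_ideal J -> ideal_mul (principal z) (ideal_pow J n) =
    ideal_scale z (ideal_pow J n).
  by move=> Ji; apply: principal_mul; apply: is_ideal_pow.
have sub J z : is_ideal J -> J z -> is_ideal (principal z) /\ principal z `<=` J.
  move=> Ji Jz; split; first by apply: is_ideal_scale; apply: ideal_setT.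
  by move=> _ [a _ <-]; rewrite mulrC; apply: idealM.
split=> -[_ _ [n hn]].
  have [Pi PI] := sub _ _ Ii Iy; split=> //; exists n; rewrite red //.
  by apply: reduction_transfer xreg e _; rewrite -red.
have [Pi PK] := sub _ _ Ki Kx; split=> //; exists n; rewrite red //.
by apply: reduction_transfer yreg (esym e) _; rewrite -red.
Qed.

End CanonicalIdeals.

(** * Injective resolutions *)

Section QuotientModule.
Variables (R : comNzRingType) (V : lmodType R) (Z : set V).

Definition coset_repr (v : V) : V := choose (fun u => `[< Z (u - v) >]) v.

(** Cosets are represented by chosen members, so the carrier is a subtype of V. The proof that Z is
    a submodule is an argument because the module structure depends on it. *)
Definition quot_mod of is_submod Z := {v : V | coset_repr v == v}.

Variable Zs : is_submod Z.
Local Notation Q := (quot_mod Zs).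

HB.instance Definition _ := Choice.on Q.

Lemma coset_reprP v : Z (coset_repr v - v).
Proof.
apply/asboolP; apply: (@chooseP _ (fun u => `[< Z (u - v) >])).
by apply/asboolP; rewrite subrr; apply: submod0.
Qed.

Lemma coset_repr_eq u v : Z (u - v) -> coset_repr u = coset_repr v.
Proof.
move=> Zuv; rewrite /coset_repr.
have e w : `[< Z (w - u) >] = `[< Z (w - v) >].
  apply: asbool_equiv_eq; split=> h; last first.
    by rewrite -[w](subrK v) -addrA -(opprB u v); apply: (submodB Zs).
  by rewrite -[w](subrK u) -addrA; apply: (submodD Zs).
rewrite (eq_choose e); apply: choose_id; apply/asboolP => //.
by rewrite subrr; apply: submod0.
Qed.

Lemma coset_reprK v : coset_repr (coset_repr v) == coset_repr v.
Proof. exact/eqP/coset_repr_eq/coset_reprP. Qed.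

Definition coset_of (v : V) : Q :=
  exist (fun v => coset_repr v == v) (coset_repr v) (coset_reprK v).

Lemma coset_eq u v : coset_of u = coset_of v <-> Z (u - v).
Proof.
split=> [/(congr1 val)/= e|/coset_repr_eq e]; last exact: val_inj.
have -> : u - v = (coset_repr v - v) - (coset_repr u - u).
  by rewrite e opprB [RHS]addrC addrA subrK.
by apply: submodB => //; apply: coset_reprP.
Qed.

Lemma coset_val (x : Q) : coset_of (val x) = x.
Proof. by apply: val_inj; apply/eqP; case: x. Qed.

Lemma coset_ind (P : Q -> Prop) : (forall v, P (coset_of v)) -> forall x, P x.
Proof. by move=> h x; rewrite -[x]coset_val. Qed.

Definition quot_add (x y : Q) : Q := coset_of (val x + val y).
Definition quot_opp (x : Q) : Q := coset_of (- val x).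
Definition quot_scale a (x : Q) : Q := coset_of (a *: val x).

Lemma quot_addE u v : quot_add (coset_of u) (coset_of v) = coset_of (u + v).
Proof. by apply/coset_eq; rewrite opprD addrACA; apply: submodD => //; apply: coset_reprP. Qed.

Lemma quot_oppE u : quot_opp (coset_of u) = coset_of (- u).
Proof. by apply/coset_eq; rewrite -opprD; apply: submodN => //; apply: coset_reprP. Qed.

Lemma quot_scaleE a u : quot_scale a (coset_of u) = coset_of (a *: u).
Proof. by apply/coset_eq; rewrite -scalerBr; apply: submodZ => //; apply: coset_reprP. Qed.

Lemma quot_addA : associative quot_add.
Proof.
by elim/coset_ind=> u; elim/coset_ind=> v; elim/coset_ind=> w; rewrite !quot_addE addrA.
Qed.

Lemma quot_addC : commutative quot_add.
Proof. by elim/coset_ind=> u; elim/coset_ind=> v; rewrite !quot_addE addrC. Qed.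

Lemma quot_add0 : left_id (coset_of 0) quot_add.
Proof. by elim/coset_ind=> u; rewrite quot_addE add0r. Qed.

Lemma quot_addN : left_inverse (coset_of 0) quot_opp quot_add.
Proof. by elim/coset_ind=> u; rewrite quot_oppE quot_addE addNr. Qed.

HB.instance Definition _ :=
  GRing.isZmodule.Build Q quot_addA quot_addC quot_add0 quot_addN.

Lemma coset_ofD u v : coset_of (u + v) = coset_of u + coset_of v.
Proof. by rewrite -quot_addE. Qed.

Lemma quot_scaleA a b (x : Q) : quot_scale a (quot_scale b x) = quot_scale (a * b) x.
Proof. by elim/coset_ind: x => u; rewrite !quot_scaleE scalerA. Qed.

Lemma quot_scale1 : left_id 1 quot_scale.
Proof. by elim/coset_ind=> u; rewrite quot_scaleE scale1r. Qed.

Lemma quot_scaleDr : right_distributive quot_scale +%R.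
Proof.
move=> a; elim/coset_ind=> u; elim/coset_ind=> v.
by rewrite -coset_ofD !quot_scaleE scalerDr coset_ofD.
Qed.

Lemma quot_scaleDl (x : Q) : {morph quot_scale^~ x : a b / a + b}.
Proof.
elim/coset_ind: x => u a b; by rewrite !quot_scaleE scalerDl coset_ofD.
Qed.

HB.instance Definition _ := GRing.Zmodule_isLmodule.Build R Q
  quot_scaleA quot_scale1 quot_scaleDr quot_scaleDl.

Lemma coset_of_is_linear : linear (coset_of : V -> Q).
Proof. by move=> a u v; rewrite coset_ofD -quot_scaleE. Qed.

HB.instance Definition _ :=
  GRing.isLinear.Build R V Q _ coset_of coset_of_is_linear.

Lemma coset0 v : coset_of v = 0 <-> Z v.
Proof. by rewrite -[0](raddf0 coset_of) coset_eq subr0. Qed.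

End QuotientModule.

(** * Baer's criterion *)

Section Baer.
Variables (R : comNzRingType) (M : lmodType R).

Definition baer_condition := forall (J : set R) (phi : R -> M), is_ideal J ->
  (forall a u v, J u -> J v -> phi (a * u + v) = a *: phi u + phi v) ->
  exists e, forall a, J a -> phi a = a *: e.

Hypothesis M_baer : baer_condition.

(* Partial linear maps are handled through their graphs. *)
Lemma baer_extension (B : lmodType R) (G0 : set (B * M)%type) :
  is_submod G0 -> (forall y, G0 (0, y) -> y = 0) ->
  exists g : {linear B -> M}, forall x y, G0 (x, y) -> g x = y.
Proof.
move=> G0s G0f.
pose good (G : set (B * M)%type) :=
  [/\ is_submod G, forall y, G (0, y) -> y = 0 & G0 `<=` G].
(* [Zorn_bigcup] includes the empty chain, whose union is empty; hence the extra member [set0],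
   excluded afterwards by comparison with G0. *)
have [F FP Ftot|G [[G_0|[Gs Gf G0G]] Gmax]] :=
    @Zorn_bigcup (B * M)%type [set G | G = set0 \/ good G].
- have [[G1 FG1 [Gs1 Gf1 G01]]|nF] := pselect (exists2 G, F G & good G); last first.
    left; apply/seteqP; split=> // x [G FG Gx]; case: (FP _ FG) => [G_0|gG].
      by rewrite G_0 in Gx.
    by apply: nF; exists G.
  right; split=> [|y [G FG Gy]|x G0x]; last by exists G1 => //; apply: G01.
    apply/is_submodP; split; first by exists G1 => //; apply: submod0.
    move=> a u v [G FG Gu] [H FH Hv].
    have sub G' H' : F G' -> F H' -> G' `<=` H' -> G' u -> H' v ->
        exists2 X, F X & X (a *: u + v).
      move=> FG' FH' GH Gu' Hv'; exists H' => //.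
      case: (FP _ FH') => [H0|[H's _ _]]; first by rewrite H0 in Hv'.
      by apply: submodP => //; apply: GH.
    case: (Ftot _ _ FG FH) => [GH|HG]; first exact: (sub G H).
    exists G => //; case: (FP _ FG) => [G_0|[G's _ _]]; first by rewrite G_0 in Gu.
    by apply: submodP => //; apply: HG.
  by case: (FP _ FG) => [G_0|[_ Gf' _]]; [rewrite G_0 in Gy|exact: Gf'].
- exfalso; apply: (Gmax G0); last by right; split.
  by rewrite G_0; split=> // /(_ 0)[]; apply: submod0.
have Gfun x y y' : G (x, y) -> G (x, y') -> y = y'.
  move=> h h'; apply/eqP; rewrite -subr_eq0; apply/eqP/Gf.
  have -> : (0, y - y') = (x, y) - (x, y') :> B * M.
    by congr pair; rewrite /= subrr.
  exact: submodB.
have dom b : exists y, G (b, y).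
  (* Baer's condition on the ideal of all r with r b in the domain of G gives e, the value at b for
     a larger graph G'. *)
  pose J : set R := [set r | exists y, G (r *: b, y)].
  have Ji : is_ideal J.
    rewrite is_idealE; apply/is_submodP; split.
      by exists 0; rewrite scale0r; apply: (submod0 Gs).
    move=> a u v [y Gy] [z Gz]; exists (a *: y + z).
    have -> : ((a * u + v) *: b, a *: y + z) = a *: (u *: b, y) + (v *: b, z) :> B * M.
      by congr pair; rewrite /= scalerDl scalerA.
    exact: (submodP Gs).
  have /choice[phi hphi] r : exists y, J r -> G (r *: b, y).
    by have [[y Gy]|nJ] := pselect (J r); [exists y|exists 0].
  have [|e he] := M_baer Ji (phi := phi).
    move=> a u v Ju Jv; apply: (Gfun ((a * u + v) *: b)).
      by apply: hphi; apply: (@submodP R R^o).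
    have -> : ((a * u + v) *: b, a *: phi u + phi v) =
        a *: (u *: b, phi u) + (v *: b, phi v) :> B * M.
      by congr pair; rewrite /= scalerDl scalerA.
    by apply: (submodP Gs); apply: hphi.
  pose G' : set (B * M)%type :=
    [set p | exists x y r, [/\ G (x, y) & p = (x + r *: b, y + r *: e)]].
  have GG' : G `<=` G' by move=> [x y] Gxy; exists x, y, 0; rewrite !scale0r !addr0.
  have gG' : good G'.
    split.
    - apply/is_submodP; split; first by apply: GG'; apply: (submod0 Gs).
      move=> a _ _ [x [y [r [Gx ->]]]] [x' [y' [r' [Gx' ->]]]].
      exists (a *: x + x'), (a *: y + y'), (a * r + r').
      split; first exact: (submodP Gs a Gx Gx').
      by congr pair; rewrite /= scalerDr scalerDl !scalerA addrACA.
    - move=> y' [x [y [r [Gxy [e1 ->]]]]].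
      have rb : r *: b = - x by apply/eqP; rewrite -addr_eq0 addrC -e1.
      have Grb : G (r *: b, - y) by rewrite rb; apply: (submodN Gs Gxy).
      have Jr : J r by exists (- y).
      by rewrite -he // -(Gfun _ _ _ Grb (hphi _ Jr)) addrN.
    by move=> p /G0G/GG'.
  have G'G : G' `<=` G.
    by apply: contrapT => nG; apply: (Gmax G'); [split|right].
  by exists e; apply: G'G; exists 0, 0, 1; rewrite !scale1r !add0r; split=> //; apply: (submod0 Gs).
have /choice[g hg] := dom.
have glin : linear g.
  by move=> a u v; apply: (Gfun (a *: u + v)) => //; apply: (submodP Gs a (hg u) (hg v)).
exists (HB.pack g (GRing.isLinear.Build R B M _ g glin) : {linear B -> M}).
by move=> x y /G0G Gxy; apply: (Gfun x).
Qed.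

Lemma baer_injective : injective_module M.
Proof.
move=> A B i f iinj.
have [||g hg] := @baer_extension B [set p | exists a, p = (i a, f a)].
- apply/is_submodP; split; first by exists 0; rewrite !linear0.
  move=> c _ _ [a ->] [b ->]; exists (c *: a + b).
  by congr pair; rewrite /= linearP.
- move=> y [a [e ->]]; have -> : a = 0 by apply: iinj; rewrite linear0 -e.
  by rewrite linear0.
by exists g => a; apply: hg; exists a.
Qed.

End Baer.

(** * Q/Z as an injective abelian group *)

Section RationalsModZ.

Let intsub : set (zmodule rat) := [set x | exists z : int, x = z%:~R].

Lemma submod_intsub : is_submod intsub.
Proof.
apply/is_submodP; split; first by exists 0; rewrite mulr0z.
move=> a _ _ [u ->] [v ->]; exists (a * u + v).
by rewrite scalezrE intrD intrM -mulrzr mulrC.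
Qed.

Definition QZ := quot_mod submod_intsub.
HB.instance Definition _ := GRing.Lmodule.on QZ.

Definition qz (x : rat) : QZ := coset_of submod_intsub x.

Lemma int_ideal_principal (J : set int) : is_ideal J ->
  J = [set 0] \/ exists n : nat, J n.+1%:Z /\ forall a, J a -> exists b, a = b * n.+1%:Z.
Proof.
move=> Ji; have [[a Ja a0]|nJ] := pselect (exists2 a, J a & a <> 0); last first.
  left; apply/seteqP; split=> [a Ja|_ ->]; last exact: (@submod0 _ int^o).
  by apply: contrapT => a0; apply: nJ; exists a.
have ex : exists n : nat, `[< J n.+1%:Z >].
  case: a a0 Ja => [[//|n]|n] _ Ja; exists n; apply/asboolP => //.
  by rewrite -[_%:Z]opprK -NegzE; apply: (@submodN _ int^o).
right; case: (ex_minnP ex) => n /asboolP Jn nmin; exists n; split=> // b Jb.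
exists (b %/ n.+1%:Z)%Z; rewrite {1}[b](divz_eq b n.+1%:Z).
have Jr : J (b %% n.+1%:Z)%Z.
  have -> : (b %% n.+1%:Z)%Z = b - (b %/ n.+1%:Z)%Z * n.+1%:Z.
    by rewrite {2}[b](divz_eq b n.+1%:Z) addrC addKr.
  by apply: (@submodB _ int^o) => //; apply: idealM.
have := ltz_pmod b (isT : 0 < n.+1%:Z); have := modz_ge0 b (isT : n.+1%:Z != 0).
case: (b %% _)%Z Jr => [[|r]|//] Jr _; first by rewrite addr0.
by rewrite ltz_nat ltnS => rn; have := nmin r (asboolT Jr); rewrite leqNgt rn.
Qed.

Lemma rat_divMz (q : rat) (b : int) n : q *~ b = (q / n.+1%:R) *~ (b * n.+1%:Z).
Proof.
have n0 : (n.+1%:R : rat) != 0 by rewrite Num.Theory.pnatr_eq0.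
rewrite -[RHS]mulrzr intrM.
have -> : (n.+1%:Z)%:~R = n.+1%:R :> rat by rewrite pmulrn.
by rewrite mulrCA -mulrA mulVf // mulr1 -mulrzr mulrC.
Qed.

(** Ideals of Z are principal and Q/Z is divisible, so Baer's condition amounts to one division. *)
Lemma QZ_baer : baer_condition QZ.
Proof.
move=> J phi Ji plin.
have phi0 : phi 0 = 0.
  by have := plin (-1) 0 0 (@submod0 _ int^o _ Ji) (@submod0 _ int^o _ Ji);
    rewrite mulr0 addr0 scaleN1r addNr.
have [-> |[n [Jn hn]]] := int_ideal_principal Ji.
  by exists 0 => _ ->; rewrite scaler0.
have [q eq] : exists q : rat, phi n.+1%:Z = qz q.
  by exists (val (phi n.+1%:Z)); rewrite /qz coset_val.
exists (qz (q / n.+1%:R)) => _ /hn[b ->].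
have := plin b n.+1%:Z 0 Jn (@submod0 _ int^o _ Ji); rewrite !addr0 => ->.
rewrite phi0 addr0 eq /qz -!linearZ; congr coset_of.
exact: rat_divMz.
Qed.

End RationalsModZ.

Definition additive_fun (A B : zmodType) (h : A -> B) :=
  forall u v, h (u + v) = h u + h v.

Lemma additive_fun0 (A B : zmodType) (h : A -> B) : additive_fun h -> h 0 = 0.
Proof. by move=> hD; apply: (addrI (h 0)); rewrite -hD !addr0. Qed.

Lemma additive_funN (A B : zmodType) (h : A -> B) u : additive_fun h -> h (- u) = - h u.
Proof.
move=> hD; have h0 := additive_fun0 hD.
by apply: (addIr (h u)); rewrite -hD !addNr.
Qed.

Lemma additive_fun_linear (A B : zmodType) (L : lmodType int) (h : zmodule A -> L) :
  additive_fun h -> linear h.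
Proof.
move=> hD; have hnat n u : h (u *+ n) = h u *+ n.
  elim: n => [|n IH]; first by rewrite !mulr0n; apply: additive_fun0.
  by rewrite !mulrS hD IH.
have hint a u : h (u *~ a) = a *: h u.
  case: a => n; first by rewrite -pmulrn hnat -[Posz n]natz scaler_nat.
  rewrite NegzE mulrNz scaleNr (additive_funN _ hD) -pmulrn hnat.
  by rewrite -[Posz n.+1]natz scaler_nat.
by move=> a u v; rewrite hD scalezrE hint.
Qed.

Lemma QZ_extension (A B : zmodType) (i : A -> B) (f : A -> QZ) :
  additive_fun i -> injective i -> additive_fun f ->
  exists2 g : B -> QZ, additive_fun g & forall a, g (i a) = f a.
Proof.
move=> iD iinj fD.
have ilin : linear (i : zmodule A -> zmodule B) by apply: additive_fun_linear.
have flin : linear (f : zmodule A -> QZ) by apply: additive_fun_linear.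
pose i' : {linear zmodule A -> zmodule B} :=
  HB.pack (i : zmodule A -> zmodule B) (GRing.isLinear.Build int (zmodule A) (zmodule B) _ _ ilin).
pose f' : {linear zmodule A -> QZ} :=
  HB.pack (f : zmodule A -> QZ) (GRing.isLinear.Build int (zmodule A) QZ _ _ flin).
have [g hg] := @baer_injective _ _ QZ_baer _ _ i' f' iinj.
by exists g => // u v; apply: (linearD g).
Qed.

(** On the cyclic group generated by x the character sends x to 1/n, where n > 1 is the order of x,
    or to 1/2 if the order is infinite; Baer's criterion extends it. *)
Lemma QZ_separates (M : zmodType) (x : M) : x <> 0 ->
  exists2 chi : M -> QZ, additive_fun chi & chi x <> 0.
Proof.
move=> x0; pose xz : zmodule M := x.
pose J : set int := [set a | a *: xz = 0].
have Ji : is_ideal J.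
  apply/(@is_submodP int int^o); split; first by rewrite /J /= scale0r.
  move=> a u v Ju Jv; rewrite /J /= -[a *: u]/(a * u) scalerDl -scalerA.
  by rewrite (Ju : _ = 0) (Jv : _ = 0) scaler0 addr0.
have [q q0 Jq] : exists2 q : QZ, q <> 0 & forall a, J a -> a *: q = 0.
  have half (n : nat) : (1 < n)%N -> qz (n%:R^-1) <> 0.
    move=> n1 /coset0 [z ez].
    have : (1 : rat) = (z * n%:Z)%:~R.
      rewrite intrM -ez -[n%:~R]/(n%:R) mulVf // Num.Theory.pnatr_eq0.
      by rewrite -lt0n (ltn_trans _ n1).
    rewrite -[1]/(1%:~R) => /intr_inj /esym/eqP.
    rewrite -[(1 : int)]/(1%:Z); case: z {ez} => z; last first.
      by rewrite NegzE mulNr -PoszM; case: (_ * n)%N.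
    by rewrite -PoszM eqz_nat muln_eq1 => /andP[_ /eqP n_1]; rewrite n_1 in n1.
  have [J0|[n [Jn hn]]] := int_ideal_principal Ji.
    by exists (qz (2%:R^-1)); [exact: half|rewrite J0 => _ ->; rewrite scale0r].
  case: n Jn hn => [|n] Jn hn.
    by case: x0; have := Jn; rewrite /J /= scale1r.
  exists (qz (n.+2%:R^-1)); first exact: half.
  move=> _ /hn[b ->]; rewrite -scalerA.
  have -> : n.+2%:Z *: qz (n.+2%:R^-1) = 0.
    rewrite /qz -linearZ; apply/coset0; exists 1; rewrite scalezrE.
    by have := rat_divMz 1 1 n.+1; rewrite !mul1r => <-.
  exact: scaler0.
have [||g hg] := baer_extension QZ_baer (B := zmodule M)
   (G0 := [set p | exists a : int, p = (a *: xz, a *: q)]).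
- apply/is_submodP; split; first by exists 0; rewrite !scale0r.
  move=> c _ _ [a ->] [b ->]; exists (c * a + b).
  by rewrite !scalerDl -!scalerA.
- by move=> y [a [/esym ea ->]]; apply: Jq.
exists g; first by move=> u v; apply: (linearD g).
by rewrite (hg xz q) //; exists 1; rewrite !scale1r.
Qed.

(** * Enough injectives *)

Section CharacterModule.
Variables (R : comNzRingType) (M : lmodType R).

Definition characters := {chi : M -> QZ | additive_fun chi}.

(* The module Hom_Z(R, D), where D is a power of Q/Z containing M. *)
Definition char_module :=
  {F : characters -> R -> QZ | forall chi, additive_fun (F chi)}.

HB.instance Definition _ := gen_eqMixin char_module.
HB.instance Definition _ := gen_choiceMixin char_module.

Lemma char_module_eq (F G : char_module) :
  (forall chi r, sval F chi r = sval G chi r) -> F = G.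
Proof.
case: F => f hf; case: G => g hg /= e.
have efg : f = g by apply/funext => chi; apply/funext => r.
by subst g; congr exist; apply: Prop_irrelevance.
Qed.

Lemma char_zero_subproof (chi : characters) : additive_fun (fun _ : R => 0 : QZ).
Proof. by move=> u v; rewrite addr0. Qed.
Definition char_zero : char_module := exist _ (fun _ _ => 0) char_zero_subproof.

Lemma char_add_subproof (F G : char_module) chi :
  additive_fun (fun r => sval F chi r + sval G chi r).
Proof. by move=> u v; rewrite (svalP F) (svalP G) addrACA. Qed.
Definition char_add (F G : char_module) : char_module :=
  exist _ (fun chi r => sval F chi r + sval G chi r) (char_add_subproof F G).

Lemma char_opp_subproof (F : char_module) chi : additive_fun (fun r => - sval F chi r).
Proof. by move=> u v; rewrite (svalP F) opprD. Qed.
Definition char_opp (F : char_module) : char_module :=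
  exist _ (fun chi r => - sval F chi r) (char_opp_subproof F).

Lemma char_scale_subproof a (F : char_module) chi :
  additive_fun (fun r => sval F chi (r * a)).
Proof. by move=> u v; rewrite mulrDl (svalP F). Qed.
Definition char_scale a (F : char_module) : char_module :=
  exist _ (fun chi r => sval F chi (r * a)) (char_scale_subproof a F).

Lemma char_addA : associative char_add.
Proof. by move=> F G H; apply: char_module_eq => chi r /=; rewrite addrA. Qed.

Lemma char_addC : commutative char_add.
Proof. by move=> F G; apply: char_module_eq => chi r /=; rewrite addrC. Qed.

Lemma char_add0 : left_id char_zero char_add.
Proof. by move=> F; apply: char_module_eq => chi r /=; rewrite add0r. Qed.

Lemma char_addN : left_inverse char_zero char_opp char_add.
Proof. by move=> F; apply: char_module_eq => chi r /=; rewrite addNr. Qed.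

HB.instance Definition _ :=
  GRing.isZmodule.Build char_module char_addA char_addC char_add0 char_addN.

Lemma char_scaleA a b F : char_scale a (char_scale b F) = char_scale (a * b) F.
Proof. by apply: char_module_eq => chi r /=; rewrite mulrA. Qed.

Lemma char_scale1 : left_id 1 char_scale.
Proof. by move=> F; apply: char_module_eq => chi r /=; rewrite mulr1. Qed.

Lemma char_scaleDr : right_distributive char_scale +%R.
Proof. by move=> a F G; apply: char_module_eq. Qed.

Lemma char_scaleDl F : {morph char_scale^~ F : a b / a + b}.
Proof. by move=> a b; apply: char_module_eq => chi r /=; rewrite mulrDr (svalP F). Qed.

HB.instance Definition _ := GRing.Zmodule_isLmodule.Build R char_module
  char_scaleA char_scale1 char_scaleDr char_scaleDl.

(** Adjunction: R-linear maps into Hom_Z(R, D) are additive maps into D, by evaluation at 1. These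
    extend one character at a time because Q/Z is injective. *)
Lemma char_module_injective : injective_module (char_module : lmodType R).
Proof.
move=> A B i f iinj.
have ex (chi : characters) : exists g : B -> QZ, additive_fun g /\
    forall a, g (i a) = sval (f a) chi 1.
  have [|||g gD hg] := @QZ_extension A B i (fun a => sval (f a) chi 1).
  - exact: linearD.
  - exact: iinj.
  - by move=> u v; rewrite linearD.
  by exists g.
have /choice[g hg] := ex.
have gP b chi : additive_fun (fun r : R => g chi (r *: b)).
  by move=> u v; rewrite scalerDl (proj1 (hg chi)).
pose h b : char_module := exist _ (fun chi r => g chi (r *: b)) (gP b).
have hlin : linear h.
  move=> a u v; apply: char_module_eq => chi r /=.
  by rewrite scalerDr (proj1 (hg chi)) scalerA.
exists (HB.pack h (GRing.isLinear.Build R B char_module _ h hlin) : {linear B -> char_module}).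
move=> a; apply: char_module_eq => chi r /=.
by rewrite -linearZ (proj2 (hg chi)) linearZ /= mul1r.
Qed.

Lemma char_embed_subproof (x : M) (chi : characters) :
  additive_fun (fun r : R => sval chi (r *: x)).
Proof. by move=> u v; rewrite scalerDl (svalP chi). Qed.
Definition char_embed (x : M) : char_module :=
  exist _ (fun chi r => sval chi (r *: x)) (char_embed_subproof x).

Lemma char_embed_is_linear : linear char_embed.
Proof.
move=> a u v; apply: char_module_eq => chi r /=.
by rewrite scalerDr (svalP chi) scalerA.
Qed.
HB.instance Definition _ :=
  GRing.isLinear.Build R M char_module _ char_embed char_embed_is_linear.

Lemma char_embed_inj : injective char_embed.
Proof.
move=> u v e; apply/eqP; rewrite -subr_eq0; apply/eqP; apply: contrapT => uv.
have [chi chiD] := QZ_separates uv; apply.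
have := congr1 (fun F : char_module => sval F (exist _ chi chiD) 1) e.
by rewrite /= !scale1r chiD additive_funN // => ->; rewrite addrN.
Qed.

End CharacterModule.

Lemma enough_injectives (R : comNzRingType) (M : lmodType R) :
  exists (E : lmodType R) (e : {linear M -> E}), injective_module E /\ injective e.
Proof.
exists (char_module M), (@char_embed R M); split.
  exact: char_module_injective.
exact: char_embed_inj.
Qed.

(** * Injective dimension and vanishing of Ext *)

Section InjectiveDimension.
Variable R : comNzRingType.
Implicit Types (M E Q : lmodType R).

(** An injective resolution cut into short exact sequences 0 -> M -> E -> C -> 0, the form suited to
    dimension shifting. *)
Fixpoint inj_dim_le n M : Prop :=
  match n with
  | 0%N => injective_module M
  | n'.+1 => exists (E : lmodType R) (e : {linear M -> E}) (C : lmodType R)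
      (p : {linear E -> C}),
      [/\ injective_module E, injective e, forall c, exists x, p x = c,
          forall x, p x = 0 <-> exists u, x = e u & inj_dim_le n' C]
  end.

Lemma zero_module_injective : injective_module ('rV[R]_0 : lmodType R).
Proof. by move=> A B i f _; exists \0 => a; rewrite [f a]thinmx0. Qed.

Lemma inj_dim_finite n M : inj_dim_le n M -> finite_injective_dim M.
Proof.
move=> h; exists n; elim: n M h => [|n IH] M /=.
  move=> Minj; pose E i : lmodType R := match i with 0%N => M | _ => 'rV[R]_0 end.
  exists E, (idfun : {linear M -> E 0%N}), (fun i => \0 : {linear E i -> E i.+1}).
  split=> [[|i]||u|i u|[|i] // _ u].
  - exact: Minj.
  - exact: zero_module_injective.
  - by move=> u v.
  - by split=> // _; exists u.
  - split=> // _; exists 0; exact: thinmx0.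
  - exact: thinmx0.
move=> [E0 [e0 [C [p [E0inj e0inj psurj pker /IH[E [e [d [Einj einj d0 dS Enil]]]]]]]]].
pose E' i : lmodType R := match i with 0%N => E0 | i'.+1 => E i' end.
exists E', e0, (fun i => match i return {linear E' i -> E' i.+1} with
  | 0%N => (e \o p : {linear E0 -> E 0%N}) | i'.+1 => d i' end).
split=> [[|i]|//|u|[|i] u|[|i] // ni u].
- exact: E0inj.
- exact: Einj.
- rewrite -pker /=; split=> [h|->]; last exact: raddf0.
  by apply: einj; rewrite h raddf0.
- rewrite /= d0; split=> [[c ->]|[v ->]]; last by exists (p v).
  by have [x <-] := psurj c; exists x.
- exact: dS.
- exact: Enil.
Qed.

Lemma quot_lift (V W : lmodType R) (Z : set V) (Zs : is_submod Z)
  (f : {linear V -> W}) : (forall v, Z v -> f v = 0) ->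
  exists g : {linear quot_mod Zs -> W}, forall v, g (coset_of Zs v) = f v.
Proof.
move=> fZ; pose h (x : quot_mod Zs) := f (val x).
have hE v : h (coset_of Zs v) = f v.
  apply/eqP; rewrite -subr_eq0 -linearB; apply/eqP/fZ; exact: coset_reprP.
have hlin : linear h.
  move=> a; elim/coset_ind=> u; elim/coset_ind=> v.
  by rewrite -linearP !hE linearP.
exists (HB.pack h (GRing.isLinear.Build R (quot_mod Zs) W _ h hlin) :
  {linear quot_mod Zs -> W}).
exact: hE.
Qed.

(** The image of A is R^p modulo the kernel, embedded in R^n; f factors through it and then extends
    by injectivity. *)
Lemma injective_module_factor E n p (A : 'M[R]_(p, n)) (f : {linear 'rV[R]_p -> E}) :
  injective_module E -> (forall v, v *m A = 0 -> f v = 0) ->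
  exists g : {linear 'rV[R]_n -> E}, forall v, f v = g (v *m A).
Proof.
move=> Einj fA.
have Zs : is_submod [set v : 'rV[R]_p | v *m A = 0].
  apply/is_submodP; split; first by rewrite /= mul0mx.
  by move=> a u w /= eu ew; rewrite mulmxDl -scalemxAl eu ew scaler0 addr0.
have [f' hf'] := quot_lift Zs fA.
have [|i hi] := @quot_lift _ _ _ Zs (mulmxr A : {linear 'rV[R]_p -> 'rV[R]_n}).
  by move=> v.
have [|g hg] := Einj _ _ i f'.
  elim/coset_ind=> u; elim/coset_ind=> v; rewrite !hi => e.
  by apply/coset_eq; rewrite /= mulmxBl; apply/eqP; rewrite subr_eq0; apply/eqP.
by exists g => v; rewrite -hf' -hg hi.
Qed.

(* Ext^(j+1)(-, M) = 0; the shift avoids the case of Hom. *)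
Definition ext_module_vanish n (C : cx R n) M j :=
  forall f : {linear 'rV[R]_(rks C j) -> M}, (forall v, f (v *m df C j.+1) = 0) ->
  exists g : {linear 'rV[R]_(rk_ n (rks C) j) -> M}, forall v, f v = g (v *m df C j).

(** Dimension shifting along 0 -> M -> E -> Q -> 0. A cocycle f into Q lifts to F into E, whose
    coboundary h has values in M. Writing h as g after the differential, [F - e g] kills boundaries,
    hence extends along [df C j], and p turns the extension into the one sought for f. *)
Lemma ext_module_shift n (C : cx R n) M E (Q : lmodType R) (e : {linear M -> E}) (p : {linear E -> Q}) j :
  acyclic C -> injective_module E -> injective e ->
  (forall c, exists x, p x = c) -> (forall x, p x = 0 <-> exists u, x = e u) ->
  ext_module_vanish C M j.+1 -> ext_module_vanish C Q j.
Proof.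
move=> Cac Einj einj psurj pker van f f0.
have /choice[F0 hF0] i : exists x, p x = f (delta_mx 0 i) by apply: psurj.
pose F : {linear 'rV[R]_(rks C j) -> E} := lincomb F0.
have pF v : p (F v) = f v.
  by rewrite /F /= linear_lincomb lincombE; apply: eq_bigr => i _ /=; rewrite hF0.
have /choice[h hh] (v : 'rV[R]_(rks C j.+1)) : exists u, F (v *m df C j.+1) = e u.
  by apply/pker; rewrite pF.
have hlin : linear h.
  move=> a u v; apply: einj; rewrite -hh mulmxDl -scalemxAl.
  apply: (etrans (linearP F a _ _)).
  by rewrite (linearP e) -!hh.
pose h' : {linear 'rV[R]_(rks C j.+1) -> M} := HB.pack h
  (GRing.isLinear.Build R 'rV[R]_(rks C j.+1) M _ h hlin).
have [|g hg] := van h'.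
  move=> v; apply: einj; rewrite -hh -mulmxA.
  by have /= -> := proj1 Cac j.+1; rewrite mulmx0 !raddf0.
have [v v0|G hG] := @injective_module_factor E _ _ (df C j)
    (F \- (e \o g) : {linear 'rV[R]_(rks C j) -> E}) Einj.
  have [w ->] := proj2 Cac j v v0; rewrite /= hh.
  by have /= <- := hg w; rewrite subrr.
exists (p \o G : {linear _ -> Q}) => v.
have /= <- := hG v; rewrite linearB pF.
by have -> : p (e (g v)) = 0 by [apply/pker; exists (g v)]; rewrite subr0.
Qed.

Hypothesis Rnoeth : noetherian R.

(** Complexes ending in R^1 resolve the modules R/J, and Ext^1(R/J, M) = 0 for all J is Baer's
    condition; this settles n = 0. For larger n, M is embedded in an injective module and the degree
    is shifted. *)
Lemma inj_dim_of_vanish n M :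
  (forall C : cx R 1, acyclic C -> forall j, (n <= j)%N -> ext_module_vanish C M j) ->
  inj_dim_le n M.
Proof.
elim: n M => [|n IH] M van /=.
  apply: baer_injective => J phi Ji plin.
  have Zs : is_submod [set v : 'rV[R]_1 | J (v 0 0)].
    apply/is_submodP; split=> [|a u v Ju Jv]; rewrite /= !mxE.
      exact: (@submod0 R R^o).
    exact: (@submodP R R^o).
  have [C [Cac eC]] := resolution_exists Rnoeth Zs.
  have JD (v : 'rV[R]_(rks C 0%N)) : J ((v *m df C 0%N) 0 0).
    have : rowspan (df C 0%N) (v *m df C 0%N) by exists v.
    by rewrite eC.
  have phi0 : phi 0 = 0.
    have J0 : J 0 by apply: (@submod0 R R^o).
    by have := plin (-1) 0 0 J0 J0; rewrite mulr0 addr0 scaleN1r addNr.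
  pose f (v : 'rV[R]_(rks C 0%N)) := phi ((v *m df C 0%N) 0 0).
  have flin : linear f.
    move=> a u v; rewrite /f mulmxDl -scalemxAl -plin //.
    by congr phi; rewrite mxE [(_ *: _ : 'M__) _ _]mxE.
  have [|g hg] := van C Cac 0%N isT (HB.pack f
      (GRing.isLinear.Build R 'rV[R]_(rks C 0%N) M _ f flin)).
    by move=> v; rewrite /= /f -mulmxA (proj1 Cac 0%N) mulmx0 mxE.
  exists (g 1%:M) => a Ja; have : rowspan (df C 0%N) a%:M by rewrite eC /= mxE eqxx.
  move=> [v ev]; have := hg v; rewrite /= /f -ev mxE eqxx mulr1n => ->.
  by rewrite -[a%:M]scalemx1 linearZ.
have [E [e [Einj einj]]] := enough_injectives M.
have Zs : is_submod (range e).
  apply/is_submodP; split; first by exists 0; rewrite ?linear0.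
  by move=> a _ _ [u _ <-] [v _ <-]; exists (a *: u + v); rewrite ?linearP.
exists E, e, (quot_mod Zs), (coset_of Zs : {linear E -> quot_mod Zs}).
have surj (c : quot_mod Zs) : exists x, coset_of Zs x = c.
  by exists (val c); apply: coset_val.
have ker x : coset_of Zs x = 0 <-> exists u, x = e u.
  by rewrite coset0; split=> [[u _ <-]|[u ->]]; exists u.
split=> //; apply: IH => C Cac j nj.
apply: (ext_module_shift (e := e) (p := coset_of Zs : {linear E -> quot_mod Zs})) => //.
exact: van.
Qed.

Lemma ext_vanish_module n (C : cx R n) j :
  ext_vanish C setT [set 0] j.+1 -> ext_module_vanish C R^o j.
Proof.
move=> van f f0; pose w := \col_i (f (delta_mx 0 i) : R).
have fw v : f v = (v *m w) 0 0.
  by rewrite lincombE -lincomb_col; apply: eq_bigr => i _; rewrite mxE.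
have [|u [_ /mxin_set0/eqP]] := van w.
  split=> //; apply/mxin_set0/matrixP=> i l; rewrite ord1 [RHS]mxE -(f0 (delta_mx 0 i)).
  by rewrite fw -mulmxA -rowE [RHS]mxE.
rewrite subr_eq0 => /eqP ew.
exists (lincomb (fun i => u i 0 : R^o)) => v.
by rewrite fw ew mulmxA /= lincomb_col.
Qed.

End InjectiveDimension.

Lemma canonical_unit_ideal_gorenstein (R : comNzRingType) (m : set R) (k : fieldType)
  (pi : {rmorphism R -> k}) d : noetherian_local m pi ->
  canonical_ideal m pi d setT -> gorenstein_local m pi.
Proof.
move=> loc /canonical_ext[Ri Re]; split=> //.
apply: (@inj_dim_finite _ d); apply: inj_dim_of_vanish; first by case: loc.
move=> C Cac j dj; apply: ext_vanish_module.
exact: (ext_concentrated_above loc (d := d)).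
Qed.

(** * Multiplicity *)

Section ChainLengths.
Variable R : comNzRingType.
Implicit Types (A B C I : set R).

Definition interval A B I := [/\ is_ideal I, A `<=` I & I `<=` B].

Definition chain_in A B l (c : nat -> set R) :=
  (forall i, (i <= l)%N -> interval A B (c i)) /\
  (forall i, (i < l)%N -> c i `<` c i.+1).

(** The length of B/A is kept as two inequalities, so that it may be infinite and no composition
    series is needed. *)
Definition length_ge A B l := exists c, chain_in A B l c.
Definition length_le A B l := forall p, length_ge A B p -> (p <= l)%N.

Lemma length_quotientE J l :
  length_quotient J l <-> length_ge J setT l /\ length_le J setT l.
Proof.
have e I : (is_ideal I /\ J `<=` I) <-> interval J setT I.
  by split=> [[? ?]|[? ? _]]; split.
have ec p c : ((forall i, (i <= p)%N -> is_ideal (c i) /\ J `<=` c i) /\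
    (forall i, (i < p)%N -> c i `<` c i.+1)) <-> chain_in J setT p c.
  by split=> -[h1 h2]; split=> // i /h1/e.
split=> [[[c /ec hc] hle]|[[c hc] hle]]; split; try by exists c; rewrite ?ec //; apply/ec.
  by move=> p [c' /ec]; apply: hle.
by move=> p c' /ec hc'; apply: hle; exists c'.
Qed.

Lemma length_ge0 A B : is_ideal A -> A `<=` B -> length_ge A B 0.
Proof. by move=> Ai AB; exists (fun=> A); split=> // i _; split. Qed.

Lemma length_ge_sub A B A' B' l : A' `<=` A -> B `<=` B' ->
  length_ge A B l -> length_ge A' B' l.
Proof.
move=> A'A BB' [c [cI cS]]; exists c; split=> // i /cI[Ii AI IB].
by split=> // [a /A'A/AI|a /IB/BB'].
Qed.

Lemma length_le_sub A B A' B' l : A `<=` A' -> B' `<=` B ->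
  length_le A B l -> length_le A' B' l.
Proof. by move=> AA' BB' h p /(length_ge_sub AA' BB')/h. Qed.

Lemma length_ge_add A B C p q :
  length_ge A B p -> length_ge B C q -> A `<=` B -> B `<=` C -> length_ge A C (p + q).
Proof.
move=> [c [cI cS]] [c' [c'I c'S]] AB BC.
(* The chains are joined at index p, where [c' 0] takes the place of [c p]; this is harmless as
   [c p] lies in B and B in [c' 0]. *)
exists (fun i => if (i < p)%N then c i else c' (i - p)%N); split=> i ilt.
  case: ltnP => ip; first by have [Ii AI IB] := cI i (ltnW ip); split=> // a /IB/BC.
  have [|Ii BI IC] := c'I (i - p)%N; first by rewrite leq_subLR.
  by split=> // a /AB/BI.
case: (ltnP i p) => ip; last first.
  rewrite ltnNge (leqW ip) subSn //; apply: c'S.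
  by rewrite ltn_subLR.
case: ltnP => ip1; first exact: cS.
have -> : i.+1 = p by apply/eqP; rewrite eqn_leq ip ip1.
rewrite subnn; have [_ B0 _] := c'I 0%N isT.
have [_ _ pB] := cI _ (leqnn p).
have [sub nsub] := cS i ip; have ep : i.+1 = p by apply/eqP; rewrite eqn_leq ip ip1.
rewrite ep in sub nsub; split=> [a /sub/pB/B0//|h]; apply: nsub.
by move=> a /pB/B0/h.
Qed.

Lemma length_ge_proper A B C l : is_ideal A -> is_ideal C -> A `<=` B ->
  length_ge A B l -> B `<=` C -> ~ C `<=` B -> length_ge A C l.+1.
Proof.
move=> Ai Ci AB [c [cI cS]] BC nCB.
exists (fun i => if (i <= l)%N then c i else C); split=> i il.
  case: ifP => h; first by have [Ii AI IB] := cI _ h; split=> // a /IB/BC.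
  by split=> // a /AB/BC.
move: il; rewrite ltnS => il; rewrite il; case: ltnP => h; first exact: cS.
have [_ _ IB] := cI _ il; split=> [a /IB/BC//|CI]; apply: nCB.
by move=> a /CI/IB.
Qed.

(* From a weakly increasing sequence, keep one member per strict step. *)
Lemma length_ge_weak A B (w : nat -> set R) l :
  (forall i, (i <= l)%N -> interval A B (w i)) ->
  (forall i, (i < l)%N -> w i `<=` w i.+1) ->
  length_ge A B (\sum_(i < l) ~~ `[< w i.+1 `<=` w i >])%N.
Proof.
move=> wI winc; suff : forall p, (p <= l)%N -> exists c,
    [/\ chain_in A B (\sum_(i < p) ~~ `[< w i.+1 `<=` w i >])%N c &
        c (\sum_(i < p) ~~ `[< w i.+1 `<=` w i >])%N = w p].
  by move/(_ l (leqnn l)) => [c [hc _]]; exists c.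
elim=> [|p IH] pl.
  by exists (fun=> w 0%N); rewrite big_ord0; split=> //; split=> // i _; apply: wI.
have [c [[cI cS] ec]] := IH (ltnW pl).
rewrite big_ord_recr /=; move: (\sum_(i < p) _)%N cI cS ec => s cI cS ec.
case: asboolP => h /=.
  rewrite addn0; exists c; split=> //; rewrite ec.
  by apply/seteqP; split=> //; apply: winc.
rewrite addn1; exists (fun i => if (i <= s)%N then c i else w p.+1); split; last first.
  by rewrite ltnn.
split=> i il; first by case: ifP => hi; [apply: cI|apply: wI].
move: il; rewrite ltnS => il; rewrite il; case: ltnP => hi; first exact: cS.
have -> : i = s by apply/eqP; rewrite eqn_leq il hi.
by rewrite ec; split=> //; apply: winc.
Qed.

(** By the modular law, a strict step of a chain remains strict after intersecting with B or after
    adding B; the two resulting weak chains have at most p and q strict steps. *)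
Lemma length_le_add A B C p q : is_ideal B -> is_ideal C ->
  length_le A B p -> length_le B C q -> A `<=` B -> B `<=` C -> length_le A C (p + q).
Proof.
move=> Bi Ci hp hq AB BC l [c [cI cS]].
pose w1 i := c i `&` B; pose w2 i := padd (c i : set R^o) 1 B.
have ci i : (i <= l)%N -> is_ideal (c i) by case/cI.
have le1 : (\sum_(i < l) (~~ `[< w1 i.+1 `<=` w1 i >]) <= p)%N.
  apply/hp/length_ge_weak => i il.
    have [Ii AI IC] := cI _ il; split=> [|a Aa|a []//].
      exact: (@submodI R R^o).
    by split; [exact: AI|exact: AB].
  by have [sub _] := cS _ il; move=> a [ca Ba]; split=> //; apply: sub.
have le2 : (\sum_(i < l) (~~ `[< w2 i.+1 `<=` w2 i >]) <= q)%N.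
  apply/hq/length_ge_weak => i il.
    have [Ii AI IC] := cI _ il; split.
    - exact: ideal_padd.
    - move=> b Bb; exists 0, b; split=> //; first exact: (@submod0 R R^o).
      by rewrite add0r scale1r.
    - move=> _ [a [b [Ia Bb ->]]]; rewrite scale1r.
      by apply: (@submodD R R^o _ Ci); [exact: IC|exact: BC].
  have [sub _] := cS _ il; move=> _ [a [b [ca Bb ->]]].
  by exists a, b; split=> //; apply: sub.
apply: leq_trans (leq_add le1 le2); rewrite -big_split /= -{1}[l]card_ord -sum1_card.
apply: leq_sum => i _; have [sub nsub] := cS i (ltn_ord i).
case: asboolP => // s1; case: asboolP => // s2; exfalso; apply: nsub => a ca.
have [|a' [b [ca' Bb e]]] := s2 a.
  by exists a, 0; split=> //; [exact: (@submod0 R R^o)|rewrite scaler0 addr0].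
rewrite scale1r in e; rewrite e.
have cSi : is_ideal (c i.+1) by apply: ci; apply: ltn_ord.
apply: (@submodD R R^o _ (ci i (ltnW (ltn_ord i)))) => //.
have [] : w1 i b; last by [].
by apply: s1; split=> //; apply: (@submodDl R R^o _ cSi a'); [exact: sub|rewrite -e].
Qed.

Lemma length_ge_scale A B x l : GRing.lreg x ->
  length_ge A B l -> length_ge (ideal_scale x A) (ideal_scale x B) l.
Proof.
move=> xreg [c [cI cS]]; exists (fun i => ideal_scale x (c i)); split=> i il.
  have [Ii AI IB] := cI _ il; split; first exact: is_ideal_scale.
    by move=> _ [a /AI Ia <-]; exists a.
  by move=> _ [a /IB Ba <-]; exists a.
have [sub nsub] := cS _ il; split=> [_ [a /sub ca <-]|h]; first by exists a.
apply: nsub => a ca.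
by have : ideal_scale x (c i) (x * a) by [apply: h; exists a]; case=> b cb /xreg <-.
Qed.

Lemma length_sup A B l : is_ideal A -> A `<=` B -> length_le A B l ->
  exists r, length_ge A B r /\ length_le A B r.
Proof.
move=> Ai AB hl; have ex : exists p, `[< length_ge A B p >].
  by exists 0%N; apply/asboolP/length_ge0.
have ub p : `[< length_ge A B p >] -> (p <= l)%N by move/asboolP/hl.
case: (ex_maxnP ex ub) => r /asboolP hr rmax; exists r; split=> // p hp.
by apply: rmax; apply/asboolP.
Qed.

End ChainLengths.

(** * Generators of m, the theorem of Eakin and Sathaye, and minimal multiplicity *)

Section Multiplicity.
Variables (R : comNzRingType) (m : set R) (k : fieldType).
Variable pi : {rmorphism R -> k}.
Hypothesis loc : noetherian_local m pi.
Implicit Types (I J M : set R).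

Let Rnoeth : noetherian R. Proof. by case: loc. Qed.
Let mi : is_ideal m. Proof. exact: local_max_ideal loc. Qed.
Let mn j : is_ideal (ideal_pow m j). Proof. exact: is_ideal_pow. Qed.

Lemma generated_ideal n (g : 'I_n -> R) : is_ideal (generated_by g).
Proof.
rewrite is_idealE; apply/is_submodP; split.
  by exists (fun=> 0); rewrite big1 // => i _; rewrite mul0r.
move=> a _ _ [c ->] [e ->]; exists (fun i => a * c i + e i).
rewrite -[a *: _]/(a * _) mulr_sumr -big_split; apply: eq_bigr => i _ /=.
by rewrite mulrDl mulrA.
Qed.

Lemma generated_min n (g : 'I_n -> R) J : is_ideal J -> (forall i, J (g i)) ->
  generated_by g `<=` J.
Proof.
move=> Ji gJ _ [c ->]; apply: (@submod_sum R R^o _ Ji) => i _.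
exact: idealM.
Qed.

Lemma max_mul_generated n (g : 'I_n -> R) :
  ideal_mul m (generated_by g) `<=`
  [set a | exists2 c : 'I_n -> R, forall i, m (c i) & a = \sum_i c i * g i].
Proof.
apply: ideal_mul_min => [|a _ ma [c ->]]; last first.
  exists (fun i => a * c i) => [i|]; first by rewrite mulrC; apply: idealM.
  by rewrite mulr_sumr; apply: eq_bigr => i _; rewrite mulrA.
rewrite is_idealE; apply/is_submodP; split.
  exists (fun=> 0) => [_|]; first exact: (@submod0 R R^o _ mi).
  by rewrite big1 // => i _; rewrite mul0r.
move=> a _ _ [c mc ->] [e me ->]; exists (fun i => a * c i + e i).
  by move=> i; apply: (@submodP R R^o _ mi).
rewrite -[a *: _]/(a * _) mulr_sumr -big_split; apply: eq_bigr => i _ /=.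
by rewrite mulrDl mulrA.
Qed.

Lemma nakayama_max I L : is_ideal I -> is_ideal L ->
  (forall a, I a -> exists2 b, ideal_mul m I b & L (a - b)) -> I `<=` L.
Proof.
move=> Ii Li h; have [n [g Ig]] := Rnoeth Ii.
rewrite {1}Ig; apply: generated_min => // i.
move: i; apply: (@nakayama _ _ _ _ loc R^o) => // i.
have [|b + Lb] := h (g i); first by rewrite Ig; apply: generated_mem.
by rewrite Ig => /max_mul_generated[c mc eb]; exists c; rewrite // -eb.
Qed.

Lemma ideal_pow1 : ideal_pow m 1 = m.
Proof.
apply/seteqP; split; first by apply: ideal_mul_min => // a b ma _; rewrite mulrC; apply: idealM.
by move=> a ma; rewrite -[a]mulr1; apply: ideal_mul_mem.
Qed.

Lemma ideal_pow_sub j : ideal_pow m j.+1 `<=` ideal_pow m j.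
Proof. by apply: ideal_mul_min => // a b _ mb; apply: idealM. Qed.

(** The chain is m^2 + (g_0, ..., g_(i-1)). It is strict, for otherwise g_i would be redundant by
    Nakayama's lemma, against minimality. *)
Lemma length_generators e : min_generators m e -> length_ge (ideal_pow m 2) m e.
Proof.
have m2m : ideal_pow m 2 `<=` m by move=> a /ideal_pow_sub; rewrite ideal_pow1.
case: e => [_|e [[g mg] gmin]]; first by apply: length_ge0.
have gm i : m (g i) by rewrite {1}mg; apply: generated_mem.
pose c i : set R := [set v | exists r : 'I_e.+1 -> R,
  (forall l : 'I_e.+1, (i <= l)%N -> r l = 0) /\ ideal_pow m 2 (v - \sum_l r l * g l)].
have ci i : is_ideal (c i).
  rewrite is_idealE; apply/is_submodP; split.
    exists (fun=> 0); split=> //; rewrite big1 ?subr0 => [|l _]; last exact: mul0r.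
    exact: (@submod0 R R^o _ (mn 2)).
  move=> a u v [r [r0 ru]] [q [q0 qv]]; exists (fun l => a * r l + q l); split.
    by move=> l il; rewrite r0 // q0 // mulr0 addr0.
  have -> : a *: (u : R^o) + v - \sum_l (a * r l + q l) * g l =
      a * (u - \sum_l r l * g l) + (v - \sum_l q l * g l).
    rewrite mulrBr mulr_sumr addrACA -opprD -big_split /=; congr (_ - _).
    by apply: eq_bigr => l _; rewrite mulrDl mulrA.
  exact: (@submodP R R^o _ (mn 2)).
exists c; split=> i il.
  split=> // [a ma|a [r [_ /m2m ra]]].
    by exists (fun=> 0); split=> //; rewrite big1 ?subr0 // => l _; rewrite mul0r.
  apply: (@submodBl R R^o _ mi a (\sum_l r l * g l)) => //.
  by apply: (@submod_sum R R^o _ mi) => l _; apply: idealM.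
split=> [a [r [r0 ra]]|h].
  by exists r; split=> // l il'; apply: r0; apply: ltnW.
pose i0 := Ordinal il.
have [r [r0 ri]] : c i (g i0).
  apply: h; exists (fun l => (l == i0)%:R); split.
    by move=> l il'; case: eqP => // el; rewrite el ltnn in il'.
  rewrite (bigD1 i0) //= eqxx mul1r big1 ?addr0 => [|l /negPf->]; last by rewrite mul0r.
  by rewrite subrr; apply: (@submod0 R R^o _ (mn 2)).
pose L := generated_by (g \o lift i0).
have Li : is_ideal L by apply: generated_ideal.
have Lg l : l != i0 -> L (g l).
  by case: (unliftP i0 l) => [l' ->|->]; [move=> _; apply: generated_mem|rewrite eqxx].
have mL : m `<=` L.
  rewrite {1}mg; apply: generated_min => // l; move: l.
  apply: (@nakayama _ _ _ _ loc R^o) => // l.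
  have [->|li] := eqVneq l i0; last first.
    exists (fun=> 0) => [_|]; first exact: (@submod0 R R^o _ mi).
    by rewrite big1 ?subr0 => [|j _]; [exact: Lg|rewrite scale0r].
  have [s ms es] : [set a | exists2 c : 'I_e.+1 -> R, forall i, m (c i) &
      a = \sum_i c i * g i] (g i0 - \sum_l0 r l0 * g l0).
    apply: max_mul_generated; rewrite -mg; move: ri; rewrite /= -/(ideal_pow m 1).
    by rewrite ideal_pow1.
  exists s => //; rewrite -[\sum_j s j *: _]es subKr.
  apply: (@submod_sum R R^o _ Li) => j _.
  have [->|ji] := eqVneq j i0; last by apply: idealM => //; apply: Lg.
  by rewrite r0 // mul0r; apply: (@submod0 R R^o _ Li).
suff : (e.+1 <= e)%N by rewrite ltnn.
apply: (gmin e (g \o lift i0)); apply/seteqP; split=> //.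
by apply: (generated_min mi) => l; apply: gm.
Qed.

Section Infinite.
Hypothesis k_infinite : infinite_set [set: k].

Lemma infinite_field_nonroot (q : {poly k}) : q != 0 -> exists c, ~~ root q c.
Proof.
move=> q0; have [f finj] := infinite_injection k_infinite.
apply: contrapT => h; have : (size [seq f i | i <- iota 0 (size q)] < size q)%N.
  apply: max_poly_roots => //; last by rewrite map_inj_uniq // iota_uniq.
  apply/allP => _ /mapP[i _ ->]; apply: contrapT => nr; apply: h.
  by exists (f i); apply/negP.
by rewrite size_map size_iota ltnn.
Qed.

(** Over k, the matrix 1 + cA with c nonzero is singular only if 1/c is an eigenvalue of -A; so c
    lifts the inverse of some mu that is neither 0 nor such an eigenvalue. *)
Lemma perturb_invertible p (A : 'M[R]_p) :
  exists c, ~ m c /\ exists N, N *m (1%:M + c *: A) = 1%:M.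
Proof.
pose Ak := map_mx pi A.
have [|mu] := @infinite_field_nonroot ('X * char_poly (- Ak)).
  by rewrite mulf_neq0 ?polyX_eq0 // monic_neq0 // char_poly_monic.
rewrite rootM rootX negb_or => /andP[mu0 detmu].
have [c hc] := local_lift loc mu^-1; exists c; split.
  by move/(local_maxE loc); rewrite hc => /eqP; rewrite invr_eq0 (negPf mu0).
have [|b hb] := @local_unit _ _ _ _ loc (\det (1%:M + c *: A)).
  move/(local_maxE loc); rewrite -det_map_mx map_mxD map_mx1 map_mxZ hc -/Ak => /eqP.
  case/det0P => v v0; rewrite mulmxDr mulmx1 -scalemxAr => /eqP.
  rewrite addr_eq0 => /eqP ev; case/negP: detmu; rewrite -eigenvalue_root_char.
  apply/eigenvalueP; exists v => //.
  by rewrite {2}ev mulmxN scalerN scalerA divff // scale1r.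
exists (b *: \adj (1%:M + c *: A)).
by rewrite -scalemxAl mul_adj_mx scale_scalar_mx hb.
Qed.

Local Notation pd M w j := (padd (M : set R^o) w (ideal_pow m j)).

Lemma perturb_generic M w y z j : is_ideal M -> m z ->
  pd M w j `<=` pd M (w * y) j.-1 ->
  exists2 c, ~ m c & pd M w j `<=` pd M (w * (y + c * z)) j.-1.
Proof.
move=> Mi mz good; have [p [g mg]] := Rnoeth (mn j.-1).
have gm i : ideal_pow m j.-1 (g i) by rewrite mg; apply: generated_mem.
have /choice[A hA] i : exists a : 'I_p -> R,
    M (w * (z * g i) - (w * y) * \sum_l a l * g l).
  have [|b [t [Mb]]] := good (w * (z * g i)).
    exists 0, (z * g i); split; first exact: (@submod0 R R^o _ Mi).
      case: j g mg gm {good} => [//|j] g mg gm.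
      by apply: ideal_mul_mem => //; apply: gm.
    by rewrite add0r.
  rewrite mg => -[a ->] ->; exists a.
  by rewrite -[(w * y) *: _]/((w * y) * _) addrK.
have [c [nc [N hN]]] := perturb_invertible (\matrix_(i, l) A i l).
exists c => // u /good[b [t [Mb]]]; rewrite {1}mg => -[s ->] ->.
have Pi : is_ideal (pd M (w * (y + c * z)) j.-1) by apply: ideal_padd (mn _) Mi.
have MP : M `<=` pd M (w * (y + c * z)) j.-1.
  exact: (@sub_padd R R^o _ _ _ (mn j.-1)).
apply: (@submodD R R^o _ Pi); first exact: MP.
rewrite -[(w * y) *: _]/((w * y) * _) mulr_sumr.
apply: (@submod_sum R R^o _ Pi) => l _; rewrite mulrCA; apply: idealM => //.
pose h i := w * (y + c * z) * g i - c * (w * (z * g i) - (w * y) * \sum_l A i l * g l).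
have -> : w * y * g l = \sum_i N l i * h i.
  transitivity (\sum_j (N *m (1%:M + c *: \matrix_(i, l) A i l)) l j * (w * y * g j)).
    rewrite hN (bigD1 l) //= big1 ?addr0 => [|q ql]; rewrite mxE.
      by rewrite eqxx mul1r.
    by rewrite eq_sym (negPf ql) mul0r.
  under eq_bigr do rewrite mxE mulr_suml.
  rewrite exchange_big /=; apply: eq_bigr => i _.
  under eq_bigr do rewrite -mulrA.
  rewrite -mulr_sumr; congr (_ * _).
  have E q : (1%:M + c *: \matrix_(i, l) A i l) i q = (i == q)%:R + c * A i q.
    by rewrite !mxE.
  under eq_bigr do rewrite E mulrDl.
  rewrite big_split /= (bigD1 i) //= eqxx mul1r big1 ?addr0 => [|q qi]; last first.
    by rewrite eq_sym (negPf qi) mul0r.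
  have -> : \sum_j c * A i j * (w * y * g j) = c * (w * y * \sum_j A i j * g j).
    by rewrite !mulr_sumr; apply: eq_bigr => q _; ring.
  by rewrite /h; ring.
apply: (@submod_sum R R^o _ Pi) => i _; apply: idealM => //.
apply: (@submodB R R^o _ Pi); last by apply: MP; apply: idealM => //; apply: hA.
exact: (@padd_mul R R^o).
Qed.

(* Eakin-Sathaye: take x with w x m^j of maximal length modulo M.  If w m^(j+1) is
   longer, induction applied to w x gives many y with w x m^j = w x y m^(j-1) mod M,
   hence w y m^j = w x m^j mod M; such y span m. *)
Lemma eakin_sathaye M j w : is_ideal M ->
  length_le M (pd M w j) j -> exists2 y, m y & pd M w j `<=` pd M (w * y) j.-1.
Proof.
move=> Mi; have m0 : m 0 by apply: (@submod0 R R^o _ mi).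
have mstep i x t : m x -> ideal_pow m i.-1 t -> ideal_pow m i (x * t).
  by case: i => // i mx mt; apply: ideal_mul_mem.
have pdi v i : is_ideal (pd M v i) by apply: ideal_padd (mn _) Mi.
have Mpd v i : M `<=` pd M v i by apply: (@sub_padd R R^o _ _ _ (mn i)).
have pd_mem v i a : ideal_pow m i a -> pd M v i (v * a).
  by move=> ma; apply: (@padd_mul R R^o).
have pd_min v i L : is_ideal L -> M `<=` L -> (forall a, ideal_pow m i a -> L (v * a)) ->
    pd M v i `<=` L.
  move=> Li ML h _ [b [t [/ML Lb mt ->]]].
  by apply: (@submodD R R^o _ Li) => //; apply: h.
elim: j w => [|j IH] w le.
  (* A length of at most 0 forces M + wR = M, so any y in m does. *)
  exists 0 => // a wa; apply: contrapT => nwa.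
  have : (1 <= 0)%N; last by [].
  apply: le; apply: (length_ge_proper Mi (pdi w 0%N) (@subset_refl _ M)
    (length_ge0 Mi (@subset_refl _ M)) (Mpd w 0%N)).
  by move=> wM; apply: nwa; apply: Mpd; apply: wM.
have xsub x : m x -> pd M (w * x) j `<=` pd M w j.+1.
  move=> mx; apply: (pd_min _ _ _ (pdi _ _) (Mpd _ _)) => a ma; rewrite -mulrA; apply: pd_mem.
  exact: ideal_mul_mem.
have ex : exists n, `[< exists2 x, m x & length_ge M (pd M (w * x) j) n >].
  by exists 0%N; apply/asboolP; exists 0 => //; apply: length_ge0.
have ub n : `[< exists2 x, m x & length_ge M (pd M (w * x) j) n >] -> (n <= j.+1)%N.
  by move/asboolP => [x mx h]; apply: le; apply: length_ge_sub h => //; apply: xsub.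
case: (ex_maxnP ex ub) => n0 /asboolP[x mx hx] n0max.
have [full|nfull] := pselect (pd M w j.+1 `<=` pd M (w * x) j); first by exists x.
(* M + w x m^j is strictly inside M + w m^(j+1), so its length over M is at most j and the induction
   hypothesis applies to w x. *)
have [y0 my0 good0] : exists2 y, m y & pd M (w * x) j `<=` pd M (w * x * y) j.-1.
  apply: IH => q hq; rewrite -ltnS; apply: le.
  exact: length_ge_proper Mi (pdi _ _) (Mpd _ _) hq (xsub _ mx) nfull.
(* Here w x m^j lies modulo M in w x y m^(j-1), hence in w y m^j; a strict inclusion would exceed
   the maximal length n0. *)
have good_sub y : m y -> pd M (w * x) j `<=` pd M (w * x * y) j.-1 ->
    pd M (w * y) j `<=` pd M (w * x) j.
  move=> my good; apply: contrapT => nsub.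
  suff : (n0.+1 <= n0)%N by rewrite ltnn.
  apply: n0max; apply/asboolP; exists y => //.
  apply: (length_ge_proper Mi (pdi _ _) (Mpd _ _) hx _ nsub).
  apply: (subset_trans good); apply: (pd_min _ _ _ (pdi _ _) (Mpd _ _)) => t mt.
  have xt : ideal_pow m j (x * t) by apply: mstep.
  have -> : w * x * y * t = w * y * (x * t) by ring.
  exact: pd_mem.
exfalso; apply: nfull; apply: (pd_min _ _ _ (pdi _ _) (Mpd _ _)) => a.
have Li : is_ideal [set a | pd M (w * x) j (w * a)].
  rewrite is_idealE; apply/is_submodP; split=> [|u v z Pv Pz] /=.
    by rewrite mulr0; apply: (@submod0 R R^o _ (pdi _ _)).
  rewrite mulrDr -[u *: v]/(u * v) mulrCA.
  exact: (@submodP R R^o _ (pdi _ _)).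
move: a; apply: (ideal_mul_min Li) => z a mz ma /=.
have [c nc good1] := perturb_generic Mi mz good0.
have [b bc] := local_unit loc nc.
have h0 := good_sub _ my0 good0.
have h1 : pd M (w * (y0 + c * z)) j `<=` pd M (w * x) j.
  apply: good_sub good1; apply: (@submodD R R^o _ mi) => //; exact: idealM.
have -> : w * (z * a) = b * (w * (y0 + c * z) * a - w * y0 * a).
  by rewrite -[w * (z * a)]mul1r -bc; ring.
apply: (idealM _ (pdi _ _)); apply: (@submodB R R^o _ (pdi _ _)).
  by apply: h1; apply: pd_mem.
by apply: h0; apply: pd_mem.
Qed.

Lemma linear_polynomial_step (P : {poly rat}) n :
  size P = 2 -> P.[n.+1%:R] = P.[n%:R] + lead_coef P.
Proof.
move=> P2; rewrite !horner_coef lead_coefE P2 !big_ord_recr !big_ord0 /=.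
by rewrite !expr0 !expr1 !mulr1 -natr1 mulrDr mulr1 !addrA.
Qed.

(** Powers of m inherit faithfulness from an ideal J inside m; x is then regular as soon as x R
    contains such a power. *)
Lemma max_pow_faithful J n a : is_ideal J -> J `<=` m ->
  (forall r, (forall t, J t -> r * t = 0) -> r = 0) ->
  (forall t, ideal_pow m n t -> a * t = 0) -> a = 0.
Proof.
move=> Ji Jm Jf; elim: n a => [|n IH] a an; first by rewrite -[a]mulr1 an.
apply: Jf => t /Jm mt; apply: IH => u mu.
by rewrite -mulrA; apply: an; apply: ideal_mul_mem.
Qed.

(** The Hilbert polynomial has slope e, so m^n/x m^n, a quotient of m^n/m^(n+1), has length at most
    e, and m/x m^n at most e + r with r the length of m/m^n. The chain x m^n, x m, m^2, m
    contributes at least r, then 1 if m^2 is not x m, then e, which is one too many. *)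
Lemma minimal_multiplicity_square J : is_ideal J -> J `<=` m ->
  (forall r, (forall t, J t -> r * t = 0) -> r = 0) ->
  minimal_multiplicity m ->
  exists2 x, m x & ideal_pow m 2 `<=` ideal_scale x m.
Proof.
move=> Ji Jm Jf [e [egen [P [P2 Plead [N hP]]]]].
have quot n : (N <= n)%N -> exists l,
    [/\ length_ge (ideal_pow m n.+1) setT l, length_le (ideal_pow m n.+1) setT l &
        P.[n%:R] = l%:R].
  by move=> Nn; have [l [/length_quotientE[ge le] el]] := hP n Nn; exists l.
have step n : (N <= n)%N -> length_le (ideal_pow m n.+2) (ideal_pow m n.+1) e.
  move=> Nn p hp; have [l [ge _ el]] := quot n Nn.
  have [l' [_ le' el']] := quot n.+1 (leqW Nn).
  have : l' = (l + e)%N.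
    apply/eqP; rewrite -(Num.Theory.eqr_nat rat) -el' (linear_polynomial_step _ P2).
    by rewrite el Plead divr1 natrD.
  move=> el''; have := le' _ (length_ge_add hp ge (@ideal_pow_sub _) (fun _ _ => I)).
  by rewrite el'' addnC leq_add2l.
(* Large enough for the Hilbert polynomial and, being at least e, for the length bound in
   [eakin_sathaye] at degree n + 1. *)
pose n := (N + e).+1.
have le1 := step (N + e)%N (leq_addr _ _); rewrite -/n in le1.
have le2 : length_le (ideal_pow m n.+2) (ideal_pow m n.+1) e.
  by apply: step; rewrite /n leqW // leq_addr.
have [x mx hx] : exists2 y, m y &
    pd (ideal_pow m n.+2) 1 n.+1 `<=` pd (ideal_pow m n.+2) (1 * y) n.
  apply: eakin_sathaye => // p hp; apply: (@leq_trans e).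
    apply: le2; apply: length_ge_sub hp => // _ [b [t [/ideal_pow_sub mb mt ->]]].
    by rewrite scale1r; apply: (@submodD R R^o _ (mn _)).
  by rewrite /n leqW // leqW // leq_addl.
have red : ideal_pow m n.+1 `<=` ideal_scale x (ideal_pow m n).
  apply: nakayama_max => [//||a ma]; first exact: is_ideal_scale.
  have [|b [t [mb mt ->]]] := hx a.
    exists 0, a; split=> //; first exact: (@submod0 R R^o _ (mn n.+2)).
    by rewrite scale1r add0r.
  by exists b => //; rewrite addrC addKr mul1r; exists t.
have xreg : GRing.lreg x.
  apply: lregP => a xa; apply: (max_pow_faithful (n := n.+1) Ji Jm Jf) => t.
  by move=> /red[u _ <-]; rewrite mulrA [a * x]mulrC xa mul0r.
have scale_sub I' : is_ideal I' -> ideal_scale x I' `<=` I'.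
  by move=> I'i _ [a Ia <-]; apply: idealM.
have nm : ideal_pow m n `<=` m.
  rewrite /n; elim: (N + e)%N => [|i IH]; first by rewrite ideal_pow1.
  by move=> a /ideal_pow_sub/IH.
have [r [ger ler]] : exists r, length_ge (ideal_pow m n) m r /\ length_le (ideal_pow m n) m r.
  have [l [_ le _]] := quot (N + e)%N (leq_addr _ _).
  by apply: (length_sup (mn n) nm); apply: length_le_sub le.
exists x => //; apply: contrapT => nsub.
have xmm : ideal_scale x m `<=` ideal_pow m 2.
  move=> _ [a ma <-]; apply: (ideal_mul_mem (J := ideal_pow m 1)) => //.
  by rewrite ideal_pow1.
have xmi : is_ideal (ideal_scale x m) by apply: is_ideal_scale.
have ge1 : length_ge (ideal_scale x m) (ideal_pow m 2) 1.
  exact: (length_ge_proper xmi (mn 2) (@subset_refl _ _)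
    (length_ge0 xmi (@subset_refl _ _)) xmm nsub).
have m2m : ideal_pow m 2 `<=` m by move=> a /ideal_pow_sub; rewrite ideal_pow1.
have ge2 := length_ge_add ge1 (length_generators egen) xmm m2m.
have xnm : ideal_scale x (ideal_pow m n) `<=` ideal_scale x m.
  by move=> _ [a /nm ma <-]; exists a.
have ge3 := length_ge_add (length_ge_scale xreg ger) ge2 xnm (scale_sub _ mi).
have le3 : length_le (ideal_scale x (ideal_pow m n)) m (e + r).
  apply: (length_le_add (mn n) mi _ ler (scale_sub _ (mn n)) nm).
  exact: length_le_sub le1.
by have := le3 _ ge3; rewrite addnC leq_add2r addnC addn1 ltnn.
Qed.

End Infinite.

End Multiplicity.

Theorem mainTheorem1 (R : comNzRingType) (m : set R) (k : fieldType)
    (pi : {rmorphism R -> k}) (d : nat)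
    (d_ge1 : (1 <= d)%N)
    (R_CM : CM_local m pi d)
    (R_nonGor : ~ gorenstein_local m pi)
    (k_infinite : infinite_set [set: k])
    (I : set R) (I_can : canonical_ideal m pi d I) :
  (~ maximal_canonical_ideal m pi d I ->
     (forall T : set R, canonical_ideal m pi d T -> I `<` T ->
        exists x : R,
          [/\ GRing.lreg x, m x, I = ideal_scale x T &
              principal x = colon I T]) /\
     I `<=` ideal_pow m 2)
  /\
  (forall (K : set R) (x : R), canonical_ideal m pi d K -> K x -> GRing.lreg x ->
     (exists y : R, I y /\ ideal_scale y K = ideal_scale x I) /\
     (forall y : R, I y -> ideal_scale y K = ideal_scale x I ->
        (is_reduction (principal x) K <-> is_reduction (principal y) I)))
  /\
  (d = 1%N ->
     (forall t : nat, reduction_number m t ->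
        forall J : set R, maximal_canonical_ideal m pi d J ->
          ~ J `<=` ideal_pow m t.+1) /\
     (minimal_multiplicity m ->
        forall J : set R, canonical_ideal m pi d J ->
          (~ maximal_canonical_ideal m pi d J <-> J `<=` ideal_pow m 2))).
Proof.
have loc : noetherian_local m pi by case: R_CM.
have proper J : canonical_ideal m pi d J -> J `<=` m.
  move=> Jc; apply: (proper_ideal_sub loc (canonical_is_ideal Jc)) => J1.
  apply: R_nonGor; apply: (canonical_unit_ideal_gorenstein (d := d) loc).
  by rewrite -(ideal_one (canonical_is_ideal Jc) J1).
have square J : canonical_ideal m pi d J -> ~ maximal_canonical_ideal m pi d J ->
    J `<=` ideal_pow m 2.
  move=> Jc nmax; have [T [Tc [JT nTJ]]] : exists T, canonical_ideal m pi d T /\ J `<` T.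
    apply: contrapT => h; apply: nmax; split=> // T Tc JT.
    apply/seteqP; split=> //; apply: contrapT => nTJ; apply: h.
    by exists T.
  have [x [_ mx -> _]] := canonical_contained loc k_infinite Jc Tc (conj JT nTJ).
  move=> _ [t Tt <-]; apply: (ideal_mul_mem (J := ideal_pow m 1)) => //.
  by rewrite (ideal_pow1 loc); apply: (proper T).
split; last split.
- move=> nmax; split; last exact: square.
  move=> T Tc IT; exact: (canonical_contained loc k_infinite I_can Tc IT).
- move=> K x Kc Kx xreg; split.
    exact: (canonical_transfer loc k_infinite I_can Kc Kx).
  move=> y Iy; exact: (canonical_reduction loc k_infinite I_can Kc Kx Iy xreg).
move=> _; split=> [t [[x mx ex] _] J [Jc Jmax] Jm|mult J Jc].
  (* By the choice of x, m^(t+1) = x m^t lies in xR. *)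
  apply: (not_maximal_of_divisible loc k_infinite mx Jc); last by split.
  by move=> a /Jm; rewrite ex => -[b _ <-]; exists b.
split=> [|J2]; first exact: square.
have [x mx m2] := minimal_multiplicity_square loc k_infinite (canonical_is_ideal Jc)
  (proper J Jc) (canonical_faithful loc k_infinite Jc) mult.
apply: (not_maximal_of_divisible loc k_infinite mx Jc) => a /J2/m2[b _ <-].
by exists b.
Qed.
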